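(* Let $u^N(t,\frac xN)$ be the solution on $[0,T]\times\frac1N\mathbb T_N^n$ of $$\partial_t u^N=\Delta^N\varphi(u^N)+Kf(u^N),$$ satisfying $u_-\le u^N(t,\frac xN)\le u_+$ for all $t\in[0,T]$, $x\in\mathbb T^n_N$. Let $\sigma\in(0,1)$ be the Nash exponent. Then there is a constant $C=C(n,c_\pm,T,\sigma,\|f\|_\infty,\|\varphi''\|_\infty,u_\pm)$ (independent of $N$ and $K$) such that $$|\tilde u^N|^*_{1+\sigma}\le C\big(K^{1+\frac1\sigma}+1\big).$$ In particular, for every $|e|=1$, $$|\nabla^N_eu^N(t,\tfrac xN)|\le C\,t^{-\frac12}\big(K^{\frac1\sigma}+1\big),\qquad t\in(0,T],\ x\in\mathbb T_N^n,$$ and the $\sigma$-Hölder seminorm of $\nabla^N_eu^N$ has at most the singularity $t^{-\frac{1+\sigma}2}$ near $t=0$, in the sense that $[\tilde u^N]^*_{1+\sigma}\le C(K^{1+\frac1\sigma}+1)$.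
   Context: Lattice notation. $N\in\mathbb N$, $T>0$ fixed, $\mathbb T^n=\mathbb R^n/\mathbb Z^n$, $\mathbb T_N^n=(\mathbb Z/N\mathbb Z)^n$; functions on $\frac1N\mathbb T^n_N\subset\mathbb T^n$ are written $u(\frac xN)$. For $e\in\mathbb Z^n$, $|e|=1$: $\nabla_e^Nu(\frac xN)=N(u(\frac{x+e}N)-u(\frac xN))$. ''$e>0$'' means that the nonzero component of $e$ is $1$. $\Delta^Nu(\frac xN)=N^2\sum_{|e|=1}(u(\frac{x+e}N)-u(\frac xN))$. Quasilinear setting. $\varphi\in C^5(\mathbb R)$ strictly increasing, $f\in C^1(\mathbb R)$ with $u f(u)<0$ for $|u|$ large, $K>0$. $u_-<u_+$ are constants; $c_-=\min_{[u_-,u_+]}\varphi'$, $c_+=\max_{[u_-,u_+]}\varphi'$, with $c_->0$. For a function $h$ on $\mathbb R$, $\|h\|_\infty=\sup_{[u_-,u_+]}|h|$. Nash exponent. $\sigma\in(0,1)$ denotes a fixed exponent for which there is $C=C(n,c_\pm)$ such that for every $N$, every $a(t)=\{a_{x,e}(t)\}_{x\in\mathbb Z^n,|e|=1}$ continuous in $t$ with $a_{x,e}=a_{x+e,-e}$ and $c_-\le a_{x,e}\le c_+$, and every bounded $u_0$ on $\frac1N\mathbb Z^n$, the bounded solution of $\partial_tu(t,\frac xN)=N^2\sum_{|e|=1}a_{x,e}(t)\{u(t,\frac{x+e}N)-u(t,\frac xN)\}$ on $\frac1N\mathbb Z^n$ with $u(0)=u_0$ satisfies $|u(t,\frac xN)-u(s,\frac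 yN)|\le C\|u_0\|_\infty\big(\frac{|t-s|^{1/2}\vee|\frac xN-\frac yN|}{(t\wedge s)^{1/2}}\big)^\sigma$ for all $t,s>0$, $x,y\in\mathbb Z^n$. Such an exponent exists by the Nash continuity estimate. Norms. $\Omega=[0,T]\times\mathbb T^n$, $\Omega_N=[0,T]\times\frac1N\mathbb T_N^n$. For $X=(t,z)$, $Y=(s,y)$: $|X-Y|=\max\{|t-s|^{1/2},|z-y|\}$ with $|z-y|$ the Euclidean distance on the torus, and $d(X)=\sqrt t$. For $F$ on $\Omega$, $\nabla^N_eF(t,z)=N(F(t,z+\frac eN)-F(t,z))$, and $|\nabla^NF(X)-\nabla^NF(Y)|=\max_{|e|=1,e>0}|\nabla^N_eF(X)-\nabla_e^NF(Y)|$. The polylinear interpolation in space of a function $u$ on $\Omega_N$ is $\tilde u(t,z)=\sum_{v\in\{0,1\}^n}\prod_{i=1}^n\vartheta(v_i,z_i)\,u(t,\frac{[Nz]+v}N)$, where $\vartheta(1,b)=\{Nb\}$, $\vartheta(0,b)=1-\{Nb\}$ and $[\cdot],\{\cdot\}$ are (componentwise) integer and fractional parts. For $\alpha\in(0,1)$ put $[F]^*_{1+\alpha}=\sup_{X\ne Y\in\Omega}(d(X)\wedge d(Y))^{1+\alpha}\frac{|\nabla^NF(X)-\nabla^NF(Y)|}{|X-Y|^\alpha}$; $\langle u\rangle^{*,N}_{1+\alpha}=\sup(d(X)\wedge d(Y))^{1+\alpha}\frac{|u(X)-u(Y)|}{|t-s|^{(1+\alpha)/2}}$, supremum over $X=(t,\frac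 xN)\neq Y=(s,\frac xN)$ in $\Omega_N$ with the same spatial coordinate; $|\nabla^NF|_0^{(1)}=\max_{|e|=1,e>0}\sup_{X\in\Omega}d(X)|\nabla^N_eF(X)|$; and $|\tilde u^N|^*_{1+\alpha}=[\tilde u^N]^*_{1+\alpha}+\langle u^N\rangle^{*,N}_{1+\alpha}+|\nabla^N\tilde u^N|^{(1)}_0$. *)

(* Defs.v *)
From HB Require Import structures.
From mathcomp Require Import all_boot all_order all_algebra.
From mathcomp Require Import all_classical all_reals all_analysis.

Set Implicit Arguments.
Unset Strict Implicit.
Unset Printing Implicit Defensive.

Import Order.TTheory GRing.Theory Num.Theory.
Import numFieldNormedType.Exports.

Local Open Scope classical_set_scope.
Local Open Scope ring_scope.

(* A point of the torus T^n = R^n / Z^n is given by a representative in R^n,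
   and a function on T^n by a function of the representative.  The discrete
   torus (Z/NZ)^n is a genuine finite group; 'I_N.-1.+1 is Z/NZ for every
   N >= 1, including N = 1 (contrary to 'Z_N). *)
Notation lattice_torus N n := 'rV['I_N.-1.+1]_n (only parsing).

(* The class of x in Z^n modulo N; the trivial group Z/1Z has no ring
   structure, hence  inZp 1 *~ k  instead of  k%:~R. *)
Definition lclass (N n : nat) (x : 'rV[int]_n) : lattice_torus N n :=
  \row_i ((inZp 1 : 'I_N.-1.+1) *~ x 0 i).

(* The e in Z^n with |e| = 1 are indexed by a coordinate and a sign;
   e > 0 means that the sign is  true. *)
Definition dir (n : nat) : finType := ('I_n * bool)%type.

Definition evec (n : nat) (e : dir n) : 'rV[int]_n :=
  if e.2 then delta_mx 0 e.1 else - delta_mx 0 e.1.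

Definition dopp (n : nat) (e : dir n) : dir n := (e.1, ~~ e.2).

Section Norms.
Variables (R : realType) (n : nat).

Definition ivec (x : 'rV[int]_n) : 'rV[R]_n := map_mx intr x.

(* The library norm on 'rV[R]_n is the sup norm. *)
Definition euclid (v : 'rV[R]_n) : R := Num.sqrt (\sum_i v 0 i ^+ 2).

Definition torus_dist (z y : 'rV[R]_n) : R :=
  inf [set euclid (z - y + ivec k) | k in [set: 'rV[int]_n]].

Definition torus_eq (z y : 'rV[R]_n) : Prop :=
  exists k : 'rV[int]_n, z = y + ivec k.

Definition supnorm (a b : R) (h : R -> R) : R :=
  sup [set `|h r| | r in `[a, b]].

Definition is_min_on (a b : R) (h : R -> R) (m : R) : Prop :=
  (exists2 r, a <= r <= b & h r = m) /\ (forall r, a <= r <= b -> m <= h r).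

Definition is_max_on (a b : R) (h : R -> R) (m : R) : Prop :=
  (exists2 r, a <= r <= b & h r = m) /\ (forall r, a <= r <= b -> h r <= m).

Definition Ck (k : nat) (h : R -> R) : Prop :=
  (forall j, (j < k)%N -> forall r, derivable (derive1n j h) r 1)
  /\ continuous (derive1n k h).

End Norms.

Section Lattice.
Variables (R : realType) (n N : nat).

Definition lgrad (e : dir n) (u : lattice_torus N n -> R)
    (x : lattice_torus N n) : R :=
  N%:R * (u (x + lclass N (evec e)) - u x).

Definition laplace (u : lattice_torus N n -> R) (x : lattice_torus N n) : R :=
  N%:R ^+ 2 * \sum_(e : dir n) (u (x + lclass N (evec e)) - u x).

(* At the end points of [0, T] the one-sided derivatives then follow from
   the continuity of the right-hand side. *)
Definition is_solution (T K : R) (phi f : R -> R)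
    (u : R -> lattice_torus N n -> R) : Prop :=
  (forall x, {within `[0, T], continuous (fun t => u t x)}) /\
  (forall (t : R) x, 0 < t < T ->
    is_derive t 1 (fun s => u s x)
      (laplace (fun y => phi (u t y)) x + K * f (u t x))).

Definition fracpart (r : R) : R := r - (Num.floor r)%:~R.

Definition vartheta (b : bool) (r : R) : R :=
  if b then fracpart (N%:R * r) else 1 - fracpart (N%:R * r).

Definition cell (z : 'rV[R]_n) (v : {ffun 'I_n -> bool}) : 'rV[int]_n :=
  \row_i (Num.floor (N%:R * z 0 i) + (v i : nat)%:Z).

Definition interp (u : R -> lattice_torus N n -> R) (t : R) (z : 'rV[R]_n) : R :=
  \sum_(v : {ffun 'I_n -> bool})
    (\prod_(i < n) vartheta (v i) (z 0 i)) * u t (lclass N (cell z v)).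

Definition cgrad (e : dir n) (F : R -> 'rV[R]_n -> R) (X : R * 'rV[R]_n) : R :=
  N%:R * (F X.1 (X.2 + N%:R^-1 *: ivec R (evec e)) - F X.1 X.2).

Definition Omega (T : R) : set (R * 'rV[R]_n) := [set X | 0 <= X.1 <= T].

Definition same_point (X Y : R * 'rV[R]_n) : Prop :=
  X.1 = Y.1 /\ torus_eq X.2 Y.2.

Definition pdist (X Y : R * 'rV[R]_n) : R :=
  Num.max (Num.sqrt `|X.1 - Y.1|) (torus_dist X.2 Y.2).

Definition grad_diff (F : R -> 'rV[R]_n -> R) (X Y : R * 'rV[R]_n) : R :=
  \big[Num.max/0]_(i < n) `|cgrad (i, true) F X - cgrad (i, true) F Y|.

Definition holder_grad (T alpha : R) (F : R -> 'rV[R]_n -> R) : \bar R :=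
  ereal_sup [set q | exists X Y,
    [/\ Omega T X, Omega T Y, ~ same_point X Y &
        q = (Num.min (Num.sqrt X.1) (Num.sqrt Y.1) `^ (1 + alpha)
             * (grad_diff F X Y / pdist X Y `^ alpha))%:E]].

Definition holder_time (T alpha : R) (u : R -> lattice_torus N n -> R) : \bar R :=
  ereal_sup [set q | exists (t s : R) (x : lattice_torus N n),
    [/\ 0 <= t <= T, 0 <= s <= T, t != s &
        q = (Num.min (Num.sqrt t) (Num.sqrt s) `^ (1 + alpha)
             * (`|u t x - u s x| / `|t - s| `^ ((1 + alpha) / 2)))%:E]].

Definition grad_sup (T : R) (F : R -> 'rV[R]_n -> R) : \bar R :=
  \big[maxe/0%E]_(i < n)
    ereal_sup [set (Num.sqrt X.1 * `|cgrad (i, true) F X|)%:E | X in Omega T].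

Definition star_norm (T alpha : R) (u : R -> lattice_torus N n -> R) : \bar R :=
  (holder_grad T alpha (interp u) + holder_time T alpha u
   + grad_sup T (interp u))%E.

End Lattice.

Section Periodicity.
Variables (R : realType) (n N : nat).

Lemma lclassD (x y : 'rV[int]_n) :
  lclass N (x + y) = lclass N x + lclass N y.
Proof. by apply/rowP => i; rewrite !mxE mulrzDr. Qed.

Lemma lclass_eq0 (k : 'rV[int]_n) : (0 < N)%N -> lclass N (k *+ N) = 0.
Proof.
move=> N0; apply/rowP => i; rewrite !mxE mulmxnE -mulr_natr mulrC mulrzA.
suff -> : (inZp 1 : 'I_N.-1.+1) *~ N%:R = 0 by rewrite mul0rz.
rewrite natz; apply: val_inj.
by rewrite -[_ *~ _]/(_ *+ N) Zp_mulrn /= prednK// modnMl.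
Qed.

Lemma interp_periodic (u : R -> lattice_torus N n -> R) t z k :
  (0 < N)%N -> interp u t (z + ivec R k) = interp u t z.
Proof.
move=> N0; have kN i : ((k *+ N) 0 i)%:~R = N%:R * (k 0 i)%:~R :> R.
  by rewrite mulmxnE -(mulr_natl (k 0 i)) intrM [in LHS]natz.
have zE i : N%:R * (z + ivec R k) 0 i = N%:R * z 0 i + ((k *+ N) 0 i)%:~R.
  by rewrite kN !mxE mulrDr.
have flE i : Num.floor (N%:R * (z + ivec R k) 0 i) =
    Num.floor (N%:R * z 0 i) + (k *+ N) 0 i.
  by rewrite zE floorDrz ?intrKfloor// intr_int.
apply: eq_bigr => v _; congr (_ * u t _); last first.
  rewrite -[RHS]addr0 -(lclass_eq0 k N0) -lclassD; congr (lclass N _).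
  by apply/rowP => i; rewrite [LHS]mxE flE [RHS]mxE [cell _ _ _ _ _]mxE addrAC.
apply: eq_bigr => i _; rewrite /vartheta.
suff -> : fracpart (N%:R * (z + ivec R k) 0 i) = fracpart (N%:R * z 0 i) by [].
by rewrite /fracpart flE zE intrD opprD addrACA subrr addr0.
Qed.

End Periodicity.

Section Nash.
Variables (R : realType) (n : nat).

Definition coefficients (cm cp : R) (a : R -> 'rV[int]_n -> dir n -> R) : Prop :=
  [/\ forall x e, {within `[0, +oo[, continuous (fun t => a t x e)},
      forall (t : R) x e, 0 <= t -> a t x e = a t (x + evec e) (dopp e) &
      forall (t : R) x e, 0 <= t -> cm <= a t x e <= cp].

Definition bounded_solution (N : nat) (a : R -> 'rV[int]_n -> dir n -> R)
    (u0 : 'rV[int]_n -> R) (u : R -> 'rV[int]_n -> R) : Prop :=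
  [/\ exists M : R, forall (t : R) x, 0 <= t -> `|u t x| <= M,
      forall x, {within `[0, +oo[, continuous (fun t => u t x)},
      forall x, u 0 x = u0 x &
      forall (t : R) x, 0 < t -> is_derive t 1 (fun s => u s x)
        (N%:R ^+ 2 * \sum_(e : dir n) a t x e * (u t (x + evec e) - u t x))].

Definition nash_exponent (cm cp sigma : R) : Prop :=
  0 < sigma < 1 /\
  exists C : R, forall (N : nat) (a : R -> 'rV[int]_n -> dir n -> R)
    (u0 : 'rV[int]_n -> R) (u : R -> 'rV[int]_n -> R),
    (0 < N)%N -> coefficients cm cp a ->
    (exists M : R, forall x, `|u0 x| <= M) ->
    bounded_solution N a u0 u ->
    forall (t s : R) (x y : 'rV[int]_n), 0 < t -> 0 < s ->
      `|u t x - u s y| <=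
        C * sup [set `|u0 w| | w in [set: 'rV[int]_n]] *
        (Num.max (Num.sqrt `|t - s|) (euclid (N%:R^-1 *: ivec R (x - y)))
         / Num.sqrt (Num.min t s)) `^ sigma.

End Nash.

(* Main.v *)
Require Import Defs.
From HB Require Import structures.
From mathcomp Require Import all_boot all_order all_algebra.
From mathcomp Require Import all_classical all_reals all_analysis.
From mathcomp Require Import lra ring zify.

Import Order.TTheory GRing.Theory Num.Theory.
Import numFieldNormedType.Exports.

Local Open Scope classical_set_scope.
Local Open Scope ring_scope.

(** All bounds for the heat semigroup of the discrete torus come from the maximum
    principle.  If [v] is a caloric function, [v ^ 2 + t * |grad v| ^ 2] is a
    subsolution (Bernstein); comparing it with the square of a supersolution that
    grows like the squared distance to a base point, and iterating, one bounds the
    derivatives of the heat flow at the base point of a function that is controlled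
    by a power of the distance to that point.

    Let [h = min (t0, 1 / K)].  The Nash estimate for the homogeneous equation with
    the coefficients of [u], on a window shorter than [h], shows that [u] is Hölder
    continuous with exponent [sigma / 2] at scale [sqrt h].  Put [a = phi' (u (t0, x0))].
    Then [u] solves the heat equation with constant coefficient [a] up to the source
    and the Laplacian of [phi (u (s, y)) - phi (u (s, x0)) - a * (u (s, y) - u (s, x0))],
    which is at most [|phi''|] times the oscillation of [u] times
    [|u (s, y) - u (s, x0)|].  With Duhamel's formula on a time interval [eps * h] this
    bounds the gradient by [C / sqrt h] plus a small multiple of itself.  Once the
    gradient is bounded the remainder is of order [1 + sigma], and the same formula
    bounds two and three derivatives of the heat flow started from [u t]; this is the
    Hölder continuity of the gradient.  The powers of [K] come from
    [t / h <= (1 + T) * max (1, K)]. *)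

(* The library has a lemma [dopp] about differentials. *)
Local Notation dopp := Defs.dopp.

(** * Functions of time *)

(** The Nash estimate concerns equations without source, and balancing it against the source costs
    half of the exponent. The loss is temporary. The linearization error is the oscillation from the
    base value times a spatial increment, that is a gradient; any positive power in the first factor
    makes the gradient absorbable over a short time. A bounded gradient gives oscillation of order
    one, of which order [sigma] is kept, and the error reaches order [1 + sigma]. Higher differences
    of [u t] need not be bounded uniformly in [N]. They are measured after a flow of length [tau],
    and their rate of blow-up as [tau] tends to 0 encodes the Hölder continuity of the gradient.
    Constants are uniform in [N] because the comparison level [theta] never falls below the squared
    mesh [N ^- 2]. *)

Section DiffOn.
Context {R : realType}.
Implicit Types (f g df dg : R -> R) (a b c t s : R).

(** Continuity on the closed interval with a derivative only inside is what the mean value theorem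
    asks for and what [is_solution] provides. Carrying [df] explicitly lets an evolution equation be
    stated as an instance. *)
Definition diff_on a b f df : Prop :=
  {within `[a, b], continuous f} /\
  (forall t, a < t < b -> is_derive t 1 f (df t)).

Lemma diff_on_ext a b f g df dg : f =1 g -> (forall t, a < t < b -> df t = dg t) ->
  diff_on a b f df -> diff_on a b g dg.
Proof.
move=> /funext -> e [cf d]; split=> // t tab; rewrite -e//; exact: d.
Qed.

Lemma diff_on_cst a b c : diff_on a b (fun=> c) (fun=> 0).
Proof. by split=> [|t _]; [move=> x; exact: cvg_cst|exact: is_derive_cst]. Qed.

Lemma diff_on_add a b f df g dg : diff_on a b f df -> diff_on a b g dg ->
  diff_on a b (fun t => f t + g t) (fun t => df t + dg t).
Proof.
move=> [cf d] [cg d']; split=> [x|t tab]; first by apply: continuousD; [exact: cf|exact: cg].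
by have := d t tab; have := d' t tab => ? ?; exact: is_deriveD.
Qed.

Lemma diff_on_mul a b f df g dg : diff_on a b f df -> diff_on a b g dg ->
  diff_on a b (fun t => f t * g t) (fun t => df t * g t + f t * dg t).
Proof.
move=> [cf d] [cg d']; split=> [x|t tab]; first by apply: continuousM; [exact: cf|exact: cg].
have := d t tab; have := d' t tab => ? ?.
have -> : df t * g t + f t * dg t = f t *: dg t + g t *: df t.
  by rewrite addrC mulrC [X in _ + X]mulrC mulrC.
exact: is_deriveM.
Qed.

Lemma diff_on_scale a b c f df : diff_on a b f df ->
  diff_on a b (fun t => c * f t) (fun t => c * df t).
Proof.
move=> h; apply: diff_on_ext (diff_on_mul a b _ _ _ _ (diff_on_cst a b c) h) => //.
by move=> t _; rewrite mul0r add0r.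
Qed.

Lemma diff_on_opp a b f df : diff_on a b f df ->
  diff_on a b (fun t => - f t) (fun t => - df t).
Proof.
move=> h; apply: diff_on_ext (diff_on_scale a b (-1) _ _ h) => [t|t _];
  by rewrite mulN1r.
Qed.

Lemma diff_on_sub a b f df g dg : diff_on a b f df -> diff_on a b g dg ->
  diff_on a b (fun t => f t - g t) (fun t => df t - dg t).
Proof. by move=> h /diff_on_opp; exact: diff_on_add. Qed.

Lemma diff_on_sum (I : Type) (r : seq I) (P : pred I) a b (f df : I -> R -> R) :
  (forall i, diff_on a b (f i) (df i)) ->
  diff_on a b (fun t => \sum_(i <- r | P i) f i t)
              (fun t => \sum_(i <- r | P i) df i t).
Proof.
move=> h; elim: r => [|i r IH].
  by apply: diff_on_ext (diff_on_cst a b 0) => [t|t _]; rewrite big_nil.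
case Pi: (P i); last by apply: diff_on_ext IH => [t|t _]; rewrite big_cons Pi.
by apply: diff_on_ext (diff_on_add a b _ _ _ _ (h i) IH) => [t|t _];
  rewrite big_cons Pi.
Qed.

Lemma within_continuousP (A : set R) f : {within A, continuous f} <->
  (forall t, A t -> forall e, 0 < e ->
     exists2 d, 0 < d & forall s, A s -> `|t - s| < d -> `|f t - f s| < e).
Proof.
rewrite subspace_continuousP; split=> h t At.
  move=> e e0; have /(@cvgrPdist_lt _ R^o) /(_ e e0) := h t At.
  move=> /nbhs_ballP[d /= d0 hd]; exists d => // s sA ts; exact: hd.
apply/(@cvgrPdist_lt _ R^o) => e e0.
have [d d0 hd] := h t At e e0.
by apply/nbhs_ballP; exists d => // s /= ts sA; exact: hd.
Qed.

Lemma within_continuous_comp (A B : set R) f (k : R -> R) :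
  (forall t, A t -> B (k t)) -> {within A, continuous k} ->
  {within B, continuous f} -> {within A, continuous (fun t => f (k t))}.
Proof.
move=> AB /within_continuousP ck /within_continuousP cf.
apply/within_continuousP => t At e e0.
have [d d0 hd] := cf (k t) (AB t At) e e0.
have [d' d'0 hd'] := ck t At d d0.
by exists d' => // s As ts; apply: hd; [exact: AB|exact: hd'].
Qed.

Lemma diff_on_sub_itv a b c d f df : a <= c -> d <= b ->
  diff_on a b f df -> diff_on c d f df.
Proof.
move=> ac db [cf df']; split=> [|t /andP[ct td]]; last first.
  by apply: df'; rewrite (le_lt_trans ac)// (lt_le_trans td).
apply: (within_continuous_comp _ _ f id) cf => [t /=|]; last by apply: continuous_subspaceT => x; exact: cvg_id.
rewrite !in_itv/= => /andP[ct td].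
by rewrite (le_trans ac)// (le_trans td).
Qed.

Lemma diff_on_affine a b c d f df k m :
  (forall t, a <= t <= b -> c <= k * t + m <= d) ->
  (forall t, a < t < b -> c < k * t + m < d) ->
  diff_on c d f df ->
  diff_on a b (fun t => f (k * t + m)) (fun t => k * df (k * t + m)).
Proof.
move=> h1 h2 [cf d1]; split=> [|t tab].
  apply: (within_continuous_comp _ `[c, d]%classic f (fun t => k * t + m)) cf.
    by move=> t; rewrite /= !in_itv/=; exact: h1.
  apply: continuous_subspaceT => x; apply: (@continuousD _ R^o).
    by apply: continuousM; [exact: cvg_cst|exact: cvg_id].
  exact: cvg_cst.
have dk : is_derive t 1 (fun t => k * t + m) k.
  have := @is_deriveD R R^o R^o _ _ t 1 _ _
    (is_deriveM (is_derive_cst k t 1) (is_derive_id t 1)) (is_derive_cst m t 1).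
  by rewrite scaler0 !addr0 /GRing.scale/= mulr1.
rewrite mulrC.
exact: (@is_derive1_comp R f (fun t => k * t + m) t _ _ (d1 _ (h2 t tab)) dk).
Qed.

(** Time reversal, for Duhamel's formula run backwards from the base time. *)
Lemma diff_on_comp_affine_neg a b f df m :
  diff_on a b f df ->
  diff_on (m - b) (m - a) (fun t => f (m - t)) (fun t => - df (m - t)).
Proof.
move=> h.
apply: (diff_on_ext _ _ (fun t => f (-1 * t + m)) _ (fun t => -1 * df (-1 * t + m))).
- by move=> t; rewrite mulN1r addrC.
- by move=> t _; rewrite !mulN1r [in X in X = _]addrC.
- apply: (diff_on_affine _ _ a b) h => t /andP[h1 h2]; apply/andP; split; lra.
Qed.

(** Both [g - f] and [g + f] are nondecreasing. The majorant is a function and not a constant, so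
    that exponential and power rates can be integrated. *)
Lemma mvt_le a b f df g dg : a <= b -> diff_on a b f df -> diff_on a b g dg ->
  (forall t, a < t < b -> `|df t| <= dg t) -> `|f b - f a| <= g b - g a.
Proof.
move=> ab hf hg h.
have key F dF : diff_on a b F dF -> (forall t, a < t < b -> 0 <= dF t) ->
    F a <= F b.
  move=> [cF dF'] dF0; move: ab; rewrite le_eqVlt => /predU1P[->//|ab].
  have D x : x \in `]a, b[%R -> is_derive x 1 F (dF x).
    by rewrite in_itv/=; exact: dF'.
  have [c /[1!in_itv]/= cab e] := MVT ab D cF.
  by rewrite -subr_ge0 e mulr_ge0 ?dF0// subr_ge0 ltW.
have h1 := key _ _ (diff_on_sub _ _ _ _ _ _ hg hf).
have h2 := key _ _ (diff_on_add _ _ _ _ _ _ hg hf).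
rewrite ler_norml; apply/andP; split.
  have : g a + f a <= g b + f b.
    by apply: h2 => t /h; rewrite ler_norml => /andP[]; lra.
  lra.
have : g a - f a <= g b - f b.
  by apply: h1 => t /h; rewrite ler_norml => /andP[]; lra.
lra.
Qed.

End DiffOn.

(** * Integration of power rates and the maximum principle *)

Section TimeEstimates.
Context {R : realType}.
Implicit Types (f g df dg : R -> R) (a b c t s : R).

Lemma derivable_diff_on a b f df :
  (forall t, a <= t <= b -> is_derive t 1 f (df t)) -> diff_on a b f df.
Proof.
move=> h; split=> [|t /andP[ta tb]]; last by apply: h; rewrite !ltW.
apply: derivable_within_continuous => t; rewrite in_itv/= => /h [].
by [].
Qed.

(** The bound is the integral of the rate, and [p] may be negative: numerator and denominator then
    change sign together. For [tau = 0] the primitive need not be differentiable at 0, so the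
    integral starts at a small [eta] and the continuity of [f] removes it. *)
Lemma powR_growth_bound f df (M tau k del p : R) :
  0 < k -> 0 <= tau -> 0 <= del -> 0 <= M -> (0 < tau) || (0 < p) -> p != 0 ->
  diff_on 0 del f df ->
  (forall s, 0 < s < del -> `|df s| <= M * (tau + k * s) `^ (p - 1)) ->
  `|f del - f 0| <= M * (((tau + k * del) `^ p - tau `^ p) / (k * p)).
Proof.
move=> k0 tau0 del0 M0 taup p0 hf hdf.
pose g s := M / (k * p) * (tau + k * s) `^ p.
pose dg s := M * (tau + k * s) `^ (p - 1).
have hg eta : 0 <= eta -> 0 < tau + k * eta -> diff_on eta del g dg.
  move=> eta0 te; apply: derivable_diff_on => t /andP[et _].
  have tt : 0 < tau + k * t.
    by rewrite (lt_le_trans te)// lerD2l ler_pM2l.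
  have dk : is_derive t 1 (fun t => tau + k * t) k.
    have := @is_deriveD R R^o R^o _ _ t 1 _ _
      (is_derive_cst tau t 1) (is_deriveM (is_derive_cst k t 1) (is_derive_id t 1)).
    by rewrite scaler0 !addr0 add0r /GRing.scale/= mulr1.
  have d1 := @is_derive1_comp R _ _ t _ _ (is_derive1_powR p tt) dk.
  have := @is_deriveM R R^o _ _ t 1 _ _ (is_derive_cst (M / (k * p)) t 1) d1.
  rewrite scaler0 addr0 /GRing.scale/= => hh.
  rewrite /dg; suff -> : M * (tau + k * t) `^ (p - 1) =
    M / (k * p) * (p * (tau + k * t) `^ (p - 1) * k) by exact: hh.
  by field; rewrite p0 gt_eqF.
have E x y : g x - g y = M * (((tau + k * x) `^ p - (tau + k * y) `^ p) / (k * p)).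
  by rewrite /g; field; rewrite p0 gt_eqF.
have main eta : 0 <= eta <= del -> 0 < tau + k * eta ->
    `|f del - f eta| <= M * (((tau + k * del) `^ p - (tau + k * eta) `^ p) / (k * p)).
  move=> /andP[eta0 ed] te; rewrite -E.
  apply: (mvt_le _ _ f df g dg ed); last 2 first.
  - exact: hg.
  - by move=> t /andP[t1 t2]; apply: hdf; rewrite (le_lt_trans eta0).
  exact: diff_on_sub_itv hf.
move: tau0; rewrite le_eqVlt => /predU1P[t0|tau0]; last first.
  by have := main 0; rewrite mulr0 addr0; apply => //; rewrite lexx.
move: del0; rewrite le_eqVlt => /predU1P[<-|del0].
  by rewrite mulr0 addr0 !subrr normr0 mul0r mulr0.
have pp : 0 < p by move: taup; rewrite -t0 ltxx.
rewrite -t0 add0r powR0// subr0; apply/ler_addgt0Pr => e e0.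
have [/within_continuousP /(_ 0) cf _] := hf.
have [|d d0 hd] := cf _ e e0; first by rewrite /= in_itv/= lexx ltW.
pose eta := Num.min del (d / 2).
have eta0 : 0 < eta by rewrite lt_min del0 divr_gt0.
have ed : eta <= del by rewrite ge_min lexx.
have h1 : `|f 0 - f eta| < e.
  apply: hd; first by rewrite /= in_itv/= ed ltW.
  rewrite sub0r normrN gtr0_norm//.
  by rewrite (@le_lt_trans _ _ (d / 2))// ?ge_min ?lexx ?orbT//; lra.
have := main eta; rewrite -t0 !add0r ed (ltW eta0) mulr_gt0// => /(_ isT isT) h2.
have h3 : M * (((k * del) `^ p - (k * eta) `^ p) / (k * p)) <=
   M * ((k * del) `^ p / (k * p)).
  rewrite ler_wpM2l// ler_wpM2r ?invr_ge0 ?mulr_ge0 ?ltW//.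
  by rewrite ltrBlDr ltrDl powR_gt0// mulr_gt0.
have := ler_normD (f del - f eta) (f eta - f 0).
rewrite addrA subrK (distrC (f eta)); lra.
Qed.

Lemma is_deriveP f t d : is_derive t 1 f d <->
  (forall e, 0 < e -> exists2 del, 0 < del &
    forall s, `|s - t| < del -> `|f s - f t - d * (s - t)| <= e * `|s - t|).
Proof.
split=> [[df <-] e e0|h].
  have /cvgrPdist_le /(_ e e0) := df.
  move=> /nbhs_ballP[del /= del0 hdel]; exists del => // s st.
  have [->|st0] := eqVneq s t; first by rewrite !subrr mulr0 subr0 normr0 mulr0.
  have sn : `|s - t| != 0 by rewrite normr_eq0 subr_eq0.
  have hb : ball (0 : R) del (s - t) by rewrite /ball/= sub0r normrN.
  have st1 : s - t != 0 by rewrite subr_eq0.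
  have hh : `|'D_1 f t - (s - t)^-1 * (f s - f t)| <= e.
    have := hdel _ hb st1.
    by rewrite /= {2}/GRing.scale/= [X in X + t](_ : _ = s - t) ?subrK//
      /GRing.scale/= mulr1.
  have : `|'D_1 f t - (s - t)^-1 * (f s - f t)| * `|s - t| <= e * `|s - t|.
    by rewrite ler_wpM2r.
  rewrite -normrM mulrBl mulrAC mulVf ?subr_eq0// mul1r distrC.
  by rewrite mulrC.
have cv : h^-1 *: ((f \o shift t) (h *: 1) - f t) @[h --> 0^'] --> d.
  apply/(@cvgrPdist_le _ R^o) => e e0; have [del del0 hdel] := h e e0.
  apply/nbhs_ballP; exists del => // x hx x0.
  have xd : `|x| < del by move: hx; rewrite /ball/= sub0r normrN.
  have := hdel (x + t); rewrite addrK => /(_ xd).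
  rewrite /GRing.scale/= mulr1 => hh.
  rewrite -(@ler_pM2r _ `|x|) ?normr_gt0// -normrM mulrBl mulrAC mulVf// mul1r.
  by rewrite distrC.
split; first by apply/cvg_ex; exists d.
exact: cvg_lim cv.
Qed.

(** Subtracting [eps * t] makes the inequality at a spatial maximum strict, so the maximum over
    space and time can only be at time 0. The argument runs on [[0, t]] with [t < h], where a
    maximum at positive time has a derivative; time [h] follows by continuity. *)
Lemma max_principle (V : finType) h (v dv : V -> R -> R) (M : R) :
  (forall x, diff_on 0 h (v x) (dv x)) ->
  (forall x t, 0 < t < h -> (forall y, v y t <= v x t) -> dv x t <= 0) ->
  (forall x, v x 0 <= M) -> forall x t, 0 <= t <= h -> v x t <= M.
Proof.
move=> hv hm hM.
have main x t : 0 <= t < h -> v x t <= M.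
  move=> /andP[t0 th]; apply/ler_addgt0Pr => e e0.
  pose eps := e / (h + 1).
  have h1 : 0 < h + 1 by lra.
  have eps0 : 0 < eps by rewrite divr_gt0.
  pose q y s := v y s - eps * s.
  have cq y : {within `[0, t], continuous (q y)}.
    have [] // : diff_on 0 t (q y) (fun s => dv y s - eps * 1).
    apply: diff_on_sub; first by apply: diff_on_sub_itv (hv y) => //; exact: ltW.
    apply: diff_on_scale; apply: derivable_diff_on => s _; exact: is_derive_id.
  have /choice[m hmm] : forall y, exists c, 0 <= c <= t /\
      forall s, 0 <= s <= t -> q y s <= q y c.
    move=> y; have [c] := EVT_max t0 (cq y); rewrite in_itv/= => ct hc.
    by exists c; split=> // s st; apply: hc; rewrite in_itv.
  have [y _ hy] := @arg_maxP _ _ _ x xpredT (fun y => q y (m y)) isT.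
  have hq z s : 0 <= s <= t -> q z s <= q y (m y).
    by move=> st; apply: le_trans (hy z isT); apply: (hmm z).2.
  have [/andP[m0 mt] _] := hmm y.
  have my : m y = 0.
    apply/eqP; rewrite eq_le m0 andbT leNgt; apply/negP => mpos.
    have mh : 0 < m y < h by rewrite mpos (le_lt_trans mt).
    have : dv y (m y) <= 0.
      apply: hm => // z; have := hq z (m y); rewrite m0 mt /q lerD2r; exact.
    have [_ /(_ _ mh) /is_deriveP /(_ (eps / 2))] := hv y.
    have e2 : 0 < eps / 2 by lra.
    move=> /(_ e2)[del del0 hdel] dv0.
    (* Just before the maximum the difference quotient of [v y] must be at least [eps], which
       contradicts a derivative that is at most 0. *)
    pose s := m y - Num.min (m y) (del / 2).
    have mn : 0 < Num.min (m y) (del / 2) by rewrite lt_min mpos divr_gt0.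
    have sm : `|s - m y| = Num.min (m y) (del / 2).
      by rewrite /s addrAC subrr add0r normrN gtr0_norm.
    have md : Num.min (m y) (del / 2) < del.
      by rewrite gt_min; apply/orP; right; lra.
    have := hdel s; rewrite sm => /(_ md).
    have -> : s - m y = - Num.min (m y) (del / 2).
      by rewrite /s addrAC subrr add0r.
    have := hq y s; rewrite /q.
    have -> : 0 <= s <= t.
      rewrite /s subr_ge0 ge_min lexx/= lerBlDr (le_trans mt)// lerDl.
      by rewrite ltW.
    move=> /(_ isT); rewrite {1}/s ler_norml => h2 /andP[h3 _].
    rewrite mulrN opprK in h3.
    have : dv y (m y) * Num.min (m y) (del / 2) <= 0 by rewrite mulr_le0_ge0// ltW.
    rewrite /s in h2 h3; move: mn h2 h3; set mm := Num.min _ _ => mn h2 h3 h4.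
    have : 0 < eps * mm by rewrite mulr_gt0.
    nra.
  have := hq x t; rewrite t0 lexx /q my mulr0 subr0 => /(_ isT).
  have := hM y.
  have : eps * t <= e.
    rewrite /eps mulrAC ler_pdivrMr// ler_wpM2l// ?ltW//; lra.
  lra.
move=> x t /andP[t0]; rewrite le_eqVlt => /predU1P[th|th]; last first.
  by apply: main; rewrite t0.
rewrite th in t0 *.
move: t0; rewrite le_eqVlt => /predU1P[<-//|h0].
apply/ler_addgt0Pr => e e0.
have [/within_continuousP /(_ h) cf _] := hv x.
have [|d d0 hd] := cf _ e e0; first by rewrite /= in_itv/= lexx ltW.
pose s := h - Num.min h (d / 2).
have mn : 0 < Num.min h (d / 2) by rewrite lt_min h0 divr_gt0.
have mle : Num.min h (d / 2) <= h by rewrite ge_min lexx.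
have mle2 : Num.min h (d / 2) <= d / 2 by rewrite ge_min lexx orbT.
have s0 : 0 <= s by rewrite subr_ge0.
have sh : s < h by rewrite /s ltrBlDr ltrDl.
have : `|v x h - v x s| < e.
  apply: hd; first by rewrite /= in_itv/= s0 ltW.
  by rewrite /s opprB addrC subrK gtr0_norm//; lra.
have := main x s; rewrite s0 sh => /(_ isT).
rewrite ltr_norml; lra.
Qed.

End TimeEstimates.

(** * Linear differential equations *)

Section LinearODE.
Context {R : realType}.

Lemma continuous_epsP (f : R -> R) : continuous f <->
  (forall t e, 0 < e ->
     exists2 d, 0 < d & forall s, `|t - s| < d -> `|f t - f s| < e).
Proof.
split=> [cf t e e0|h t].
  have /(@cvgrPdist_lt _ R^o) /(_ e e0) := cf t.
  by move=> /nbhs_ballP[d /= d0 hd]; exists d => // s ts; exact: hd.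
apply/(@cvgrPdist_lt _ R^o) => e e0; have [d d0 hd] := h t e e0.
by apply/nbhs_ballP; exists d => // s /= ts; exact: hd.
Qed.

Lemma continuous_max0 : continuous (fun t : R => Num.max t 0).
Proof.
apply/continuous_epsP => t e e0; exists e => // s ts.
apply: le_lt_trans ts.
have h1 := ler_norm (t - s); have h2 := ler_norm (s - t).
rewrite distrC in h2.
rewrite ler_norml; have [t0|t0] := leP t 0; have [s0|s0] := leP s 0; lra.
Qed.

(** The integral starts at -1 so that 0 is an interior point, and its argument is clamped at 0. The
    result is continuous on the whole line and constant at negative times, so Picard iterates remain
    continuous functions on [R]. *)
Lemma antiderivative (g : R -> R) : continuous g ->
  exists G : R -> R, [/\ continuous G, G 0 = 0,
    forall t : R, t <= 0 -> G t = 0 & forall t : R, 0 < t -> is_derive t 1 G (g t)].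
Proof.
move=> cg.
pose F x := (\int[lebesgue_measure]_(t in [set` `[(-1 : R), x]]) (g t))%R.
have dF (t : R) : 0 <= t -> is_derive t 1 F (g t).
  move=> t0.
  have int : lebesgue_measure.-integrable `[(-1 : R), t + 1] (EFin \o g).
    apply: continuous_compact_integrable; first exact: segment_compact.
    exact: continuous_subspaceT.
  have t1 : t < t + 1 by lra.
  have t2 : -1 < t by lra.
  have [d1 d2] := continuous_FTC1_closed t1 int t2 (cg t).
  by rewrite -d2 derive1E; exact: derivableP.
pose G t := F (Num.max t 0) - F 0.
have G0 (t : R) : t <= 0 -> G t = 0.
  by move=> t0; rewrite /G max_r// subrr.
exists G; split => //; first last.
- move=> t t0; apply/is_deriveP => e e0.
  have /is_deriveP /(_ e e0) [d d0 hd] := dF t (ltW t0).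
  exists (Num.min d t); first by rewrite lt_min d0.
  move=> s; rewrite lt_min => /andP[sd st].
  have s0 : 0 <= s by move: st; rewrite ltr_norml; lra.
  have -> : G s - G t = F s - F t by rewrite /G (max_idPl s0) (max_idPl (ltW t0)); ring.
  exact: hd.
- exact: G0.
move=> t; apply: (@cvgB R R^o R _ _ (fun t => F (Num.max t 0)) (fun=> F 0)); last exact: cvg_cst.
have [d _] := dF (Num.max t 0) ltac:(by rewrite le_max lexx orbT).
apply: (@continuous_comp _ _ _ (fun t : R => Num.max t 0)).
  exact: continuous_max0.
by apply: differentiable_continuous; exact/derivable1_diffP.
Qed.

Variable V : finType.

Lemma continuous_sum (g : V -> R -> R) : (forall y, continuous (g y)) ->
  continuous (fun t => \sum_y g y t).
Proof.
move=> cg; elim: (index_enum V) => [|y r IH].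
  rewrite (_ : (fun t => _) = fun=> 0); first by move=> t; exact: cvg_cst.
  by apply/funext => t; rewrite big_nil.
rewrite (_ : (fun t => _) = fun t => g y t + \sum_(z <- r) g z t).
  by move=> t; apply: (@cvgD R R^o R); [exact: cg|exact: IH].
by apply/funext => t; rewrite big_cons.
Qed.

(* Picard iteration.  Measured against [expR (2 * M * t)] it contracts by 1/2 on
   the whole half-line, and squeezing the iterates between the monotone
   sequences [lo] and [up] lets an infimum play the role of the limit. *)
Lemma linear_ode (A : R -> V -> V -> R) (M : R) (v0 : V -> R) :
  (forall x y, continuous (fun t => A t x y)) ->
  (forall t x, \sum_y `|A t x y| <= M) ->
  exists v : R -> V -> R, [/\ forall x, v 0 x = v0 x,
    forall x, continuous (fun t => v t x) &
    forall (t : R) x, 0 < t ->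
      is_derive t 1 (fun s => v s x) (\sum_y A t x y * v t y)].
Proof.
wlog M0 : M / 0 < M.
  move=> h cA hM; apply: (h (Num.max M 1)) => //; first by rewrite lt_max ltr01 orbT.
  by move=> t x; rewrite le_max hM.
move=> cA hM.
have [J hJ] : exists J : (R -> R) -> R -> R, forall g, continuous g ->
    [/\ continuous (J g), J g 0 = 0,
    forall t : R, t <= 0 -> J g t = 0 & forall t : R, 0 < t -> is_derive t 1 (J g) (g t)].
  have /choice[J hJ] : forall g : R -> R, exists G, continuous g ->
     [/\ continuous G, G 0 = 0,
    forall t : R, t <= 0 -> G t = 0 & forall t : R, 0 < t -> is_derive t 1 G (g t)].
    move=> g; have [cg|ncg] := pselect (continuous g); last by exists g.
    by have [G] := antiderivative g cg; exists G.
  by exists J.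
pose B (v : V -> R -> R) x t := \sum_y A t x y * v y t.
have cB v : (forall x, continuous (v x)) -> forall x, continuous (B v x).
  move=> cv x; apply: continuous_sum => y t.
  by apply: continuousM; [exact: cA|exact: cv].
pose P v (x : V) t := v0 x + J (B v x) t.
have cP v : (forall x, continuous (v x)) -> forall x, continuous (P v x).
  move=> cv x t; have [cJ _ _ _] := hJ _ (cB v cv x).
  by apply: (@continuousD R R^o R^o); [exact: cvg_cst|exact: cJ].
have dP v : (forall x, continuous (v x)) -> forall b x, diff_on 0 b (P v x) (B v x).
  move=> cv b x; split=> [|t /andP[t0 _]].
    by apply: continuous_subspaceT; exact: cP.
  have [_ _ _ /(_ t t0) d] := hJ _ (cB v cv x).
  have := @is_deriveD R R^o R^o _ _ t 1 _ _ (is_derive_cst (v0 x) t 1) d.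
  by rewrite add0r.
have P0 v : (forall x, continuous (v x)) -> forall x (t : R), t <= 0 -> P v x t = v0 x.
  move=> cv x t t0; have [_ _ j0 _] := hJ _ (cB v cv x).
  by rewrite /P j0// addr0.
pose E (t : R) := expR (2 * M * Num.max t 0).
have E1 t : 1 <= E t.
  rewrite /E -[leLHS]expR0 ler_expR; apply: mulr_ge0; last by rewrite le_max lexx orbT.
  by rewrite mulr_ge0// ltW.
have Bdiff (v w : V -> R -> R) (c : R) x t : (forall y, `|v y t - w y t| <= c) ->
    `|B v x t - B w x t| <= M * c.
  move=> h; rewrite /B -sumrB.
  have c0 : 0 <= c by apply: le_trans (h x).
  apply: le_trans (ler_norm_sum _ _ _) _.
  apply: (@le_trans _ _ (\sum_y `|A t x y| * c)).
    by apply: ler_sum => y _; rewrite -mulrBr normrM ler_wpM2l.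
  by rewrite -mulr_suml ler_wpM2r.
(* The factor 1/2 arises because [M] times the integral of [expR (2 * M * s)] up to [t] is at most
   [expR (2 * M * t) / 2]. *)
have step v w c : 0 <= c -> (forall x, continuous (v x)) -> (forall x, continuous (w x)) ->
    (forall x t, `|v x t - w x t| <= c * E t) ->
    forall x t, `|P v x t - P w x t| <= c / 2 * E t.
  move=> c0 cv cw h x t.
  have [t0|t0] := leP t 0.
    by rewrite !P0// subrr normr0 mulr_ge0 ?divr_ge0// (le_trans _ (E1 t)).
  have hh := diff_on_sub _ _ _ _ _ _ (dP v cv t x) (dP w cw t x).
  pose g s := c / 2 * expR (2 * M * s).
  pose dg s := M * (c * expR (2 * M * s)).
  have hg : diff_on 0 t g dg.
    apply: derivable_diff_on => s _.
    have d2 : is_derive s 1 (fun s => 2 * M * s) (2 * M).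
      have := is_deriveM (is_derive_cst (2 * M) s 1) (is_derive_id s 1).
      by rewrite scaler0 addr0 /GRing.scale/= mulr1.
    have d3 := @is_derive1_comp R expR (fun s => 2 * M * s) s _ _
       (is_derive_expR _) d2.
    have := @is_deriveM R R^o _ _ s 1 _ _ (is_derive_cst (c / 2) s 1) d3.
    rewrite scaler0 addr0 /GRing.scale/= => d4.
    have -> : dg s = c / 2 * (expR (2 * M * s) * (2 * M)) by rewrite /dg; field.
    exact: d4.
  have t0' := ltW t0.
  have := mvt_le _ _ _ _ _ _ t0' hh hg.
  rewrite /= (P0 v cv x 0 (lexx 0)) (P0 w cw x 0 (lexx 0)) subrr subr0 => hle.
  apply: (le_trans (hle _)).
    move=> s /andP[s0 _]; apply: Bdiff => y.
    by have := h y s; rewrite /E max_l// ltW.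
  rewrite /g /E max_l// mulr0 expR0 mulr1 lerBlDr lerDl divr_ge0//.
pose vk := fix vk k : V -> R -> R := if k is k'.+1 then P (vk k') else fun _ _ => 0.
have cvk k : forall x, continuous (vk k x).
  by elim: k => [|k IH] x /=; [move=> t; exact: cvg_cst|exact: cP].
pose c := \sum_y `|v0 y|.
have c0 : 0 <= c by apply: sumr_ge0.
have v0c x : `|v0 x| <= c.
  by rewrite /c (bigD1 x)//= lerDl; apply: sumr_ge0.
have dk k x t : `|vk k.+1 x t - vk k x t| <= c / 2 ^+ k * E t.
  elim: k x t => [|k IH] x t.
    rewrite expr0 divr1 /= subr0 /P.
    have B0 : B (fun _ _ => 0) x = (fun=> 0).
      by apply/funext => s; rewrite /B big1// => y _; rewrite mulr0.
    have cc : continuous (fun _ : R => 0 : R) by move=> s; exact: cvg_cst.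
    have [_ J0 Jneg dJ] := hJ _ cc.
    have -> : J (B (fun _ _ => 0) x) t = 0.
      rewrite B0; have [/Jneg //|t0] := leP t 0.
      have hd : diff_on 0 t (J (fun=> 0)) (fun=> 0).
        split=> [|s /andP[s0 _]]; last exact: dJ.
        by apply: continuous_subspaceT; have [] := hJ _ cc.
      have := mvt_le _ _ _ _ _ _ (ltW t0) hd (diff_on_cst 0 t 0).
      rewrite J0 !subr0 => hh; apply/eqP; rewrite -normr_le0; apply: hh.
      by move=> s _; rewrite normr0.
    by rewrite addr0 (le_trans (v0c x))// ler_peMr.
  have ck0 : 0 <= c / 2 ^+ k by rewrite divr_ge0// exprn_ge0.
  have -> : c / 2 ^+ k.+1 = c / 2 ^+ k / 2 by rewrite exprSr; field.
  exact: (step (vk k.+1) (vk k) _ ck0 (cvk k.+1) (cvk k) IH).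
(* [2 * c / 2 ^+ i] is the sum of the bounds [c / 2 ^+ j] on the increments with [j >= i]; this
   makes [up] nonincreasing and [lo] nondecreasing in [i]. *)
pose up i x t := vk i x t + 2 * c / 2 ^+ i * E t.
pose lo i x t := vk i x t - 2 * c / 2 ^+ i * E t.
have halve j : 2 * c / 2 ^+ j = 2 * (2 * c / 2 ^+ j.+1).
  by rewrite exprS; field.
have halve' j : c / 2 ^+ j = 2 * c / 2 ^+ j.+1.
  by rewrite exprS; field.
have upS k x t : up k.+1 x t <= up k x t.
  have := dk k x t; rewrite ler_norml /up halve' => /andP[_].
  rewrite (halve k); lra.
have loS k x t : lo k x t <= lo k.+1 x t.
  have := dk k x t; rewrite ler_norml /lo halve' => /andP[h _].
  rewrite (halve k); lra.
have upm k j x t : up (k + j)%N x t <= up k x t.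
  by elim: j => [|j IH]; [rewrite addn0|rewrite addnS (le_trans (upS _ _ _))].
have lom k j x t : lo k x t <= lo (k + j)%N x t.
  by elim: j => [|j IH]; [rewrite addn0|rewrite addnS (le_trans _ (loS _ _ _))].
have loup k j x t : lo k x t <= up j x t.
  apply: (le_trans (lom k j x t)); apply: le_trans (upm j k x t).
  rewrite addnC /lo /up lerD2l (@le_trans _ _ 0)// ?oppr_le0;
    by rewrite !mulr_ge0// ?invr_ge0 ?exprn_ge0// (le_trans _ (E1 t)).
pose v x t := inf [set up k x t | k in [set: nat]].
have vup k x t : v x t <= up k x t.
  by apply: ge_inf; [exists (lo 0%N x t) => _ [j _ <-]|exists k].
have vlo k x t : lo k x t <= v x t.
  by apply: lb_le_inf; [exists (up 0%N x t), 0%N|move=> _ [j _ <-]].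
have vvk k x t : `|v x t - vk k x t| <= 2 * c / 2 ^+ k * E t.
  by have := vup k x t; have := vlo k x t; rewrite /lo /up ler_norml; lra.
have small e : 0 < e -> exists k, 2 * c / 2 ^+ k < e.
  move=> e0; have : (fun k : nat => 2 * c / 2 ^+ k) @ \oo --> (0 : R).
    have := @cvg_geometric R (2 * c) 2^-1.
    rewrite ger0_norm ?invr_ge0// invf_lt1// ltr1n => /(_ isT).
    by rewrite /geometric; under eq_fun do rewrite exprVn.
  move=> /(@cvgrPdist_lt _ R^o) /(_ e e0)[k _ /(_ k (leqnn k))] /=.
  by rewrite sub0r normrN ger0_norm ?divr_ge0 ?mulr_ge0 ?exprn_ge0//; exists k.
have cv x : continuous (v x).
  apply/continuous_epsP => t e e0.
  have e3 : 0 < e / 3 / E (t + 1) by rewrite !divr_gt0// (lt_le_trans ltr01).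
  have [k hk] := small _ e3.
  have e3' : 0 < e / 3 by lra.
  have [d d0 hd] := (continuous_epsP (vk k x)).1 (cvk k x) t (e / 3) e3'.
  have bd s : s < t + 1 -> `|v x s - vk k x s| < e / 3.
    move=> st; apply: le_lt_trans (vvk k x s) _.
    apply: (@le_lt_trans _ _ (2 * c / 2 ^+ k * E (t + 1))).
      rewrite ler_wpM2l ?divr_ge0 ?mulr_ge0 ?exprn_ge0//.
      by rewrite /E ler_expR ler_pM2l ?mulr_gt0// ge_max !le_max lexx ltW//= orbT.
    by rewrite -ltr_pdivlMr// (lt_le_trans ltr01).
  exists (Num.min d 1); first by rewrite lt_min d0 ltr01.
  move=> s; rewrite lt_min => /andP[/hd h1 h2].
  have := bd t; rewrite ltrDl ltr01 => /(_ isT).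
  have : s < t + 1 by move: h2; rewrite ltr_norml; lra.
  move: h1 => + /bd.
  by rewrite !ltr_norml; lra.
have vE x t : v x t = P v x t.
  apply/eqP; rewrite -subr_eq0 -normr_le0; apply/ler_addgt0Pr => e e0.
  have e3 : 0 < e / E t by rewrite divr_gt0// (lt_le_trans ltr01).
  have [k hk] := small _ e3.
  have h1 := vvk k.+1 x t.
  have h2 : `|P v x t - vk k.+1 x t| <= 2 * c / 2 ^+ k / 2 * E t.
    apply: (step v (vk k)) => //.
    by rewrite divr_ge0 ?mulr_ge0 ?exprn_ge0.
  have := ler_normB (v x t - vk k.+1 x t) (P v x t - vk k.+1 x t).
  rewrite opprB addrA subrK add0r => h3; apply: (le_trans h3).
  move: hk; rewrite ltr_pdivlMr ?(lt_le_trans ltr01)// => hk.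
  move: h1 h2 hk; rewrite (halve k); lra.
exists (fun t x => v x t); split.
- by move=> x; rewrite vE P0.
- by move=> x; exact: cv.
move=> t x t0; have [_] := dP v cv (t + 1) x.
move=> /(_ t); rewrite t0 ltrDl ltr01 => /(_ isT).
by rewrite (_ : P v x = v x)//; apply/funext => s; rewrite vE.
Qed.

End LinearODE.

(** * The heat semigroup of the discrete torus *)

Section Heat.
Context {R : realType} {n N : nat}.
Local Notation V := 'rV['I_N.-1.+1]_n.
Local Notation ev e := (lclass N (evec e)).
Implicit Types (g k : V -> R) (x y z : V) (e : dir n).

Lemma lclassN (a : 'rV[int]_n) : lclass N (- a) = - lclass N a.
Proof. by apply/rowP => i; rewrite !mxE mulrNz. Qed.

Lemma lclass_dopp e : ev (dopp e) = - ev e.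
Proof. by rewrite -lclassN; case: e => i [] //=; rewrite /evec/= opprK. Qed.

Lemma laplaceE g x : laplace g x = \sum_e N%:R * lgrad e g x.
Proof.
by rewrite /laplace mulr_sumr; apply: eq_bigr => e _; rewrite /lgrad mulrA expr2.
Qed.

Lemma laplace_lin (a b : R) g k x :
  laplace (fun y => a * g y + b * k y) x = a * laplace g x + b * laplace k x.
Proof.
rewrite /laplace !mulr_sumr -big_split; apply: eq_bigr => e _ /=; ring.
Qed.

Lemma laplace_sum (I : finType) (F : I -> V -> R) x :
  laplace (fun y => \sum_i F i y) x = \sum_i laplace (F i) x.
Proof.
rewrite /laplace -mulr_sumr exchange_big/=; congr (_ * _).
by apply: eq_bigr => e _; rewrite -sumrB.
Qed.

Lemma laplace_shift g z x : laplace (fun y => g (y + z)) x = laplace g (x + z).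
Proof. by rewrite /laplace; congr (_ * _); apply: eq_bigr => e _; rewrite addrAC. Qed.

Lemma laplace_max g x : (forall y, g y <= g x) -> laplace g x <= 0.
Proof.
move=> h; rewrite /laplace mulr_ge0_le0 ?exprn_ge0//.
by apply: sumr_le0 => e _; rewrite subr_le0.
Qed.

Lemma laplace_sqr g x :
  laplace (fun y => g y ^+ 2) x = 2 * g x * laplace g x + \sum_e lgrad e g x ^+ 2.
Proof.
rewrite /laplace !mulr_sumr -big_split; apply: eq_bigr => e _ /=.
rewrite /lgrad; ring.
Qed.

Lemma heat_exists : exists P : R -> (V -> R) -> V -> R, forall g,
  [/\ forall x, P 0 g x = g x, forall x, continuous (fun t => P t g x) &
   forall (t : R) x, 0 < t -> is_derive t 1 (fun s => P s g x) (laplace (P t g) x)].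
Proof.
pose A (t : R) x y : R := N%:R ^+ 2 * \sum_e ((y == x + ev e)%:R - (y == x)%:R).
have AE t x g : \sum_y A t x y * g y = laplace g x.
  rewrite /A /laplace; under eq_bigr => y _ do rewrite -mulrA mulr_suml.
  rewrite -mulr_sumr exchange_big/=; congr (_ * _); apply: eq_bigr => e _.
  under eq_bigr => y _ do rewrite mulrBl.
  rewrite sumrB; congr (_ - _).
    rewrite (bigD1 (x + ev e))//= eqxx mul1r big1 ?addr0// => y /negPf ->.
    by rewrite mul0r.
  by rewrite (bigD1 x)//= eqxx mul1r big1 ?addr0// => y /negPf ->; rewrite mul0r.
have /choice[P hP] : forall g, exists v : R -> V -> R,
    [/\ forall x, v 0 x = g x, forall x, continuous (fun t => v t x) &
   forall (t : R) x, 0 < t -> is_derive t 1 (fun s => v s x) (laplace (v t) x)].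
  move=> g; have := linear_ode V A (\sum_x \sum_y `|A 0 x y|) g.
  case=> [x y|t x|v [v0 cv dv]]; first by move=> t; exact: cvg_cst.
    rewrite [leRHS](bigD1 x)//= lerDl; apply: sumr_ge0 => z _; exact: sumr_ge0.
  by exists v; split=> // t x t0; rewrite -(AE t); exact: dv.
by exists (fun t g => P g t).
Qed.

Definition heat : R -> (V -> R) -> V -> R := projT1 (cid heat_exists).

Lemma heat0 g : heat 0 g = g.
Proof. by apply/funext => x; rewrite /heat; case: cid => P /= /(_ g)[]. Qed.

Lemma heat_diff h g x :
  diff_on 0 h (fun t => heat t g x) (fun t => laplace (heat t g) x).
Proof.
rewrite /heat; case: cid => P /= /(_ g)[_ c d]; split=> [|t /andP[t0 _]].
  exact: continuous_subspaceT.
exact: d.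
Qed.

Lemma subsol_le h (v dv : V -> R -> R) (M : R) :
  (forall x, diff_on 0 h (v x) (dv x)) ->
  (forall x t, 0 < t < h -> dv x t <= laplace (v ^~ t) x) ->
  (forall x, v x 0 <= M) -> forall x t, 0 <= t <= h -> v x t <= M.
Proof.
move=> hv hdv h0; apply: max_principle hv _ h0 => x t th hx.
by apply: (le_trans (hdv x t th)); exact: laplace_max.
Qed.

(** The difference of two solutions is compared with 0 in both directions. Linearity, translation
    invariance and the semigroup law below follow by checking that both sides solve the same Cauchy
    problem. *)
Lemma heat_unique h (v : R -> V -> R) :
  (forall x, diff_on 0 h (fun t => v t x) (fun t => laplace (v t) x)) ->
  forall t, 0 <= t <= h -> v t = heat t (v 0).
Proof.
move=> hv t th; apply/funext => x.
have key (v1 v2 : R -> V -> R) :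
    (forall x, diff_on 0 h (fun t => v1 t x) (fun t => laplace (v1 t) x)) ->
    (forall x, diff_on 0 h (fun t => v2 t x) (fun t => laplace (v2 t) x)) ->
    v1 0 = v2 0 -> v1 t x <= v2 t x.
  move=> h1 h2 e; rewrite -subr_le0.
  apply: (subsol_le h (fun x t => v1 t x - v2 t x)
     (fun x t => laplace (v1 t) x - laplace (v2 t) x) 0) => //.
  - by move=> y; apply: diff_on_sub.
  - move=> y s _; have := laplace_lin 1 (-1) (v1 s) (v2 s) y.
    rewrite mul1r mulN1r => <-; rewrite le_eqVlt; apply/orP; left; apply/eqP.
    by congr laplace; apply/funext => z; rewrite mul1r mulN1r.
  - by move=> y; rewrite e subrr.
have hH y : diff_on 0 h (fun t => heat t (v 0) y) (fun t => laplace (heat t (v 0)) y).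
  exact: heat_diff.
have e0 : v 0 = heat 0 (v 0) by rewrite heat0.
by apply/eqP; rewrite eq_le (key _ _ hv hH e0) (key (fun t => heat t (v 0)) v hH hv (esym e0)).
Qed.

Lemma heat_lin t (a b : R) g k : 0 <= t ->
  heat t (fun y => a * g y + b * k y) = fun x => a * heat t g x + b * heat t k x.
Proof.
move=> t0; have := @heat_unique t (fun t x => a * heat t g x + b * heat t k x).
rewrite !heat0 => <- //; last by rewrite t0 lexx.
move=> x.
have h1 := diff_on_scale _ _ a _ _ (heat_diff t g x).
have h2 := diff_on_scale _ _ b _ _ (heat_diff t k x).
apply: diff_on_ext (diff_on_add _ _ _ _ _ _ h1 h2).
- by [].
- by move=> s _; rewrite laplace_lin.
Qed.

Lemma heat_scale t (a : R) g : 0 <= t ->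
  heat t (fun y => a * g y) = fun x => a * heat t g x.
Proof.
move=> t0; have := heat_lin t a 0 g g t0.
under eq_fun do rewrite mul0r addr0.
by move=> ->; apply/funext => x; rewrite mul0r addr0.
Qed.

Lemma heat_add t g k : 0 <= t ->
  heat t (fun y => g y + k y) = fun x => heat t g x + heat t k x.
Proof.
move=> t0; have := heat_lin t 1 1 g k t0.
under eq_fun do rewrite !mul1r.
by move=> ->; apply/funext => x; rewrite !mul1r.
Qed.

Lemma heat_sub t g k : 0 <= t ->
  heat t (fun y => g y - k y) = fun x => heat t g x - heat t k x.
Proof.
move=> t0; have := heat_lin t 1 (-1) g k t0.
under eq_fun do rewrite mul1r mulN1r.
by move=> ->; apply/funext => x; rewrite mul1r mulN1r.
Qed.

Lemma heat_sum (I : Type) (r : seq I) (F : I -> V -> R) t : 0 <= t ->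
  heat t (fun y => \sum_(i <- r) F i y) = fun x => \sum_(i <- r) heat t (F i) x.
Proof.
move=> t0; elim: r => [|i r IH].
  have := heat_scale t 0 (fun=> 0) t0.
  under eq_fun do rewrite mul0r.
  under [in RHS]eq_fun do rewrite mul0r.
  move=> h; under eq_fun do rewrite big_nil.
  by rewrite h; apply/funext => x; rewrite big_nil.
under eq_fun do rewrite big_cons.
by rewrite heat_add// IH; apply/funext => x; rewrite big_cons.
Qed.

Lemma heat_shift t g z : 0 <= t ->
  heat t (fun y => g (y + z)) = fun x => heat t g (x + z).
Proof.
move=> t0; have := @heat_unique t (fun t x => heat t g (x + z)).
rewrite !heat0 => <- //; last by rewrite t0 lexx.
move=> x; apply: diff_on_ext (heat_diff t g (x + z)) => //.
by move=> s _; rewrite laplace_shift.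
Qed.

Lemma heat_lgrad t e g : 0 <= t -> heat t (lgrad e g) = lgrad e (heat t g).
Proof.
move=> t0; rewrite /lgrad heat_scale// heat_sub// heat_shift//.
Qed.

Lemma heat_laplace t g : 0 <= t -> heat t (laplace g) = laplace (heat t g).
Proof.
move=> t0; have -> : laplace g = fun x => \sum_e N%:R * lgrad e g x.
  by apply/funext => x; rewrite laplaceE.
rewrite heat_sum//; apply/funext => x; rewrite laplaceE.
by apply: eq_bigr => e _; rewrite heat_scale// heat_lgrad.
Qed.

Lemma heat_semigroup s t g : 0 <= s -> 0 <= t -> heat s (heat t g) = heat (s + t) g.
Proof.
move=> s0; rewrite le_eqVlt => /predU1P[<-|t0]; first by rewrite heat0 addr0.
have := @heat_unique s (fun s => heat (s + t) g).
rewrite add0r => <- //; last by rewrite s0 lexx.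
move=> x.
have h1 r : 0 <= r <= s -> 0 <= 1 * r + t <= s + t.
  by move=> /andP[r0 rs]; apply/andP; split; lra.
have h2 r : 0 < r < s -> 0 < 1 * r + t < s + t.
  by move=> /andP[r0 rs]; apply/andP; split; lra.
apply: diff_on_ext (diff_on_affine 0 s 0 (s + t) _ _ 1 t h1 h2 (heat_diff (s + t) g x)).
- by move=> r; rewrite /= mul1r.
- by move=> r _; rewrite !mul1r.
Qed.

Lemma heat_kernelE t g x : 0 <= t ->
  heat t g x = \sum_z g z * heat t (fun y => (y == z)%:R) x.
Proof.
move=> t0.
have -> : g = fun y => \sum_z g z * (y == z)%:R.
  apply/funext => y; rewrite (bigD1 y)//= eqxx mulr1 big1 ?addr0// => z.
  by rewrite eq_sym => /negPf ->; rewrite mulr0.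
rewrite heat_sum//; apply: eq_bigr => z _; rewrite heat_scale//.
congr (_ * _).
rewrite (bigD1 z)//= eqxx mulr1 big1 ?addr0// => y.
by rewrite eq_sym => /negPf ->; rewrite mulr0.
Qed.

(** Writing the flow as a finite sum against its kernel reduces the claim to the product rule for
    each kernel point. The Laplacian then moves onto [u s], since it commutes with the flow. *)
Lemma heat_evolution (tau a del : R) (u du : R -> V -> R) x :
  0 <= tau -> 0 < a -> 0 <= del ->
  (forall y, diff_on 0 del (fun s => u s y) (fun s => du s y)) ->
  diff_on 0 del (fun s => heat (tau + a * s) (u s) x)
   (fun s => heat (tau + a * s) (fun y => a * laplace (u s) y + du s y) x).
Proof.
move=> tau0 a0 del0 hu.
pose p z t := heat t (fun y => (y == z)%:R) x.
have as0 s : 0 <= s -> 0 <= tau + a * s.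
  by move=> s0; rewrite addr_ge0// mulr_ge0// ltW.
have hp z : diff_on 0 del (fun s => p z (a * s + tau))
   (fun s => a * laplace (heat (a * s + tau) (fun y => (y == z)%:R)) x).
  apply: (diff_on_affine 0 del 0 (a * del + tau) (p z)
    (fun s => laplace (heat s (fun y => (y == z)%:R)) x)).
  - move=> t /andP[t0 td]; rewrite addr_ge0 ?mulr_ge0 ?(ltW a0)//=.
    by rewrite lerD2r ler_pM2l.
  - move=> t /andP[t0 td]; rewrite ltr_wpDr ?mulr_gt0//=.
    by rewrite ltrD2r ltr_pM2l.
  - exact: heat_diff.
have := diff_on_sum _ (index_enum V) xpredT 0 del _ _
  (fun z => diff_on_mul _ _ _ _ _ _ (hu z) (hp z)).
move=> [hc hd].
have E s : 0 <= s -> \sum_z u s z * p z (a * s + tau) = heat (tau + a * s) (u s) x.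
  move=> s0; rewrite [RHS]heat_kernelE; last exact: as0.
  by apply: eq_bigr => z _; rewrite /p addrC.
split.
  apply/within_continuousP => t; rewrite /= in_itv/= => /andP[t0 td] e e0.
  move/within_continuousP : hc => /(_ t); rewrite /= in_itv/= t0 td => /(_ isT e e0).
  move=> [d d0 hdd]; exists d => // s; rewrite in_itv/= => /andP[s0 sd] ts.
  by rewrite -!E//; apply: hdd; rewrite ?in_itv/= ?s0 ?sd.
move=> t /andP[t0 td]; apply/is_deriveP => e e0.
have /is_deriveP /(_ e e0) := hd t ltac:(by rewrite t0 td).
move=> [d d0 hdd]; exists (Num.min d t); first by rewrite lt_min d0.
move=> s; rewrite lt_min => /andP[sd st].
have s0 : 0 <= s by move: st; rewrite ltr_norml; lra.
rewrite -!E ?(ltW t0)//.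
have -> : heat (tau + a * t) (fun y => a * laplace (u t) y + du t y) x =
   \sum_z (du t z * p z (a * t + tau) + u t z *
     (a * laplace (heat (a * t + tau) (fun y => (y == z)%:R)) x)); last exact: hdd.
have h0 := as0 t (ltW t0).
have := heat_lin (tau + a * t) a 1 (laplace (u t)) (du t) h0.
under eq_fun do rewrite mul1r.
move=> ->; rewrite mul1r big_split/= [LHS]addrC; congr (_ + _).
  by rewrite [LHS]heat_kernelE//; apply: eq_bigr => z _; rewrite /p [a * t + _]addrC.
rewrite heat_laplace//.
have -> : heat (tau + a * t) (u t) =
   fun x => \sum_z u t z * heat (tau + a * t) (fun y => (y == z)%:R) x.
  by apply/funext => y; rewrite heat_kernelE.
rewrite laplace_sum mulr_sumr; apply: eq_bigr => z _.
have := laplace_lin (u t z) 0 (heat (tau + a * t) (fun y => (y == z)%:R)) (fun=> 0) x.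
under eq_fun do rewrite mul0r addr0.
by move=> ->; rewrite mul0r addr0 [tau + _]addrC; ring.
Qed.

Definition lgrads (es : seq (dir n)) g : V -> R := foldr (fun e => lgrad e) g es.

Lemma heat_lgrads t es g : 0 <= t -> heat t (lgrads es g) = lgrads es (heat t g).
Proof. by move=> t0; elim: es => //= e es IH; rewrite heat_lgrad// IH. Qed.

Lemma lgrads_cat es es' g : lgrads (es ++ es') g = lgrads es (lgrads es' g).
Proof. by rewrite /lgrads foldr_cat. Qed.

Lemma lgrads_lin es (a b : R) g k :
  lgrads es (fun y => a * g y + b * k y) =
  fun x => a * lgrads es g x + b * lgrads es k x.
Proof.
elim: es => //= e es ->; apply/funext => x; rewrite /lgrad; ring.
Qed.

Lemma lgrads_sub es g k :
  lgrads es (fun y => g y - k y) = fun x => lgrads es g x - lgrads es k x.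
Proof.
elim: es => //= e es ->; apply/funext => x; rewrite /lgrad; ring.
Qed.

(** A backward difference here is the quotient along [- e], without change of sign, so the product
    with the forward one is minus the second difference. In this form bounds on [lgrads] apply to
    the Laplacian. *)
Lemma laplace_lgrads g x :
  laplace g x = - \sum_(i < n) lgrads [:: (i, false); (i, true)] g x.
Proof.
rewrite /laplace mulr_sumr.
transitivity (\sum_(i < n) \sum_(b : bool) N%:R ^+ 2 * (g (x + ev (i, b)) - g x)).
  by rewrite pair_bigA; apply: eq_bigr => -[].
rewrite -sumrN; apply: eq_bigr => i _; rewrite big_bool/= /lgrad.
have -> : ev (i, false) = - ev (i, true) by rewrite -lclass_dopp.
rewrite subrK; ring.
Qed.

End Heat.

(** * The squared distance as a comparison function *)

Section Weight.
Context {R : realType} {n N : nat} (N0 : (0 < N)%N).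
Local Notation V := 'rV['I_N.-1.+1]_n.
Local Notation ev e := (lclass N (evec e)).
Implicit Types (g k : V -> R) (x y z : V) (e : dir n).

Definition cyc_size (k : 'I_N.-1.+1) : nat := minn k (N - k).

Lemma ltn_cyc (k : 'I_N.-1.+1) : (k < N)%N.
Proof. by rewrite -[X in (_ < X)%N](prednK N0). Qed.

Lemma val_succ (k : 'I_N.-1.+1) :
  (k + inZp 1 : 'I_N.-1.+1) = (if k.+1 == N then 0 else k.+1)%N :> nat.
Proof.
rewrite /= modnDmr addn1; have := ltn_cyc k; move: (nat_of_ord k) => m mN.
rewrite prednK//; case: eqP => [->|/eqP kN']; first by rewrite modnn.
by rewrite modn_small// ltn_neqAle kN'.
Qed.

Lemma cyc_size_step (k : 'I_N.-1.+1) : (cyc_size (k + inZp 1)%R <= (cyc_size k).+1)%N &&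
  (cyc_size k <= (cyc_size (k + inZp 1)%R).+1)%N.
Proof.
rewrite /cyc_size val_succ; have kN := ltn_cyc k.
case: eqP; lia.
Qed.

(** Where [cyc_size] is linear its square has second difference 2. At the antipode it has a concave
    kink, which spoils equality but keeps the upper bound, the one that a supersolution requires. *)
Lemma cyc_size_step2 (k : 'I_N.-1.+1) :
  (cyc_size (k + inZp 1 + inZp 1)%R ^ 2 + cyc_size k ^ 2 <=
   2 * cyc_size (k + inZp 1)%R ^ 2 + 2)%N.
Proof.
rewrite /cyc_size !val_succ; have kN := ltn_cyc k.
do 2 case: eqP; nia.
Qed.

(* The squared distance from [x] to the origin of the torus of mesh [1/N]. *)
Definition weight x : R := \sum_i ((cyc_size (x 0 i))%:R / N%:R) ^+ 2.

Lemma weight_ge0 x : 0 <= weight x.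
Proof. by apply: sumr_ge0 => i _; rewrite exprn_ge0// divr_ge0. Qed.

Lemma weight0 : weight 0 = 0.
Proof.
by rewrite /weight big1// => i _; rewrite mxE /cyc_size/= min0n mul0r expr0n.
Qed.

Lemma add_ev x e i :
  (x + ev e) 0 i = if i == e.1 then (if e.2 then x 0 i + inZp 1 else x 0 i - inZp 1)
                   else x 0 i.
Proof.
case: e => j b; rewrite !mxE /evec/=; case: b; rewrite ?mxE /= [i == j]eq_sym;
  rewrite eq_sym; case: eqP => _ /=; rewrite ?mulr1z ?mulr0z ?oppr0 ?mulrNz ?addr0 //.
Qed.

Lemma weight_ev x e : weight (x + ev e) - weight x =
  ((cyc_size ((x + ev e) 0 e.1)%R)%:R ^+ 2 - (cyc_size (x 0 e.1)%R)%:R ^+ 2) / N%:R ^+ 2.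
Proof.
rewrite /weight (bigD1 e.1)//= [in X in _ - X](bigD1 e.1)//=.
rewrite (eq_bigr (fun i => ((cyc_size (x 0 i))%:R / N%:R) ^+ 2)); last first.
  by move=> i /negPf ie; rewrite add_ev ie.
by rewrite !expr_div_n; ring.
Qed.

Lemma cyc_size_ev x e : (cyc_size ((x + ev e) 0 e.1)%R <= (cyc_size (x 0 e.1)%R).+1)%N &&
  (cyc_size (x 0 e.1)%R <= (cyc_size ((x + ev e) 0 e.1)%R).+1)%N.
Proof.
rewrite add_ev eqxx; case: e.2; first exact: cyc_size_step.
by have := cyc_size_step (x 0 e.1 - inZp 1); rewrite subrK andbC.
Qed.

Let NR : 0 < N%:R :> R. Proof. by rewrite ltr0n. Qed.

Lemma cyc_size_le_weight x i : ((cyc_size (x 0 i))%:R / N%:R) ^+ 2 <= weight x.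
Proof.
rewrite /weight (bigD1 i)//= lerDl; apply: sumr_ge0 => j _.
by rewrite exprn_ge0// divr_ge0.
Qed.

Lemma laplace_weight x : laplace weight x <= n%:R * 2.
Proof.
rewrite /laplace mulr_sumr.
have -> : \sum_e N%:R ^+ 2 * (weight (x + ev e) - weight x) =
  \sum_(i < n) \sum_(b : bool) N%:R ^+ 2 * (weight (x + ev (i, b)) - weight x).
  by rewrite pair_bigA; apply: eq_bigr => -[].
rewrite -[n in leRHS]card_ord -sumr_const mulr_suml; apply: ler_sum => i _.
rewrite mul1r big_bool/= !weight_ev/= !add_ev/= eqxx.
rewrite !mulrA !(mulrC (N%:R ^+ 2)) !mulrK ?unitfE ?expf_neq0 ?gt_eqF//.
have := cyc_size_step2 (x 0 i - inZp 1); rewrite subrK.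
rewrite -(ler_nat R) !natrD !natrM; lra.
Qed.

(** The lattice form of the identity that the squared gradient of [|x| ^ 2] is [4 * |x| ^ 2]. The
    correction [N ^- 2] is the source of the condition [N ^- 2 <= theta] in [bernstein]. *)
Lemma lgrad_weight_sqr x e : lgrad e weight x ^+ 2 <= 8 * (N%:R ^- 2 + weight x).
Proof.
rewrite /lgrad weight_ev exprMn expr_div_n.
have /andP[] := cyc_size_ev x e; have := cyc_size_le_weight x e.1.
move: (cyc_size _) (cyc_size _) => m' m hw.
rewrite -!(ler_nat R) => h1 h2; rewrite -natr1 in h1; rewrite -natr1 in h2.
rewrite expr_div_n in hw.
have m0 : 0 <= m%:R :> R by [].
have m'0 : 0 <= m'%:R :> R by [].
apply: (@le_trans _ _ (8 * (N%:R ^- 2 + m%:R ^+ 2 / N%:R ^+ 2))); last first.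
  by rewrite ler_pM2l// lerD2l.
have -> : N%:R ^+ 2 * ((m'%:R ^+ 2 - m%:R ^+ 2) ^+ 2 / N%:R ^+ 2 ^+ 2) =
   (m'%:R ^+ 2 - m%:R ^+ 2) ^+ 2 * N%:R ^- 2 :> R by field; rewrite gt_eqF.
have -> : 8 * (N%:R ^- 2 + m%:R ^+ 2 / N%:R ^+ 2) = 8 * (1 + m%:R ^+ 2) * N%:R ^- 2 :> R.
  by ring.
rewrite ler_wpM2r ?invr_ge0 ?exprn_ge0//.
have h3 : (m'%:R - m%:R) ^+ 2 <= 1 :> R.
  by rewrite -ler_sqrt// sqrtr_sqr sqrtr1 ler_norml; lra.
have -> : (m'%:R ^+ 2 - m%:R ^+ 2) ^+ 2 = (m'%:R - m%:R) ^+ 2 * (m'%:R + m%:R) ^+ 2 :> R.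
  by ring.
apply: (@le_trans _ _ ((m'%:R + m%:R) ^+ 2)).
  by rewrite ler_piMl// exprn_ge0// addr_ge0.
apply: (@le_trans _ _ ((2 * m%:R + 1) ^+ 2)); last by nra.
by rewrite ler_pXn2r ?nnegrE//; lra.
Qed.

Lemma weight_ev_le x e : weight (x + ev e) <= 2 * weight x + 2 * N%:R ^- 2.
Proof.
have := weight_ev x e.
have /andP[] := cyc_size_ev x e; have := cyc_size_le_weight x e.1.
move: (cyc_size _) (cyc_size _) => m' m hw.
rewrite -!(ler_nat R) => h1 h2 h3; rewrite -natr1 in h1; rewrite -natr1 in h2.
rewrite expr_div_n in hw.
have m0 : 0 <= m%:R :> R by [].
have m'0 : 0 <= m'%:R :> R by [].
have : (m'%:R ^+ 2 - m%:R ^+ 2) / N%:R ^+ 2 <= (m%:R ^+ 2 + 2) / N%:R ^+ 2 :> R.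
  rewrite ler_wpM2r ?invr_ge0 ?exprn_ge0//.
  have h4 : m'%:R ^+ 2 <= (m%:R + 1) ^+ 2 :> R by rewrite ler_pXn2r ?nnegrE//; lra.
  have := sqr_ge0 (m%:R - 1 : R); lra.
rewrite -h3 mulrDl; lra.
Qed.

End Weight.

(** * Bernstein's gradient estimate *)

Section Bernstein.
Context {R : realType} {n N : nat} (N0 : (0 < N)%N).
Local Notation V := 'rV['I_N.-1.+1]_n.
Local Notation ev e := (lclass N (evec e)).
Implicit Types (g k : V -> R) (x y z : V) (e : dir n).

Let NR : 0 < N%:R :> R. Proof. by rewrite ltr0n. Qed.

Lemma heat_le g (M t : R) x : 0 <= t -> (forall y, g y <= M) -> heat t g x <= M.
Proof.
move=> t0 h; apply: (subsol_le t (fun x t => heat t g x) (fun x t => laplace (heat t g) x)).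
- by move=> y; exact: heat_diff.
- by [].
- by move=> y; rewrite heat0.
- by rewrite t0 lexx.
Qed.

Lemma heat_norm_le g (M t : R) x : 0 <= t -> (forall y, `|g y| <= M) ->
  `|heat t g x| <= M.
Proof.
move=> t0 h; rewrite ler_norml; apply/andP; split; last first.
  by apply: heat_le => // y; apply: le_trans (h y); exact: ler_norm.
have := heat_le (fun y => -1 * g y) M t x t0; rewrite heat_scale// mulN1r.
rewrite lerNl => -> // y; rewrite mulN1r; apply: le_trans (h y).
by rewrite -normrN ler_norm.
Qed.

(* [v ^ 2 + t * |grad v| ^ 2] is a subsolution when [v] solves the heat equation;
   the square of [theta + weight + 10 * n * t] is a supersolution. *)
Lemma bernstein g (A theta t : R) x0 x :
  N%:R ^- 2 <= theta -> 0 <= t -> 0 <= A ->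
  (forall y, `|g y| <= A * (theta + weight (y - x0))) ->
  heat t g x ^+ 2 + t * \sum_e lgrad e (heat t g) x ^+ 2 <=
  (A * (theta + weight (x - x0) + 10 * n%:R * t)) ^+ 2.
Proof.
move=> hth t0 A0 hg.
have th0 : 0 < theta by apply: lt_le_trans hth; rewrite invr_gt0 exprn_gt0.
pose w y : R := weight (y - x0).
pose W s y := theta + w y + 10 * n%:R * s.
pose v s := heat s g.
have dgrad e y : diff_on 0 t (fun s => lgrad e (v s) y)
   (fun s => laplace (lgrad e (v s)) y).
  have -> : (fun s => lgrad e (v s) y) = (fun s => N%:R * (v s (y + ev e) - v s y)) by [].
  apply: diff_on_ext (diff_on_scale _ _ N%:R _ _
    (diff_on_sub _ _ _ _ _ _ (heat_diff t g (y + ev e)) (heat_diff t g y))) => // s _.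
  rewrite -laplace_shift.
  have := laplace_lin N%:R (- N%:R) (fun z => v s (z + ev e)) (v s) y.
  rewrite mulNr -mulrBr => <-; congr laplace.
  by apply/funext => z; rewrite /lgrad; ring.
have dsq (f df : R -> R) : diff_on 0 t f df ->
    diff_on 0 t (fun s => f s ^+ 2) (fun s => 2 * f s * df s).
  move=> h; apply: diff_on_ext (diff_on_mul _ _ _ _ _ _ h h) => // s _; ring.
have did : diff_on 0 t (fun s => s) (fun=> 1).
  by apply: derivable_diff_on => s _; exact: is_derive_id.
pose F y s := (v s y ^+ 2 + s * \sum_e lgrad e (v s) y ^+ 2) - A ^+ 2 * W s y ^+ 2.
pose S1 y s := \sum_e lgrad e (v s) y ^+ 2.
pose S2 y s := \sum_e 2 * lgrad e (v s) y * laplace (lgrad e (v s)) y.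
pose dF y s := (2 * v s y * laplace (v s) y + (1 * S1 y s + s * S2 y s))
   - A ^+ 2 * (2 * W s y * (10 * n%:R)).
suff : F x t <= 0 by rewrite /F subr_le0 exprMn.
apply: (subsol_le t F dF) => //; last by rewrite t0 lexx.
- move=> y; apply: diff_on_sub.
    apply: diff_on_add; first by apply: dsq; exact: heat_diff.
    apply: diff_on_mul => //; apply: diff_on_sum => e; exact: dsq.
  apply: diff_on_scale; apply: dsq.
  have h := diff_on_add _ _ _ _ _ _ (diff_on_cst 0 t (theta + w y))
     (diff_on_scale _ _ (10 * n%:R) _ _ did).
  by apply: diff_on_ext h => // s _; rewrite add0r mulr1.
- move=> y s /andP[s0 st].
  have Wpos : 0 <= W s y.
    by rewrite /W !addr_ge0 ?mulr_ge0 ?(ltW th0) ?(ltW s0) ?weight_ge0.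
  (* Origin of the 10: [laplace_sqr] gives at most [2 * W * (2 * n)] from the Laplacian of [W], plus
     [8 * W] for each of the [2 * n] directions. The total [20 * n * W] is the time derivative of
     [W ^ 2]. *)
  have lapW : laplace (fun z => W s z ^+ 2) y <= 2 * W s y * (10 * n%:R).
    rewrite laplace_sqr.
    have EW : laplace (W s) y = laplace weight (y - x0).
      rewrite -laplace_shift /laplace; congr (_ * _); apply: eq_bigr => e _.
      by rewrite /W /w; ring.
    have Eg e : lgrad e (W s) y = lgrad e weight (y - x0).
      by rewrite /lgrad /W /w [y + _ - _]addrAC; ring.
    have h1 : laplace (W s) y <= n%:R * 2 by rewrite EW; exact: laplace_weight.
    have h2 : \sum_e lgrad e (W s) y ^+ 2 <= \sum_(e : dir n) 8 * W s y.
      apply: ler_sum => e _; rewrite Eg; apply: le_trans (lgrad_weight_sqr N0 _ _) _.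
      rewrite ler_pM2l// /W /w.
      have : 0 <= 10 * n%:R * s by rewrite !mulr_ge0// ltW.
      by move: hth; set a := weight _; lra.
    have cE : \sum_(e : dir n) 8 * W s y = 8 * W s y * (n%:R * 2).
      by rewrite sumr_const card_prod card_ord card_bool -[LHS]mulr_natr natrM.
    rewrite cE in h2.
    have h3 : 2 * W s y * laplace (W s) y <= 2 * W s y * (n%:R * 2).
      by rewrite ler_wpM2l// mulr_ge0.
    apply: le_trans (lerD h3 h2) _; rewrite -subr_ge0.
    have -> : 2 * W s y * (10 * n%:R) - (2 * W s y * (n%:R * 2) + 8 * W s y * (n%:R * 2))
      = 0 by ring.
    by [].
  have E : laplace (F ^~ s) y = laplace (fun z => v s z ^+ 2) y +
      s * \sum_e laplace (fun z => lgrad e (v s) z ^+ 2) y -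
      A ^+ 2 * laplace (fun z => W s z ^+ 2) y.
    rewrite -laplace_sum.
    have e1 := laplace_lin 1 s (fun z => v s z ^+ 2) (S1 ^~ s) y.
    have e2 := laplace_lin 1 (- A ^+ 2) (fun z => 1 * (v s z) ^+ 2 + s * S1 z s)
      (fun z => W s z ^+ 2) y.
    rewrite e1 !mul1r mulNr in e2; rewrite -e2; congr laplace.
    by apply/funext => z; rewrite /F /S1; ring.
  rewrite E laplace_sqr /dF.
  under [X in _ <= _ + s * X - _]eq_bigr => e _ do rewrite laplace_sqr.
  rewrite big_split/= -/(S1 y s) -/(S2 y s).
  have h4 : A ^+ 2 * laplace (fun z => W s z ^+ 2) y <=
     A ^+ 2 * (2 * W s y * (10 * n%:R)) by rewrite ler_wpM2l// exprn_ge0.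
  (* The squared gradient produced by the factor [s] under the time derivative cancels the one in
     the Laplacian of [v ^ 2]. These second differences are what remains, with the favourable
     sign. *)
  have h5 : 0 <= s * \sum_e \sum_e' lgrad e' (lgrad e (v s)) y ^+ 2.
    apply: mulr_ge0; first exact: ltW.
    apply: sumr_ge0 => e _; apply: sumr_ge0 => e' _.
    by rewrite sqr_ge0.
  lra.
- move=> y; rewrite /F mul0r addr0 /W mulr0 addr0 /v heat0 subr_le0 -exprMn.
  have h6 := hg y; have h7 := le_trans (normr_ge0 _) h6.
  by rewrite -(real_normK (num_real (g y))) ler_pXn2r ?nnegrE.
Qed.

End Bernstein.

Section PowR.
Context {R : realType}.

Lemma powR_le_pos (a b q : R) : 0 <= a -> a <= b -> 0 <= q -> a `^ q <= b `^ q.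
Proof.
by move=> a0 ab q0; apply: (ge0_ler_powR q0) => //; rewrite nnegrE// (le_trans a0).
Qed.

Lemma powR_le_neg (a b q : R) : 0 < a -> a <= b -> q <= 0 -> b `^ q <= a `^ q.
Proof.
move=> a0 ab q0; have b0 : 0 < b by apply: lt_le_trans ab.
rewrite -[q]opprK !(powRN _ (- q)) lef_pV2 ?posrE ?powR_gt0//.
by apply: powR_le_pos; rewrite ?oppr_ge0// ltW.
Qed.

End PowR.

(** * Iterated difference quotients of the heat flow *)

Section HeatGradients.
Context {R : realType} {n N : nat} (N0 : (0 < N)%N).
Local Notation V := 'rV['I_N.-1.+1]_n.
Local Notation ev e := (lclass N (evec e)).
Implicit Types (g : V -> R) (x y z : V) (e : dir n).

Let NR : 0 < N%:R :> R. Proof. by rewrite ltr0n. Qed.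

(** [1 + 10 * n] is [bernstein] at times below [theta]; 4 pays for passing to a neighbouring site
    below the lattice scale; the square root converts the actual scale into [theta]. *)
Definition grad_cst (m : nat) : R := 4 * (1 + 10 * n%:R) * Num.sqrt m.+1%:R.

Lemma grad_cst_ge0 m : 0 <= grad_cst m.
Proof. by rewrite mulr_ge0// mulr_ge0// addr_ge0// mulr_ge0. Qed.

Lemma heat_weight_le g (A theta t : R) x0 x :
  N%:R ^- 2 <= theta -> 0 <= t <= theta -> 0 <= A ->
  (forall y, `|g y| <= A * (theta + weight (y - x0))) ->
  `|heat t g x| <= (1 + 10 * n%:R) * (A * (theta + weight (x - x0))).
Proof.
move=> hth /andP[t0 tt] A0 hg.
have th0 : 0 <= theta by apply: le_trans tt.
have w0 := @weight_ge0 R n N (x - x0).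
have n0 : 0 <= n%:R :> R by [].
have h1 : 0 <= theta + weight (x - x0) + 10 * n%:R * t :> R.
  by rewrite !addr_ge0 ?mulr_ge0.
have := bernstein N0 g A theta t x0 x hth t0 A0 hg.
have : 0 <= t * \sum_e lgrad e (heat t g) x ^+ 2.
  by rewrite mulr_ge0//; apply: sumr_ge0 => e _; rewrite sqr_ge0.
set S := t * _ => S0 hb.
have : heat t g x ^+ 2 <= (A * (theta + weight (x - x0) + 10 * n%:R * t)) ^+ 2 by lra.
rewrite -(real_normK (num_real (heat t g x))) ler_pXn2r ?nnegrE ?mulr_ge0// => h.
apply: (le_trans h); rewrite mulrCA ler_wpM2l//.
have : 10 * n%:R * t <= 10 * n%:R * theta by rewrite ler_wpM2l// ?mulr_ge0.
have : 0 <= 10 * n%:R * weight (x - x0) :> R by rewrite !mulr_ge0.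
lra.
Qed.

(* For [t] below the lattice scale [N ^- 2] the difference quotient is bounded
   crudely by [N] times the function, and above it by [bernstein]. *)
Lemma heat_grad_weight g (A theta t : R) (m : nat) e x0 x :
  N%:R ^- 2 <= theta -> 0 <= t <= theta -> 0 <= A ->
  theta <= m%:R * t + N%:R ^- 2 ->
  (forall y, `|g y| <= A * (theta + weight (y - x0))) ->
  `|lgrad e (heat t g) x| <=
    (grad_cst m / Num.sqrt theta * A) * (theta + weight (x - x0)).
Proof.
move=> hth /andP[t0 tt] A0 hm hg.
have N2 : 0 < N%:R ^- 2 :> R by rewrite invr_gt0 exprn_gt0.
have th0 : 0 < theta by apply: lt_le_trans hth.
have w0 y := @weight_ge0 R n N (y - x0).
have n0 : 0 <= n%:R :> R by [].
have W0 : 0 < theta + weight (x - x0) by have := w0 x; lra.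
have s1 : 0 < Num.sqrt theta by rewrite sqrtr_gt0.
set c : R := 1 + 10 * n%:R.
have c0 : 0 <= c by rewrite /c addr_ge0// mulr_ge0.
have msum : m.+1%:R = m%:R + 1 :> R by rewrite natr1.
rewrite /grad_cst -/c.
have -> : 4 * c * Num.sqrt m.+1%:R / Num.sqrt theta * A * (theta + weight (x - x0)) =
  (4 * c * (A * (theta + weight (x - x0)))) * (Num.sqrt m.+1%:R / Num.sqrt theta).
  by field; rewrite gt_eqF.
have AW0 : 0 <= A * (theta + weight (x - x0)) by rewrite mulr_ge0// ltW.
(* Applied with [r] the larger of [t] and [N ^- 2]; in either case the hypothesis on [theta] gives
   [theta <= (m + 1) * r]. *)
have sq_le (r : R) : 0 < r -> theta <= m.+1%:R * r ->
    (Num.sqrt r)^-1 <= Num.sqrt m.+1%:R / Num.sqrt theta.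
  move=> r0 hr; have sr : 0 < Num.sqrt r by rewrite sqrtr_gt0.
  rewrite ler_pdivlMr// mulrC ler_pdivrMr// -sqrtrM//.
  by rewrite ler_wsqrtr.
have [hNt|hNt] := leP (N%:R ^- 2) t.
  have tpos : 0 < t by apply: lt_le_trans hNt.
  have := bernstein N0 g A theta t x0 x hth t0 A0 hg.
  have h1 : t * lgrad e (heat t g) x ^+ 2 <= t * \sum_e lgrad e (heat t g) x ^+ 2.
    rewrite ler_pM2l// (bigD1 e)//= lerDl; apply: sumr_ge0 => e' _.
    by rewrite sqr_ge0.
  have h2 := sqr_ge0 (heat t g x) => hb.
  have : (Num.sqrt t * `|lgrad e (heat t g) x|) ^+ 2 <=
     (c * (A * (theta + weight (x - x0)))) ^+ 2.
    rewrite exprMn sqr_sqrtr// real_normK ?num_real//.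
    apply: (@le_trans _ _ ((A * (theta + weight (x - x0) + 10 * n%:R * t)) ^+ 2)); first by lra.
    have h8 : 0 <= theta + weight (x - x0) + 10 * n%:R * t.
      by rewrite addr_ge0 ?(ltW W0)// !mulr_ge0.
    rewrite ler_pXn2r ?nnegrE ?mulr_ge0 ?(ltW W0)//.
    rewrite mulrCA ler_wpM2l//.
    have : 10 * n%:R * t <= 10 * n%:R * theta by rewrite ler_wpM2l// ?mulr_ge0.
    have : 0 <= 10 * n%:R * weight (x - x0) :> R by rewrite !mulr_ge0.
    rewrite /c; lra.
  rewrite ler_pXn2r ?nnegrE ?(mulr_ge0 c0 AW0) ?mulr_ge0// => h3.
  have st : 0 < Num.sqrt t by rewrite sqrtr_gt0.
  have : `|lgrad e (heat t g) x| <= c * (A * (theta + weight (x - x0))) * (Num.sqrt t)^-1.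
    by rewrite ler_pdivlMr// mulrC.
  move=> h4; apply: (le_trans h4); apply: ler_pM.
  - by rewrite mulr_ge0.
  - by rewrite invr_ge0 ltW.
  - by rewrite -mulrA ler_peMl ?mulr_ge0//; lra.
  - apply: sq_le => //; rewrite msum; lra.
have hb y := heat_weight_le g A theta t x0 y hth ltac:(by rewrite t0 tt) A0 hg.
have tN : theta <= m.+1%:R * N%:R ^- 2.
  rewrite msum mulrDl mul1r; apply: (le_trans hm); rewrite lerD2r.
  by rewrite ler_wpM2l// ltW.
have hN := sq_le _ N2 tN.
have EN : (Num.sqrt (N%:R ^- 2))^-1 = N%:R :> R.
  by rewrite -exprVn sqrtr_sqr ger0_norm ?invr_ge0// ?invrK// ltW.
rewrite EN in hN.
rewrite /lgrad normrM ger0_norm// mulrC; apply: ler_pM => //.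
apply: (le_trans (ler_normB _ _)).
apply: (le_trans (lerD (hb _) (hb _))).
rewrite -mulrDr -mulrDr.
have -> : 4 * c * (A * (theta + weight (x - x0))) =
  c * (A * (4 * (theta + weight (x - x0)))) by ring.
rewrite ler_wpM2l// ler_wpM2l//.
have := weight_ev_le (R := R) N0 (x - x0) e.
rewrite [x + _ - _]addrAC; have := w0 x; set a := weight _; set b := weight _; lra.
Qed.

(** The total time is cut into equal pieces, one for each difference. Each piece returns a bound of
    the same shape [theta + weight], only with a larger constant; this is why the estimate is kept
    at every [x] and not just at [x0]. *)
Lemma heat_lgrads_weight g (A theta t : R) (m : nat) es x0 x :
  N%:R ^- 2 <= theta -> 0 <= t <= theta -> 0 <= A ->
  theta <= m%:R * t + N%:R ^- 2 ->
  (forall y, `|g y| <= A * (theta + weight (y - x0))) ->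
  `|lgrads es (heat ((size es)%:R * t) g) x| <=
    ((grad_cst m / Num.sqrt theta) ^+ size es * A) * (theta + weight (x - x0)).
Proof.
move=> hth tt A0 hm hg; have t0 : 0 <= t by case/andP: tt.
elim: es x => [|e es IH] x /=; first by rewrite mul0r heat0 expr0 mul1r.
have -> : lgrads es (heat ((size es).+1%:R * t) g) =
    heat t (lgrads es (heat ((size es)%:R * t) g)).
  rewrite heat_lgrads// heat_semigroup// ?mulr_ge0//.
  by congr (lgrads es (heat _ g)); rewrite -natr1; ring.
rewrite exprS -!mulrA mulrA [in X in _ <= X]mulrA -[in X in _ <= X]mulrA.
have := heat_grad_weight (lgrads es (heat ((size es)%:R * t) g))
  ((grad_cst m / Num.sqrt theta) ^+ size es * A) theta t m e x0 x hth tt _ hm IH.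
rewrite !mulrA; apply.
by rewrite mulr_ge0// exprn_ge0// divr_ge0// grad_cst_ge0.
Qed.

(** One factor per difference, each over time [t / k]; then [theta = k * (t / k) + N ^- 2] dictates
    [m = k]. *)
Definition heat_cst (k : nat) : R := grad_cst k ^+ k.

Lemma heat_cst_ge0 k : 0 <= heat_cst k.
Proof. by rewrite exprn_ge0// grad_cst_ge0. Qed.

Lemma heat_lgrads_key g (A t theta : R) es x0 : (0 < size es)%N ->
  0 <= t -> 0 <= A -> theta = t + N%:R ^- 2 ->
  (forall y, `|g y| <= A * (theta + weight (y - x0))) ->
  `|lgrads es (heat t g) x0| <=
    heat_cst (size es) * A * theta `^ (1 - (size es)%:R / 2).
Proof.
move=> k0 t0 A0 thE hg; set k := size es.
have kR : 0 < k%:R :> R by rewrite ltr0n.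
have N2 : 0 < N%:R ^- 2 :> R by rewrite invr_gt0 exprn_gt0.
have th0 : 0 < theta by rewrite thE; lra.
have tk : 0 <= t / k%:R <= theta.
  rewrite divr_ge0//= ler_pdivrMr// thE.
  have : 1 <= k%:R :> R by rewrite ler1n.
  have : 0 <= (t + N%:R ^- 2) * (k%:R - 1) by rewrite mulr_ge0 ?subr_ge0 ?ler1n//; lra.
  lra.
have := heat_lgrads_weight g A theta (t / k%:R) k es x0 x0 _ tk A0 _ hg.
have Ek : k%:R * (t / k%:R) = t by rewrite mulrC divfK ?gt_eqF.
rewrite -/k !Ek subrr weight0 addr0.
rewrite thE lerDr t0 => /(_ isT (lexx _)); rewrite -thE.
move=> h; apply: (le_trans h); rewrite le_eqVlt; apply/orP; left; apply/eqP.
rewrite /heat_cst expr_div_n powRD; last by rewrite (gt_eqF th0) implybT.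
rewrite powRr1 ?(ltW th0)// powRN.
have -> : theta `^ (k%:R / 2) = Num.sqrt theta ^+ k.
  by rewrite mulrC powRrM powR12_sqrt ?(ltW th0)// powR_mulrn// sqrtr_ge0.
by field; rewrite expf_neq0// gt_eqF// sqrtr_gt0.
Qed.

(** A bounded datum has the growth of [heat_lgrads_key] with constant [M / theta]. The exponent of
    [theta] ends up negative, so [theta] may be lowered to [t]. *)
Lemma heat_lgrads_sup g (M t : R) es x0 : (0 < size es)%N -> 0 < t ->
  (forall y, `|g y| <= M) ->
  `|lgrads es (heat t g) x0| <= heat_cst (size es) * M * t `^ (- ((size es)%:R / 2)).
Proof.
move=> k0 t0 hM.
have M0 : 0 <= M by apply: le_trans (hM x0).
have N2 : 0 < N%:R ^- 2 :> R by rewrite invr_gt0 exprn_gt0.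
pose theta := t + N%:R ^- 2.
have th0 : 0 < theta by rewrite /theta; lra.
have := heat_lgrads_key g (M / theta) t theta es x0 k0 (ltW t0) _ erefl.
rewrite divr_ge0 ?(ltW th0)// => /(_ isT) h.
apply: (le_trans (h _)).
  move=> y; apply: (le_trans (hM y)).
  by rewrite mulrDr divfK ?gt_eqF// lerDl mulr_ge0 ?divr_ge0 ?(ltW th0)// weight_ge0.
rewrite powRD; last by rewrite (gt_eqF th0) implybT.
rewrite powRr1 ?(ltW th0)//; set p := theta `^ _.
have -> : heat_cst (size es) * (M / theta) * (theta * p) = heat_cst (size es) * M * p.
  by field; rewrite gt_eqF.
rewrite ler_wpM2l ?mulr_ge0 ?heat_cst_ge0//; apply: powR_le_neg => //.
by rewrite /theta; lra.
Qed.

Lemma heat_lgrads_sup0 g (M t : R) es x0 : 0 < t -> (forall y, `|g y| <= M) ->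
  `|lgrads es (heat t g) x0| <= heat_cst (size es) * M * t `^ (- ((size es)%:R / 2)).
Proof.
case: es => [|e es] t0 hg; last exact: heat_lgrads_sup.
rewrite /= mul0r oppr0 powRr0 mulr1 /heat_cst expr0 mul1r.
by apply: heat_norm_le => //; exact: ltW.
Qed.

(** With [W = theta + weight >= theta] and [q <= 1], [W ^ q] is at most [theta ^ (q - 1) * W], so
    slower growth reduces to quadratic growth. At least two differences make the final exponent
    nonpositive, which allows [theta] to be replaced by [t]. *)
Lemma heat_lgrads_holder g (A t q : R) es x0 : (1 < size es)%N -> 0 < t -> 0 <= A ->
  0 <= q <= 1 ->
  (forall y, `|g y| <= A * (t + weight (y - x0)) `^ q) ->
  `|lgrads es (heat t g) x0| <= heat_cst (size es) * A * t `^ (q - (size es)%:R / 2).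
Proof.
move=> k1 t0 A0 /andP[q0 q1] hg.
have N2 : 0 < N%:R ^- 2 :> R by rewrite invr_gt0 exprn_gt0.
pose theta := t + N%:R ^- 2.
have th0 : 0 < theta by rewrite /theta; lra.
have thn : (theta == 0) = false by rewrite gt_eqF.
have h := heat_lgrads_key g (A * theta `^ (q - 1)) t theta es x0 (ltnW k1) (ltW t0) _ erefl.
apply: (le_trans (h _ _)).
- by rewrite mulr_ge0// powR_ge0.
- move=> y; apply: (le_trans (hg y)); rewrite -mulrA ler_wpM2l//.
  have w0 := @weight_ge0 R n N (y - x0).
  have W0 : 0 < theta + weight (y - x0) by lra.
  apply: (@le_trans _ _ ((theta + weight (y - x0)) `^ q)).
    by apply: powR_le_pos => //; [have := w0; lra|rewrite /theta; lra].
  have -> : q = (q - 1) + 1 by lra.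
  rewrite addrK powRD; last by rewrite (gt_eqF W0) implybT.
  rewrite powRr1 ?(ltW W0)// ler_pM2r//; apply: powR_le_neg => //; lra.
rewrite -!mulrA ler_wpM2l ?heat_cst_ge0// ler_wpM2l//.
rewrite -powRD ?thn ?implybT//.
have -> : q - 1 + (1 - (size es)%:R / 2) = q - (size es)%:R / 2 by lra.
apply: powR_le_neg => //; first by rewrite /theta; lra.
have : 2 <= (size es)%:R :> R by rewrite (ler_nat R 2).
lra.
Qed.

End HeatGradients.

(** * Integer representatives and Lipschitz bounds *)

Section Lifts.
Context {R : realType} {n N : nat} (N0 : (0 < N)%N).
Local Notation V := 'rV['I_N.-1.+1]_n.
Local Notation ev e := (lclass N (evec e)).
Implicit Types (g : V -> R) (x y z : V) (e : dir n) (a : 'rV[int]_n).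

Let NR : 0 < N%:R :> R. Proof. by rewrite ltr0n. Qed.

Lemma lclass0 : lclass N (0 : 'rV[int]_n) = 0.
Proof. by apply/rowP => i; rewrite !mxE. Qed.

Lemma cyc_size0 : cyc_size (0 : 'I_N.-1.+1) = 0%N.
Proof. by rewrite /cyc_size /= min0n. Qed.

Lemma cyc_size_mulrz (c : int) : (cyc_size (inZp 1 *~ c : 'I_N.-1.+1) <= `|c|)%N.
Proof.
have pos m : (cyc_size (inZp 1 *+ m : 'I_N.-1.+1) <= m)%N.
  elim: m => [|m IH]; first by rewrite mulr0n cyc_size0.
  by rewrite mulrSr; have /andP[h _] := cyc_size_step N0 (inZp 1 *+ m); apply: leq_trans h _.
have neg m : (cyc_size (inZp 1 *- m : 'I_N.-1.+1) <= m)%N.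
  elim: m => [|m IH]; first by rewrite mulr0n oppr0 cyc_size0.
  rewrite mulrSr opprD.
  have /andP[_ h] := cyc_size_step N0 (inZp 1 *- m - inZp 1); rewrite subrK in h.
  exact: leq_trans h _.
by case: c => m; [exact: pos|exact: neg].
Qed.

Lemma euclid_sqr (v : 'rV[R]_n) : euclid v ^+ 2 = \sum_i v 0 i ^+ 2.
Proof. by rewrite sqr_sqrtr// sumr_ge0// => i _; rewrite sqr_ge0. Qed.

Lemma weight_lclass_le a :
  weight (lclass N a) <= euclid (N%:R^-1 *: ivec R a) ^+ 2.
Proof.
rewrite euclid_sqr; apply: ler_sum => i _.
rewrite !mxE mulrC -[leRHS]real_normK ?num_real// normrM.
rewrite ler_pXn2r ?nnegrE ?mulr_ge0 ?invr_ge0//.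
rewrite (@ger0_norm _ N%:R^-1) ?invr_ge0// ler_wpM2l ?invr_ge0//.
by rewrite -intr_norm -natr_absz ler_nat cyc_size_mulrz.
Qed.

(** The Nash estimate lives on the integer lattice. The representative that is smallest in each
    coordinate turns its Euclidean distance into [weight]. *)
Lemma lift_weight x : exists a, lclass N a = x /\
  euclid (N%:R^-1 *: ivec R a) ^+ 2 = weight x.
Proof.
pose c i : nat := x 0%R i.
pose a : 'rV[int]_n := \row_i (if (c i <= N - c i)%N then (c i)%:Z else (c i)%:Z - N%:Z).
have NE : (inZp 1 : 'I_N.-1.+1) *+ N = 0.
  by apply: val_inj; rewrite Zp_mulrn /= prednK// modnMl.
have xE (k : 'I_N.-1.+1) : (inZp 1 : 'I_N.-1.+1) *+ k = k.
  apply: val_inj; rewrite Zp_mulrn /=.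
  have := ltn_cyc N0 k; move: (nat_of_ord k) => m mN; rewrite prednK//.
  by rewrite modnMml mul1n modn_small.
exists a; split.
  apply/rowP => i; rewrite !mxE; case: ifP => _; first exact: xE.
  rewrite mulrzBr -[X in _ - X]/(inZp 1 *+ N) NE subr0; exact: xE.
rewrite euclid_sqr; apply: eq_bigr => i _; rewrite !mxE mulrC.
have := ltn_cyc N0 (x 0 i); rewrite /cyc_size -/(c i); case: ifP => h xN.
  by rewrite (minn_idPl h).
have h' : (N - c i <= c i)%N by lia.
rewrite (minn_idPr h') natrB ?(ltnW xN)// intrD mulrNz -!pmulrn.
by rewrite -sqrrN -mulNr opprB.
Qed.

(** Induction on the sum of the absolute coordinates of [a], removing one unit step towards the
    origin along a nonzero coordinate. *)
Lemma lipschitz_lclass g (G : R) a y : (forall x e, `|lgrad e g x| <= G) ->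
  `|g (y + lclass N a) - g y| <= G / N%:R * \sum_i `|a 0 i|%:~R.
Proof.
move=> hG.
have G0 (e : dir n) : 0 <= G by apply: le_trans (hG 0 e).
have stp x e : `|g (x + ev e) - g x| <= G / N%:R.
  by rewrite ler_pdivlMr// -(ger0_norm (ltW NR)) -normrM mulrC; exact: hG.
rewrite -(@raddf_sum _ _ (intr : int -> R)) /=.
have [m] : exists m : nat, \sum_i `|a 0 i| = m%:Z.
  exists `|(\sum_i `|a 0 i|)%R|%N; rewrite gez0_abs//; exact: sumr_ge0.
elim: m a => [|m IH] a hm.
  have -> : a = 0.
    apply/rowP => i; rewrite mxE; apply/eqP; rewrite -normr_eq0.
    have := hm; rewrite (bigD1 i)//= => /eqP; rewrite paddr_eq0//.
      by case/andP.
    exact: sumr_ge0.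
  by rewrite lclass0 addr0 subrr normr0 big1 ?mulr0// => i _; rewrite mxE normr0.
have [i ai] : exists i, a 0 i != 0.
  case: (pickP (fun i => a 0 i != 0)) => [i ai|h]; first by exists i.
  have : \sum_i `|a 0 i| = 0.
    by apply: big1 => i _; have := h i; move=> /negbFE /eqP ->; rewrite normr0.
  by rewrite hm.
pose e : dir n := (i, 0 < a 0 i).
pose b := a - evec e.
have bE j : b 0 j = if j == i then (if 0 < a 0 i then a 0 i - 1 else a 0 i + 1)
   else a 0 j.
  rewrite /b /e /evec !mxE /=; case: ifP => ha; rewrite !mxE/= ?opprK;
   by case: (eqVneq j i) => [->|_]; rewrite ?subr0 ?addr0.
have hb : \sum_i `|b 0 i| = m%:Z.
  move: hm; rewrite (bigD1 i)//= [in X in _ -> X](bigD1 i)//= bE eqxx.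
  have -> : \sum_(j < n | j != i) `|b 0 j| = \sum_(j < n | j != i) `|a 0 j|.
    by apply: eq_bigr => j /negPf ji; rewrite bE ji.
  move: ai; set S := \sum_(_ < n | _) _; move: (a 0 i) => c c0.
  case: ltP => hc; rewrite ?(ger0_norm (ltW hc)) ?(ler0_norm hc).
    rewrite ger0_norm; lia.
  rewrite ler0_norm; lia.
have := IH b hb; have := stp (y + lclass N b) e.
have -> : y + lclass N b + ev e = y + lclass N a.
  by rewrite -addrA -lclassD /b subrK.
rewrite hm hb -!pmulrn -natr1 mulrDr mulr1 => h1 h2.
have := ler_normD (g (y + lclass N a) - g (y + lclass N b)) (g (y + lclass N b) - g y).
rewrite addrA subrK => h3; apply: (le_trans h3); rewrite addrC; exact: lerD.
Qed.

Lemma lipschitz_weight g (G : R) y z : (forall x e, `|lgrad e g x| <= G) ->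
  `|g y - g z| <= n%:R * G * Num.sqrt (weight (y - z)).
Proof.
move=> hG; have [a [ha aw]] := lift_weight (y - z).
have := lipschitz_lclass g G a z hG; rewrite ha [z + _]addrC subrK => h.
apply: (le_trans h); rewrite -aw sqrtr_sqr ger0_norm ?sqrtr_ge0//.
set E := euclid _.
have -> : n%:R * G * E = \sum_(i < n) G * E.
  by rewrite sumr_const card_ord -[RHS]mulr_natl mulrA.
rewrite mulr_sumr; apply: ler_sum => i _; rewrite {}/E.
have G0 : 0 <= G by apply: le_trans (hG 0 (i, true)).
rewrite -mulrA ler_wpM2l//.
rewrite -[leLHS]ger0_norm ?mulr_ge0 ?invr_ge0// -sqrtr_sqr ler_wsqrtr//.
rewrite (bigD1 i)//= !mxE exprMn exprMn intr_norm real_normK ?num_real// lerDl.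
by apply: sumr_ge0 => j _; rewrite sqr_ge0.
Qed.

End Lifts.

(** * The Nash estimate with a source term *)

Section DividedDifference.
Context {R : realType} (phi dphi : R -> R).
Hypothesis dphiP : forall r : R, is_derive r 1 phi (dphi r).
Hypothesis cdphi : continuous dphi.

(** It writes the increment of [phi] as a coefficient times the increment of its argument, so that
    the nonlinear diffusion becomes a linear one. The value on the diagonal keeps the coefficient
    continuous in time. *)
Definition divdiff (p q : R) : R :=
  if p == q then dphi p else (phi q - phi p) / (q - p).

Lemma divdiffC p q : divdiff p q = divdiff q p.
Proof.
rewrite /divdiff eq_sym; case: eqVneq => [->//|pq].
by rewrite -(opprB p q) -(opprB (phi p)) invrN mulrNN.
Qed.

Lemma divdiffE p q : divdiff p q * (q - p) = phi q - phi p.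
Proof.
rewrite /divdiff; case: eqVneq => [->|pq]; first by rewrite !subrr mulr0.
by rewrite divfK// subr_eq0 eq_sym.
Qed.

Lemma divdiff_mvt p q : exists2 c, Num.min p q <= c <= Num.max p q & divdiff p q = dphi c.
Proof.
suff main p' q' : p' <= q' ->
    exists2 c, Num.min p' q' <= c <= Num.max p' q' & divdiff p' q' = dphi c.
  have [pq|/ltW qp] := leP p q.
    by have := main p q pq; rewrite (min_idPl pq) (max_idPr pq).
  by have := main q p qp; rewrite (min_idPl qp) (max_idPr qp) divdiffC.
move: p' q' => {}p {}q pq.
rewrite (min_idPl pq) (max_idPr pq) /divdiff.
case: eqVneq => [<-|npq]; first by exists p; rewrite ?lexx.
have {npq}pq' : p < q by rewrite lt_neqAle npq.
have cphi : {within `[p, q], continuous phi}.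
  apply: derivable_within_continuous => t _; by case: (dphiP t).
have [c cpq ->] := MVT pq' (fun x _ => dphiP x) cphi.
exists c; last by rewrite mulfK// subr_eq0 gt_eqF.
by move: cpq; rewrite in_itv/= => /andP[h1 h2]; rewrite !ltW.
Qed.

(** Where the two values coincide, the mean value point is squeezed between [p s] and [q s];
    elsewhere a quotient with nonzero denominator is continuous. *)
Lemma divdiff_continuous (p q : R -> R) : continuous p -> continuous q ->
  continuous (fun t => divdiff (p t) (q t)).
Proof.
move=> cp cq t.
have cphi : continuous phi.
  by move=> r; apply: differentiable_continuous; apply/derivable1_diffP; case: (dphiP r).
have [e|npq] := eqVneq (p t) (q t).
  apply/(@cvgrPdist_lt _ R^o) => eps eps0.
  have /continuous_epsP /(_ (p t) eps eps0) [d d0 hd] := cdphi.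
  have /continuous_epsP /(_ t d d0) [d1 d10 hd1] := cp.
  have /continuous_epsP /(_ t d d0) [d2 d20 hd2] := cq.
  apply/nbhs_ballP; exists (Num.min d1 d2); first by rewrite /= lt_min d10.
  move=> s; rewrite /ball/= lt_min => /andP[/hd1 h1 /hd2 h2].
  rewrite {1}/divdiff e eqxx -e.
  have [c /andP[c1 c2] ->] := divdiff_mvt (p s) (q s).
  apply: hd; rewrite -e in h2; move: h1 h2 c1 c2; rewrite !ltr_norml.
  by have [h|h] := leP (p s) (q s); lra.
have cv : (phi (q s) - phi (p s)) / (q s - p s) @[s --> t] -->
    (phi (q t) - phi (p t)) / (q t - p t).
  apply: (@cvgM R R); first apply: (@cvgB R R^o).
  - by apply: (@continuous_comp _ _ _ q phi); [exact: cq|exact: cphi].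
  - by apply: (@continuous_comp _ _ _ p phi); [exact: cp|exact: cphi].
  - apply: cvgV; first by rewrite subr_eq0 eq_sym.
    by apply: (@cvgB R R^o); [exact: cq|exact: cp].
rewrite /continuous_at [X in _ --> X]/divdiff (negPf npq).
apply: cvg_trans cv; apply: near_eq_cvg.
have : q s - p s @[s --> t] --> q t - p t by apply: (@cvgB R R^o); [exact: cq|exact: cp].
move=> /(@cvgrPdist_lt _ R^o) /(_ `|q t - p t|).
rewrite normr_gt0 subr_eq0 eq_sym npq => /(_ isT).
apply: filterS => s hs; rewrite /divdiff; case: eqVneq => // e.
by move: hs; rewrite e subrr subr0 ltxx.
Qed.

End DividedDifference.

(** The parameters up to [up] are those on which constants may depend. [N], [K] and the functions
    come after, so a constant chosen before them is uniform in them. *)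
Record admissible {R : realType} {n : nat} (cm cp T nf nphi um up : R) (N : nat)
    (K : R) (phi dphi ddphi f : R -> R) (u : R -> 'rV['I_N.-1.+1]_n -> R) : Prop :=
  Admissible {
    adm_N : (0 < N)%N;
    adm_K : 0 < K;
    adm_phi : forall r : R, is_derive r 1 phi (dphi r);
    adm_dphi : forall r : R, is_derive r 1 dphi (ddphi r);
    adm_dphi_bd : forall r, um <= r <= up -> cm <= dphi r <= cp;
    adm_ddphi_bd : forall r, um <= r <= up -> `|ddphi r| <= nphi;
    adm_f_bd : forall r, um <= r <= up -> `|f r| <= nf;
    adm_u : forall x, diff_on 0 T (fun t => u t x)
      (fun t => laplace (fun y => phi (u t y)) x + K * f (u t x));
    adm_range : forall t x, 0 <= t <= T -> um <= u t x <= up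
  }.

Section NashWindow.
Context {R : realType} {n : nat} (cm cp T nf nphi um up : R) (N : nat)
  (K : R) (phi dphi ddphi f : R -> R) (u : R -> 'rV['I_N.-1.+1]_n -> R).
Hypothesis hc : 0 < cm.
Hypothesis adm : admissible cm cp T nf nphi um up N K phi dphi ddphi f u.
Local Notation V := 'rV['I_N.-1.+1]_n.
Local Notation ev e := (lclass N (evec e)).

Let N0 := adm_N _ _ _ _ _ _ _ _ _ _ _ _ _ _ adm.
Let U : R := Num.max `|um| `|up|.

Lemma range_norm r : um <= r <= up -> `|r| <= U.
Proof.
move=> /andP[h1 h2]; rewrite /U le_max !ler_norml.
have [r0|r0] := leP 0 r; apply/orP; [right|left].
  by rewrite ger0_norm; lra.
by rewrite ler0_norm; lra.
Qed.

(* The comparison function [v] solves the homogeneous equation with the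
   coefficients of [u], frozen outside the window [t1, t1 + h]. *)
Lemma nash_window (sigma C0 t1 h : R) :
  (forall (a : R -> 'rV[int]_n -> dir n -> R)
    (u0 : 'rV[int]_n -> R) (u : R -> 'rV[int]_n -> R),
    coefficients cm cp a ->
    (exists M : R, forall x, `|u0 x| <= M) ->
    bounded_solution N a u0 u ->
    forall (t s : R) (x y : 'rV[int]_n), 0 < t -> 0 < s ->
      `|u t x - u s y| <=
        C0 * sup [set `|u0 w| | w in [set: 'rV[int]_n]] *
        (Num.max (Num.sqrt `|t - s|) (euclid (N%:R^-1 *: ivec R (x - y)))
         / Num.sqrt (Num.min t s)) `^ sigma) ->
  0 <= t1 -> 0 < h -> t1 + h <= T ->
  exists v : R -> V -> R,
    (forall t x, 0 <= t <= h -> `|u (t1 + t) x - v t x| <= K * nf * t) /\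
    (forall (t s : R) (x y : 'rV[int]_n), 0 < t -> 0 < s ->
      `|v t (lclass N x) - v s (lclass N y)| <=
        `|C0| * U *
        (Num.max (Num.sqrt `|t - s|) (euclid (N%:R^-1 *: ivec R (x - y)))
         / Num.sqrt (Num.min t s)) `^ sigma).
Proof.
move=> hN t10 h0 hT.
have [_ K0 dphiP ddphiP cbd _ fbd du ru] := adm.
have cdphi : continuous dphi.
  move=> r; apply: differentiable_continuous; apply/derivable1_diffP.
  by case: (ddphiP r).
pose cl t : R := t1 + Num.min (Num.max t 0) h.
have clP t : 0 <= cl t <= T /\ t1 <= cl t <= t1 + h.
  have h1 : t1 <= cl t by rewrite lerDl le_min le_max lexx orbT ltW.
  have h2 : cl t <= t1 + h by rewrite lerD2l ge_min lexx orbT.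
  by rewrite h1 h2 (le_trans t10 h1) (le_trans h2 hT).
have clE t : 0 <= t <= h -> cl t = t1 + t.
  by move=> /andP[h1 h2]; rewrite /cl (max_idPl h1) (min_idPl h2).
pose uc x t := u (cl t) x.
have cl_lip t s : `|cl t - cl s| <= `|t - s|.
  rewrite /cl; have hh := ler_norm (t - s); have hh' := ler_norm (s - t).
  rewrite distrC in hh'; rewrite ler_norml.
  have [h1|h1] := leP t 0; have [h2|h2] := leP _ h;
  have [h3|h3] := leP s 0; have [h4|h4] := leP _ h; apply/andP; split; lra.
have cuc x : continuous (uc x).
  apply/continuous_epsP => t e e0.
  have [/within_continuousP hcu _] := du x.
  have [|d d0 hd] := hcu (cl t) _ e e0; first by rewrite /= in_itv/=; case: (clP t).
  exists d => // s ts; apply: hd; first by rewrite /= in_itv/=; case: (clP s).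
  exact: le_lt_trans (cl_lip t s) ts.
have ruc x t : um <= uc x t <= up by apply: ru; case: (clP t).
pose a t x e := divdiff phi dphi (uc x t) (uc (x + ev e) t).
have abd t x e : cm <= a t x e <= cp.
  rewrite /a; have [c /andP[c1 c2] ->] := divdiff_mvt phi dphi dphiP (uc x t) (uc (x + ev e) t).
  have /andP[h1 h2] := ruc x t; have /andP[h3 h4] := ruc (x + ev e) t.
  apply: cbd; apply/andP; split.
    by apply: le_trans c1; rewrite le_min h1.
  by apply: (le_trans c2); rewrite ge_max h2.
have ca x e : continuous (fun t => a t x e).
  exact: (divdiff_continuous phi dphi dphiP cdphi).
pose L t (g : V -> R) x := N%:R ^+ 2 * \sum_e a t x e * (g (x + ev e) - g x).
pose A t x y : R := N%:R ^+ 2 * \sum_e a t x e * ((y == x + ev e)%:R - (y == x)%:R).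
have AE t x g : \sum_y A t x y * g y = L t g x.
  rewrite /A /L; under eq_bigr => y _ do rewrite -mulrA mulr_suml.
  rewrite -mulr_sumr exchange_big/=; congr (_ * _); apply: eq_bigr => e _.
  under eq_bigr => y _ do rewrite -mulrA mulrBl.
  rewrite -mulr_sumr; congr (_ * _); rewrite sumrB; congr (_ - _).
    rewrite (bigD1 (x + ev e))//= eqxx mul1r big1 ?addr0// => y /negPf ->.
    by rewrite mul0r.
  by rewrite (bigD1 x)//= eqxx mul1r big1 ?addr0// => y /negPf ->; rewrite mul0r.
have Lmax t g x : (forall y, g y <= g x) -> L t g x <= 0.
  move=> hg; rewrite /L mulr_ge0_le0 ?exprn_ge0//; apply: sumr_le0 => e _.
  rewrite mulr_ge0_le0 ?subr_le0//; have /andP[h1 _] := abd t x e.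
  by apply: le_trans h1; exact: ltW.
have cA x y : continuous (fun t => A t x y).
  move=> t; apply: (@cvgM R R); first exact: cvg_cst.
  apply: continuous_sum => e {}t; apply: (@cvgM R R); [exact: ca|exact: cvg_cst].
have Abd t x : \sum_y `|A t x y| <= \sum_(y : V) N%:R ^+ 2 * \sum_(e : dir n) cp * 2.
  apply: ler_sum => y _; rewrite /A normrM ger0_norm ?exprn_ge0//.
  rewrite ler_wpM2l ?exprn_ge0//; apply: (le_trans (ler_norm_sum _ _ _)).
  apply: ler_sum => e _; rewrite normrM; have /andP[h1 h2] := abd t x e.
  have h3 := le_trans (ltW hc) h1.
  apply: ler_pM => //; first by rewrite ger0_norm.
  apply: (le_trans (ler_normB _ _)); rewrite !ger0_norm//.
  by case: eqP => _; case: eqP => _ /=; lra.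
have [v [v0 cv dv]] := linear_ode V A _ (u t1) cA Abd.
have dvL x b : diff_on 0 b (fun t => v t x) (fun t => L t (v t) x).
  split=> [|t /andP[t0 _]]; first exact: continuous_subspaceT.
  by rewrite -AE; exact: dv.
have hT1 : 0 <= t1 <= T by rewrite t10; lra.
have vbd (t : R) x : 0 <= t -> `|v t x| <= U.
  move=> t0; rewrite ler_norml; apply/andP; split.
    rewrite lerNl; apply: (max_principle V t (fun x t => - v t x) (fun x t => - L t (v t) x)).
    - by move=> y; apply: diff_on_opp.
    - move=> y s _ hy; rewrite oppr_le0.
      have : L s (fun z => - v s z) y <= 0 by exact: Lmax.
      rewrite /L; under eq_bigr => e _ do rewrite -opprD mulrN.
      by rewrite sumrN mulrN oppr_le0.
    - move=> y; rewrite v0; apply: le_trans (range_norm _ (ru _ y hT1)).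
      by rewrite -normrN ler_norm.
    - by rewrite t0 lexx.
  apply: (max_principle V t (fun x t => v t x) (fun x t => L t (v t) x)).
  - by move=> y.
  - by move=> y s _ hy; exact: Lmax.
  - move=> y; rewrite v0; apply: le_trans (range_norm _ (ru _ y hT1)).
    exact: ler_norm.
  - by rewrite t0 lexx.
have dut x : diff_on 0 h (fun t => u (t1 + t) x)
   (fun t => L t (fun y => u (t1 + t) y) x + K * f (u (t1 + t) x)).
  have h1 t : 0 <= t <= h -> 0 <= 1 * t + t1 <= T by move=> /andP[]; lra.
  have h2 t : 0 < t < h -> 0 < 1 * t + t1 < T by move=> /andP[]; lra.
  apply: diff_on_ext (diff_on_affine 0 h 0 T _ _ 1 t1 h1 h2 (du x)).
    by move=> t; rewrite /= mul1r addrC.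
  move=> t /andP[ht0 hth]; rewrite !mul1r [t + t1]addrC; congr (_ + _).
  rewrite /laplace /L; congr (_ * _); apply: eq_bigr => e _.
  by rewrite /a /uc clE ?divdiffE// !ltW.
have nf0 : 0 <= nf.
  by apply: le_trans (fbd _ (ru t1 0 hT1)).
exists v; split.
  move=> t x th; have t0 : 0 <= t by case/andP: th.
  (* Both signs at once: [u - v] solves the same linear equation with a source of size at most
     [K * nf], hence is dominated by the spatially constant [K * nf * t]. *)
  have side (sg : R) : `|sg| = 1 -> forall x t, 0 <= t <= h ->
      sg * (u (t1 + t) x - v t x) - K * nf * t <= 0.
    move=> sg1; apply: (max_principle V h (fun x t => sg * (u (t1 + t) x - v t x) - K * nf * t)
      (fun x t => sg * (L t (fun y => u (t1 + t) y) x + K * f (u (t1 + t) x) - L t (v t) x)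
        - K * nf * 1)).
    - move=> y; apply: diff_on_sub.
        by apply: diff_on_scale; apply: diff_on_sub.
      by apply: diff_on_scale; apply: derivable_diff_on => s _; exact: is_derive_id.
    - move=> y s /andP[s0 sh] hy.
      have := Lmax s (fun y => sg * (u (t1 + s) y - v s y) - K * nf * s) y hy.
      have -> : L s (fun y => sg * (u (t1 + s) y - v s y) - K * nf * s) y =
        sg * (L s (fun y => u (t1 + s) y) y - L s (v s) y).
        rewrite /L !mulr_sumr -sumrB mulr_sumr; apply: eq_bigr => e _; ring.
      have : sg * (K * f (u (t1 + s) y)) <= K * nf.
        apply: (le_trans (ler_norm _)); rewrite normrM sg1 mul1r normrM gtr0_norm//.
        rewrite ler_pM2l//; apply: fbd; apply: ru; apply/andP; split; lra.
      lra.
    - by move=> y; rewrite addr0 v0 subrr !mulr0 subrr.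
  have := side 1 (normr1 _) x t th.
  have := side (-1) ltac:(by rewrite normrN normr1) x t th.
  by rewrite ler_norml; lra.
move=> t s x y t0 s0.
apply: le_trans (hN (fun t x e => a t (lclass N x) e) (fun x => u t1 (lclass N x))
  (fun t x => v t (lclass N x)) _ _ _ t s x y t0 s0) _.
(* The symmetry of the coefficients under reversal of an edge is the symmetry of the divided
   difference. *)
- split=> [z e|r z e _|r z e _]; last exact: abd.
    exact: continuous_subspaceT.
  rewrite /a lclassD divdiffC; congr (divdiff _ _ _ (uc _ r)).
  by rewrite lclass_dopp addrK.
- by exists U => z; apply: range_norm; exact: ru.
- split.
  + by exists U => r z r0; exact: vbd.
  + by move=> z; exact: continuous_subspaceT.
  + by move=> z; rewrite v0.
  + move=> r z r0; have := dv r (lclass N z) r0; rewrite AE /L.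
    by under eq_bigr => e _ do rewrite -lclassD.
rewrite ler_wpM2r ?powR_ge0//.
have sup0 : 0 <= sup [set `|u t1 (lclass N w)| | w in [set: 'rV[int]_n]] <= U.
  apply/andP; split.
    apply: (@le_trans _ _ `|u t1 (lclass N 0)|) => //; apply: ub_le_sup; last by exists 0.
    by exists U => _ [w _ <-]; apply: range_norm; exact: ru.
  apply: ge_sup; first by exists `|u t1 (lclass N 0)|, 0.
  by move=> _ [w _ <-]; apply: range_norm; exact: ru.
case/andP: sup0 => sup0 supU.
apply: (@le_trans _ _ (`|C0| * sup [set `|u t1 (lclass N w)| | w in [set: 'rV[int]_n]])).
  by rewrite ler_wpM2r// ler_norm.
by rewrite ler_wpM2l.
Qed.

End NashWindow.

(* On time intervals of this length the source [K * f] has an effect of order one. *)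
Definition tscale {R : realType} (K t : R) : R := Num.min t K^-1.

(** * Hölder modulus at the scale [tscale] *)

Section NashOsc.
Context {R : realType} {n : nat}.

Lemma weight_eq0 (N : nat) (x : 'rV['I_N.-1.+1]_n) : (0 < N)%N ->
  weight x = 0 :> R -> x = 0.
Proof.
move=> N0 h; apply/rowP => i; rewrite mxE; apply: val_inj => /=.
have := @cyc_size_le_weight R n N x i; rewrite h => hi.
have : ((cyc_size (x 0 i))%:R / N%:R) ^+ 2 == 0 :> R by rewrite eq_le hi sqr_ge0.
rewrite sqrf_eq0 mulf_eq0 invr_eq0 !pnatr_eq0 /cyc_size.
have := ltn_cyc N0 (x 0 i); move: (nat_of_ord (x 0 i)) => m; lia.
Qed.

Lemma powR_ge_quarter (a q : R) : 4^-1 <= a -> 0 <= q <= 1 -> 1 <= 4 * a `^ q.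
Proof.
move=> ha /andP[q0 q1].
have h1 : (4^-1) `^ q <= a `^ q by apply: powR_le_pos => //; rewrite invr_ge0.
have h2 : (4^-1) `^ 1 <= (4^-1) `^ q :> R.
  by apply: ger_powR => //; rewrite invr_gt0 ltr0n/= invf_le1// ler1n.
rewrite powRr1 ?invr_ge0// in h2; lra.
Qed.

(* If [d] is the squared parabolic distance, [nash_window] is applied on the
   window of length [tscale K t0 * lam] with [lam = sqrt (d / tscale K t0)]: the
   Nash term is then of order [lam ^ (sigma / 2)] and the source of order [lam]. *)
Lemma nash_osc (cm cp T sigma nf nphi um up : R) :
  0 < cm -> nash_exponent n cm cp sigma ->
  exists2 C : R, 0 <= C & forall N K phi dphi ddphi f u,
    @admissible R n cm cp T nf nphi um up N K phi dphi ddphi f u ->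
    forall (t0 s : R) x0 y, 0 < t0 <= T -> 0 <= s <= t0 ->
    `|u s y - u t0 x0| <=
      C * ((t0 - s + weight (y - x0)) / tscale K t0) `^ (sigma / 4).
Proof.
move=> hc [/andP[sg0 sg1] [C0 hC0]].
pose U : R := Num.max `|um| `|up|.
have U0 : 0 <= U by rewrite le_max normr_ge0.
exists (8 * U + 4 * (`|C0| * U) + 2 * `|nf|).
  by rewrite !addr_ge0 ?mulr_ge0.
move=> N K phi dphi ddphi f u adm t0 s x0 y /andP[t00 t0T] /andP[s0 st].
have [N0 K0 _ _ _ _ fbd _ ru] := adm.
set q := sigma / 4; set h0 := tscale K t0.
have h00 : 0 < h0 by rewrite lt_min t00 invr_gt0.
have h0t : h0 <= t0 by rewrite ge_min lexx.
have Kh0 : K * h0 <= 1 by rewrite -ler_pdivlMl// mulr1 ge_min lexx orbT.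
set w := weight (y - x0); have w0 : 0 <= w by exact: weight_ge0.
set d := t0 - s + w; have d0 : 0 <= d by rewrite addr_ge0// subr_ge0.
have q0 : 0 < q by rewrite divr_gt0.
have q1 : q <= 4^-1 by rewrite /q; lra.
set P := (d / h0) `^ q; have P0 : 0 <= P by exact: powR_ge0.
have rs : um <= u s y <= up by apply: ru; rewrite s0; lra.
have rt : um <= u t0 x0 <= up by apply: ru; rewrite ltW.
have nf0 : 0 <= nf by apply: le_trans (fbd _ rt).
have rU z : um <= z <= up -> `|z| <= U by exact: range_norm.
have triv : `|u s y - u t0 x0| <= 2 * U.
  by apply: (le_trans (ler_normB _ _)); rewrite mulr2n mulrDl mul1r lerD// rU.
have CU0 : 0 <= `|C0| * U by rewrite mulr_ge0.
rewrite (ger0_norm nf0).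
(* Below the threshold 1/4 one has [lam < 1/2], so [d = h * lam] is less than half of the window and
   [s] lies in its second half, where the Nash denominator is comparable to [sqrt h]. Above it the
   bound [2 * U] suffices. *)
have [hbig|hsmall] := leP 4^-1 (d / h0).
  have hP : 1 <= 4 * P by apply: powR_ge_quarter => //; rewrite ltW//=; lra.
  apply: (le_trans triv).
  have : 2 * U * 1 <= 2 * U * (4 * P) by rewrite ler_wpM2l// mulr_ge0.
  have : 0 <= (4 * (`|C0| * U) + 2 * nf) * P by rewrite mulr_ge0// addr_ge0 ?mulr_ge0.
  lra.
(* For [d = 0] the window would have length zero, but then the two space-time points coincide. *)
have [dz|dpos] := eqVneq d 0.
  have ts : t0 = s by move: dz; rewrite /d; lra.
  have : w = 0 by move: dz; rewrite /d; lra.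
  move=> /(weight_eq0 N _ N0) /eqP; rewrite subr_eq0 => /eqP ->.
  rewrite ts subrr normr0 mulr_ge0// !addr_ge0 ?mulr_ge0//.
have {}dpos : 0 < d by rewrite lt_neqAle eq_sym dpos.
pose lam := Num.sqrt (d / h0).
have r0 : 0 < d / h0 by rewrite divr_gt0.
have lam0 : 0 < lam by rewrite sqrtr_gt0.
have lam2 : lam ^+ 2 = d / h0 by rewrite sqr_sqrtr// ltW.
have lamh : lam < 2^-1.
  rewrite -(@ltr_pXn2r _ 2) ?nnegrE ?invr_ge0 ?ltW// lam2.
  by rewrite (_ : 2^-1 ^+ 2 = 4^-1)//; field.
pose h := h0 * lam.
have hpos : 0 < h by rewrite mulr_gt0.
have dE : d = h0 * lam ^+ 2 by rewrite lam2 mulrC divfK// gt_eqF.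
have dh : d <= h / 2.
  have : 0 <= h0 * lam * (2^-1 - lam) by rewrite mulr_ge0 ?(ltW hpos)// subr_ge0 ltW.
  by rewrite dE /h; clear; lra.
have hh0 : h <= h0 by rewrite /h ler_piMr ?(ltW h00)//; clear -lamh; lra.
have t10 : 0 <= t0 - h by rewrite subr_ge0 (le_trans hh0).
have t1T : t0 - h + h <= T by rewrite subrK.
have [v [huv hv]] := nash_window cm cp T nf nphi um up N K phi dphi ddphi f u hc adm
  sigma C0 (t0 - h) h (fun a u0 u => hC0 N a u0 u N0) t10 hpos t1T.
pose r := s - (t0 - h).
have st' : t0 - s <= d by rewrite /d lerDl.
have rpos : h / 2 <= r by rewrite /r; clear -st' dh; lra.
have rh : r <= h by rewrite /r; clear -st; lra.
have r00 : 0 < r by clear -rpos hpos; lra.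
have := huv h x0 ltac:(by rewrite lexx ltW); rewrite subrK => hv1.
have := huv r y ltac:(by rewrite rh ltW); rewrite (_ : t0 - h + r = s) => [hv2|]; last by rewrite /r; ring.
have [X [XE _]] := lift_weight (R := R) N0 x0.
have [Z [ZE Zw]] := lift_weight (R := R) N0 (y - x0).
have := hv r h (X + Z) X r00 hpos.
rewrite lclassD XE ZE [x0 + _]addrC subrK.
have -> : X + Z - X = Z by rewrite addrC addKr.
set Q := (_ / _) `^ sigma => hv3.
have QP : Q <= 4 * P.
  have eE : euclid (N%:R^-1 *: ivec R Z) <= Num.sqrt d.
    rewrite -[leLHS]ger0_norm ?sqrtr_ge0// -sqrtr_sqr ler_wsqrtr// Zw -/w /d.
    by rewrite lerDr subr_ge0.
  have mE : Num.max (Num.sqrt `|r - h|) (euclid (N%:R^-1 *: ivec R Z)) <= Num.sqrt d.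
    rewrite ge_max eE andbT ler_wsqrtr// ler0_norm; last by rewrite subr_le0.
    by rewrite /r; clear -st'; lra.
  have den : Num.sqrt (h / 2) <= Num.sqrt (Num.min r h).
    by rewrite ler_wsqrtr// le_min rpos; clear -hpos; lra.
  have h20 : 0 < Num.sqrt (h / 2) by rewrite sqrtr_gt0 divr_gt0.
  have rat : Num.max (Num.sqrt `|r - h|) (euclid (N%:R^-1 *: ivec R Z)) /
      Num.sqrt (Num.min r h) <= Num.sqrt (2 * lam).
    apply: (@le_trans _ _ (Num.sqrt d / Num.sqrt (h / 2))).
      apply: ler_pM => //; first by rewrite le_max sqrtr_ge0.
      by rewrite lef_pV2 ?posrE// (lt_le_trans h20).
    rewrite ler_pdivrMr// -sqrtrM ?mulr_ge0 ?(ltW lam0)// ler_wsqrtr// dE /h.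
    by rewrite le_eqVlt; apply/orP; left; apply/eqP; field.
  have num0 : 0 <= Num.max (Num.sqrt `|r - h|) (euclid (N%:R^-1 *: ivec R Z)) /
      Num.sqrt (Num.min r h).
    by rewrite divr_ge0 ?sqrtr_ge0// le_max sqrtr_ge0.
  apply: (le_trans (powR_le_pos _ _ sigma num0 rat (ltW sg0))).
  (* The exponent is halved twice: by the square root in the parabolic distance, and by the choice
     of [lam] as the square root of [d / h0]. *)
  have -> : Num.sqrt (2 * lam) `^ sigma = (4 * (d / h0)) `^ q.
    have -> : 4 * (d / h0) = (2 * lam) ^+ 2 by rewrite exprMn lam2; ring.
    rewrite -powR12_sqrt ?mulr_ge0 ?(ltW lam0)// -powRrM.
    rewrite -powR_mulrn ?mulr_ge0 ?(ltW lam0)// -powRrM; congr (_ `^ _).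
    by rewrite /q; field.
  rewrite powRM ?(ltW r0)// ler_wpM2r//.
  rewrite -[leRHS]powRr1//; apply: ler_powR; first by rewrite ler1n.
  by clear -q1; lra.
have lamP : lam <= P.
  rewrite /lam /P -powR12_sqrt ?(ltW r0)//; apply: ger_powR.
    by rewrite r0/=; clear -hsmall; lra.
  by clear -q1; lra.
(* The source acts for a time at most [h = h0 * lam], and [K * h0 <= 1], so its effect is of order
   [lam]. *)
have hK1 t : 0 <= t <= h -> K * nf * t <= nf * P.
  move=> /andP[tt0 tth]; rewrite [K * nf]mulrC -mulrA ler_wpM2l//.
  apply: (@le_trans _ _ (K * h)); first by rewrite ler_pM2l.
  rewrite /h mulrA; apply: (le_trans _ lamP); rewrite ler_piMl// ltW//.
have := hK1 h ltac:(by rewrite lexx ltW).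
have := hK1 r ltac:(by rewrite rh ltW).
have : `|C0| * U * Q <= `|C0| * U * (4 * P) by rewrite ler_wpM2l.
have : 0 <= U * P by rewrite mulr_ge0.
move: hv1 hv2 hv3; rewrite !ler_norml.
move: (K * nf * h) (K * nf * r) (`|C0| * U) => a1 a2 a3; clear; lra.
Qed.

End NashOsc.

(** * Freezing the coefficient *)

Section IteratedGradients.
Context {R : realType} {n N : nat}.
Local Notation V := 'rV['I_N.-1.+1]_n.
Implicit Types (g : V -> R) (x : V) (es : seq (dir n)).

Lemma diff_on_lgrads (a b : R) (F dF : R -> V -> R) es :
  (forall x, diff_on a b (fun s => F s x) (fun s => dF s x)) ->
  forall x, diff_on a b (fun s => lgrads es (F s) x) (fun s => lgrads es (dF s) x).
Proof.
move=> h; elim: es => //= e es IH x.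
have := diff_on_scale _ _ N%:R _ _ (diff_on_sub _ _ _ _ _ _ (IH (x + lclass N (evec e))) (IH x)).
exact: diff_on_ext.
Qed.

Lemma lgrads_sumN (F : 'I_n -> V -> R) es x :
  lgrads es (fun x => - \sum_i F i x) x = - \sum_i lgrads es (F i) x.
Proof.
elim: es x => //= e es IH x; rewrite /lgrad !IH -opprD -sumrB mulrN mulr_sumr//.
Qed.

Lemma lgrads_laplace g es x :
  lgrads es (laplace g) x = - \sum_i lgrads (es ++ [:: (i, false); (i, true)]) g x.
Proof.
have -> : laplace g = fun x => - \sum_i lgrads [:: (i, false); (i, true)] g x.
  by apply/funext => y; rewrite laplace_lgrads.
rewrite lgrads_sumN; congr (- _); apply: eq_bigr => i _.
by rewrite lgrads_cat.
Qed.

End IteratedGradients.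

Lemma window_bounds {R : realType} (t0 h0 s del T : R) :
  0 < h0 -> h0 <= t0 -> t0 <= T -> del <= h0 / 2 -> 0 < s -> s < del ->
  [/\ t0 - h0 / 2 <= t0 - s <= t0, 0 <= t0 - s <= T & s <= h0].
Proof. by move=> *; split; try apply/andP; try split; lra. Qed.

Section Freezing.
Context {R : realType} {n : nat} (cm cp T nf nphi um up : R) (N : nat)
  (K : R) (phi dphi ddphi f : R -> R) (u : R -> 'rV['I_N.-1.+1]_n -> R).
Hypothesis hc : 0 < cm.
Hypothesis adm : admissible cm cp T nf nphi um up N K phi dphi ddphi f u.
Local Notation V := 'rV['I_N.-1.+1]_n.

Let N0 := adm_N _ _ _ _ _ _ _ _ _ _ _ _ _ _ adm.

(** Two divided differences in succession. The product form keeps apart an oscillation measured by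
    the known modulus and a spatial increment measured by the gradient. *)
Lemma taylor_remainder (p q c M : R) : um <= p <= up -> um <= q <= up ->
  um <= c <= up -> `|p - c| <= M -> `|q - c| <= M ->
  `|phi p - phi q - dphi c * (p - q)| <= nphi * M * `|p - q|.
Proof.
move=> /andP[p1 p2] /andP[q1 q2] /andP[c1 c2] pc qc.
have [_ _ dphiP ddphiP _ ddbd _ _ _] := adm.
rewrite -(divdiffE phi dphi) -mulrBl normrM ler_wpM2r//.
have [xi /andP[x1 x2] ->] := divdiff_mvt phi dphi dphiP q p.
rewrite -(divdiffE dphi ddphi) normrM.
have [eta /andP[e1 e2] ->] := divdiff_mvt dphi ddphi ddphiP c xi.
have x1' : um <= xi <= up.
  by move: x1 x2; have [h|h] := leP q p => h1 h2; apply/andP; split; lra.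
apply: ler_pM => //.
  apply: ddbd; move: e1 e2 x1'; have [h|h] := leP c xi => h1 h2 /andP[h3 h4];
    apply/andP; split; lra.
move: pc qc x1 x2; rewrite !ler_norml; have [h|h] := leP q p; lra.
Qed.

(** The first term is the remainder, whose Laplacian adds two differences in each of [n] directions;
    the second is the source. [1 + cm^-1] compares [s] with [a * s], and [1 + cp] bounds the heat
    time by multiples of [h0]. *)
Definition freeze_cst (k : nat) : R :=
  n%:R * @heat_cst R n k.+2 * (`|nphi| * n%:R * (1 + cm^-1))
  + @heat_cst R n k * `|nf| * (1 + cp).

(* Duhamel's formula at the base point [(t0, x0)] for the heat flow with the frozen
   coefficient [a]: the remainder of [phi] is of order [2 * q + 1] in the parabolic
   distance, so [size es + 2] derivatives of the heat flow turn it into an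
   integrand of order [r `^ (p - 1)]. *)
Lemma freeze (t0 q Cm G tau del : R) x0 es :
  let h0 := tscale K t0 in let a := dphi (u t0 x0) in
  let p := q + 2^-1 - (size es)%:R / 2 in
  0 < t0 <= T -> 0 < q < 2^-1 -> 0 <= Cm -> 0 <= G ->
  (forall (s : R) y, t0 - h0 / 2 <= s <= t0 ->
    `|u s y - u t0 x0| <= Cm * ((t0 - s + weight (y - x0)) / h0) `^ q) ->
  (forall (s : R) e x, t0 - h0 / 2 <= s <= t0 -> `|lgrad e (u s) x| <= G / Num.sqrt h0) ->
  0 <= tau <= h0 -> 0 <= del <= h0 / 2 -> (0 < tau) || (0 < p) -> p != 0 ->
  `|lgrads es (heat (tau + a * del) (u (t0 - del))) x0 - lgrads es (heat tau (u t0)) x0|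
  <= h0 `^ (- (q + 2^-1)) * freeze_cst (size es) * (Cm * G + 1) *
     (((tau + a * del) `^ p - tau `^ p) / (a * p)).
Proof.
move=> h0 a p /andP[t00 t0T] /andP[q0 q1] Cm0 G0 hmod hlip /andP[tau0 tauh]
  /andP[del0 delh] tp pn0.
have [_ K0 dphiP ddphiP cbd ddbd fbd du ru] := adm.
have h00 : 0 < h0 by rewrite lt_min t00 invr_gt0.
have h0t : h0 <= t0 by rewrite ge_min lexx.
have Kh0 : K * h0 <= 1 by rewrite -ler_pdivlMl// mulr1 ge_min lexx orbT.
have rt : um <= u t0 x0 <= up by apply: ru; rewrite ltW.
have /andP[acm acp] := cbd _ rt; rewrite -/a in acm acp.
have a0 : 0 < a by apply: lt_le_trans acm.
have cp0 : 0 < cp by apply: lt_le_trans acp.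
have cp1 : 0 <= 1 + cp by rewrite addr_ge0// ltW.
have nf0 : 0 <= nf by apply: le_trans (fbd _ rt).
have nphi0 : 0 <= nphi by apply: le_trans (ddbd _ rt).
set k := size es.
pose uu s := u (t0 - s).
pose duu s y := - (laplace (fun y => phi (uu s y)) y + K * f (uu s y)).
have duuP y : diff_on 0 del (fun s => uu s y) (fun s => duu s y).
  have h1 := diff_on_comp_affine_neg _ _ _ _ t0 (du y).
  by apply: diff_on_sub_itv h1; lra.
have dD := diff_on_lgrads _ _ _ _ es (fun x => heat_evolution tau a del uu duu x tau0 a0 del0 duuP).
(* The terms at [x0] are constant in [y] and invisible to the Laplacian; subtracting them makes the
   remainder vanish at [x0], as [heat_lgrads_holder] can exploit. *)
pose r s y := phi (uu s y) - phi (uu s x0) - a * (uu s y - uu s x0).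
have rE s : (fun y => a * laplace (uu s) y + duu s y) =
    (fun y => (-1) * laplace (r s) y + (-1) * (K * f (uu s y))).
  apply/funext => y; rewrite /duu opprD addrA mulN1r; congr (_ + _); last by rewrite mulN1r.
  rewrite /laplace mulrCA -mulrBr -[RHS]mulrN; congr (_ * _); rewrite mulr_sumr -sumrB -sumrN.
  by apply: eq_bigr => e _; rewrite /r; ring.
set c1 : R := 1 + cm^-1.
have c10 : 1 <= c1 by rewrite lerDl invr_ge0 ltW.
have c1' : 0 <= c1 by apply: le_trans c10.
set pp := q + 2^-1.
have pp0 : 0 < pp by rewrite /pp; lra.
have pp1 : pp <= 1 by rewrite /pp; lra.
pose A := `|nphi| * n%:R * c1 * (Cm * G) * h0 `^ (- pp).
have A0 : 0 <= A by rewrite /A !mulr_ge0 ?powR_ge0//; lra.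
have rbd s y : 0 < s < del -> `|r s y| <= A * (tau + a * s + weight (y - x0)) `^ pp.
  move=> /andP[s0 sd]; set w := weight _; have w0 : 0 <= w by exact: weight_ge0.
  have [st sT _] := window_bounds t0 h0 s del T h00 h0t t0T delh s0 sd.
  have E : t0 - (t0 - s) = s by ring.
  pose X := (s + w) / h0.
  have X0 : 0 <= X by rewrite divr_ge0 ?(ltW h00)// addr_ge0// ltW.
  have m1 : `|uu s y - u t0 x0| <= Cm * X `^ q by have := hmod _ y st; rewrite E.
  have m2 : `|uu s x0 - u t0 x0| <= Cm * X `^ q.
    have := hmod _ x0 st; rewrite E subrr weight0 addr0 => h.
    apply: (le_trans h); rewrite ler_wpM2l//; apply: powR_le_pos.
    - by rewrite divr_ge0 ?ltW.
    - by rewrite ler_pM2r ?invr_gt0// lerDl.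
    - exact: ltW.
  have m3 : `|uu s y - uu s x0| <= n%:R * G * X `^ 2^-1.
    have := lipschitz_weight N0 (uu s) (G / Num.sqrt h0) y x0 (fun x e => hlip _ e x st).
    move=> h; apply: (le_trans h); rewrite powR12_sqrt// mulrA -!mulrA.
    rewrite !ler_wpM2l// /X sqrtrM ?addr_ge0 ?(ltW s0)// sqrtrV ?(ltW h00)// mulrC.
    by rewrite ler_wpM2r ?invr_ge0 ?sqrtr_ge0// ler_wsqrtr// lerDr ltW.
  have := taylor_remainder _ _ _ _ (ru _ y sT) (ru _ x0 sT) rt m1 m2.
  rewrite -/a -/(uu s) -/(r s y) => h; apply: (le_trans h).
  have h2 : nphi * (Cm * X `^ q) * `|uu s y - uu s x0| <=
     nphi * (Cm * X `^ q) * (n%:R * G * X `^ 2^-1).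
    by rewrite ler_wpM2l// !mulr_ge0// powR_ge0.
  apply: (le_trans h2).
  have -> : nphi * (Cm * X `^ q) * (n%:R * G * X `^ 2^-1) =
    nphi * n%:R * (Cm * G) * X `^ pp.
    rewrite /pp powRD; first by ring.
    by rewrite -/pp (gt_eqF pp0).
  pose Y := tau + a * s + w.
  have as0 : 0 < a * s by rewrite mulr_gt0.
  have Y0 : 0 < Y by rewrite /Y ltr_wpDr// ltr_wpDl.
  (* The modulus of [u] is in terms of [s], the heat flow in terms of [tau + a * s]; the lower bound
     [cm] of [a] relates them. *)
  have XY : X <= c1 * Y / h0.
    rewrite /X ler_pM2r ?invr_gt0// /Y mulrDr.
    have hw : w <= c1 * w by rewrite ler_peMl.
    have hs : s <= c1 * (a * s).
      rewrite mulrA ler_peMl ?(ltW s0)//.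
      have : cm^-1 * cm <= cm^-1 * a by rewrite ler_wpM2l// invr_ge0 ltW.
      rewrite mulVf ?gt_eqF// /c1 mulrDl mul1r => h3.
      by rewrite (le_trans h3)// lerDr ltW.
    have htau : 0 <= c1 * tau by rewrite mulr_ge0// (le_trans ler01).
    rewrite mulrDr; apply: lerD => //.
    by rewrite (le_trans hs)// lerDr.
  rewrite /A (ger0_norm nphi0).
  have -> : nphi * n%:R * c1 * (Cm * G) * h0 `^ (- pp) * Y `^ pp =
     nphi * n%:R * (Cm * G) * (c1 * Y `^ pp * h0 `^ (- pp)) by ring.
  rewrite ler_wpM2l ?mulr_ge0//.
  apply: (le_trans (powR_le_pos _ _ pp X0 XY (ltW pp0))).
  rewrite powRM ?mulr_ge0 ?invr_ge0 ?(ltW h00) ?(ltW Y0)// powRM ?(ltW Y0)//.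
  rewrite -powR_inv1 ?(ltW h00)// -powRrM mulN1r.
  rewrite ler_wpM2r ?powR_ge0// ler_wpM2r ?powR_ge0//.
  by rewrite -[leRHS]powRr1//; apply: ler_powR.
pose B := h0 `^ (- pp) * freeze_cst k * (Cm * G + 1).
have fc0 : 0 <= freeze_cst k.
  apply: addr_ge0; last by rewrite !mulr_ge0 ?heat_cst_ge0.
  by apply: mulr_ge0; [rewrite mulr_ge0 ?heat_cst_ge0|rewrite !mulr_ge0].
have B0 : 0 <= B.
  by rewrite /B mulr_ge0 ?addr_ge0 ?mulr_ge0 ?powR_ge0.
have := powR_growth_bound _ _ B tau a del p a0 tau0 del0 B0 tp pn0 (dD x0).
rewrite mulr0 addr0 /uu subr0; apply => s /andP[s0 sd].
rewrite -/(uu s) rE.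
set t' := tau + a * s.
have as0 : 0 < a * s by rewrite mulr_gt0.
have t'0 : 0 < t' by rewrite /t' ltr_wpDl.
rewrite heat_lin ?(ltW t'0)// lgrads_lin !mulN1r heat_laplace ?(ltW t'0)//.
rewrite lgrads_laplace opprK.
apply: (le_trans (ler_normB _ _)).
have b1 : `|\sum_i lgrads (es ++ [:: (i, false); (i, true)]) (heat t' (r s)) x0| <=
    n%:R * @heat_cst R n k.+2 * A * t' `^ (p - 1) :> R.
  apply: (le_trans (ler_norm_sum _ _ _)).
  have -> : n%:R * @heat_cst R n k.+2 * A * t' `^ (p - 1) =
     \sum_(i < n) @heat_cst R n k.+2 * A * t' `^ (p - 1).
    by rewrite sumr_const card_ord -[RHS]mulr_natl; ring.
  apply: ler_sum => i _.
  have szE : size (es ++ [:: (i, false); (i, true)]) = k.+2.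
    by rewrite size_cat addn2.
  have := heat_lgrads_holder N0 (r s) A t' pp (es ++ [:: (i, false); (i, true)]) x0 _ t'0 A0.
  rewrite szE => /(_ isT); rewrite (ltW pp0) pp1 => /(_ isT) h.
  apply: (le_trans (h _)); first by move=> y; apply: rbd; rewrite s0.
  rewrite le_eqVlt; apply/orP; left; apply/eqP; congr (_ * _ `^ _).
  by rewrite /p /pp -/k -!natr1; field.
(* The source has a milder singularity than the remainder. It is put in the same form by giving up
   [t' ^ (1 - pp)], and [K * h0 <= 1] removes [K]. *)
have b2 : `|lgrads es (heat t' (fun y => K * f (uu s y))) x0| <=
    @heat_cst R n k * `|nf| * (1 + cp) * h0 `^ (- pp) * t' `^ (p - 1).
  have [_ sT sh] := window_bounds t0 h0 s del T h00 h0t t0T delh s0 sd.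
  have := heat_lgrads_sup0 N0 (fun y => K * f (uu s y)) (K * nf) t' es x0 t'0.
  rewrite -/k => h; apply: (le_trans (h _)).
    by move=> y; rewrite normrM gtr0_norm// ler_pM2l//; apply: fbd; exact: ru.
  rewrite (ger0_norm nf0) -!mulrA ler_wpM2l ?heat_cst_ge0//.
  have -> : K * (nf * t' `^ (- (k%:R / 2))) = nf * (K * t' `^ (- (k%:R / 2))) by ring.
  rewrite ler_wpM2l//.
  have -> : - (k%:R / 2) = (1 - pp) + (p - 1) by rewrite /p /pp -/k; ring.
  rewrite (powRD (r := 1 - pp)); last by rewrite (gt_eqF t'0) implybT.
  rewrite !mulrA ler_wpM2r ?powR_ge0//.
  have t'h : t' <= (1 + cp) * h0.
    have h1 : a * s <= cp * h0.
      apply: ler_pM; [exact: ltW|exact: ltW|exact: acp|by []].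
    by rewrite /t' mulrDl mul1r; exact: lerD.
  have h3 : t' `^ (1 - pp) <= ((1 + cp) * h0) `^ (1 - pp).
    by apply: powR_le_pos => //; [exact: ltW|rewrite subr_ge0].
  apply: (@le_trans _ _ (K * ((1 + cp) * h0) `^ (1 - pp))).
    by rewrite ler_pM2l.
  rewrite powRM ?(ltW h00)//.
  have -> : h0 `^ (1 - pp) = h0 * h0 `^ (- pp).
    rewrite powRD; last by rewrite (gt_eqF h00) implybT.
    by rewrite powRr1// ltW.
  have h4 : (1 + cp) `^ (1 - pp) <= 1 + cp.
    by rewrite -[leRHS]powRr1; [apply: ler_powR; rewrite ?lerDl ?(ltW cp0)// gerBl ltW|].
  have -> : K * ((1 + cp) `^ (1 - pp) * (h0 * h0 `^ (- pp))) =
    (K * h0) * ((1 + cp) `^ (1 - pp)) * h0 `^ (- pp) by ring.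
  rewrite ler_wpM2r ?powR_ge0// -[leRHS]mul1r; apply: ler_pM => //.
    by rewrite mulr_ge0 ?ltW.
  exact: powR_ge0.
apply: (le_trans (lerD b1 b2)); rewrite -mulrDl ler_wpM2r ?powR_ge0//.
rewrite /B /A /freeze_cst -/c1.
have CG0 : 0 <= Cm * G by rewrite mulr_ge0.
set H := h0 `^ _; set a1 := @heat_cst R n k.+2; set a2 := @heat_cst R n k.
have H0 : 0 <= H by exact: powR_ge0.
have a10 : 0 <= a1 by exact: heat_cst_ge0.
have a20 : 0 <= a2 by exact: heat_cst_ge0.
have e1 : 0 <= n%:R * a1 * (`|nphi| * n%:R * c1) * H.
  by apply: mulr_ge0 => //; apply: mulr_ge0; [rewrite mulr_ge0|rewrite !mulr_ge0].
have e2 : 0 <= a2 * `|nf| * (1 + cp) * H.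
  by do 3 (apply: mulr_ge0 => //).
rewrite -subr_ge0.
have -> : H * (n%:R * a1 * (`|nphi| * n%:R * c1) + a2 * `|nf| * (1 + cp)) * (Cm * G + 1)
  - (n%:R * a1 * (`|nphi| * n%:R * c1 * (Cm * G) * H) + a2 * `|nf| * (1 + cp) * H) =
  n%:R * a1 * (`|nphi| * n%:R * c1) * H + a2 * `|nf| * (1 + cp) * H * (Cm * G).
  by ring.
by rewrite addr_ge0// mulr_ge0.
Qed.

End Freezing.

(** * The gradient bound by absorption *)

Section Absorption.
Context {R : realType}.

(** The crude bound [M0] only makes the supremum finite, so that [S <= C + S / 2] can be solved for
    it. It may depend on [N], since it is absent from the conclusion. *)
Lemma absorb (I : Type) (P : I -> Prop) (g : I -> R) (C M0 : R) : 0 <= C ->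
  (forall i, P i -> 0 <= g i <= M0) ->
  (forall M, 0 <= M -> (forall i, P i -> g i <= M) -> forall i, P i -> g i <= C + M / 2) ->
  forall i, P i -> g i <= 2 * C.
Proof.
move=> C0 hM0 step i Pi.
pose S := [set g j | j in P].
have ubS : has_ubound S by exists M0 => _ [j Pj <-]; case/andP: (hM0 j Pj).
have Sne : S !=set0 by exists (g i), i.
have le_sup j : P j -> g j <= sup S by move=> Pj; apply: ub_le_sup => //; exists j.
have S0 : 0 <= sup S by apply: le_trans (le_sup i Pi); case/andP: (hM0 i Pi).
have : sup S <= C + sup S / 2.
  by apply: ge_sup => // _ [j Pj <-]; exact: step.
have := le_sup i Pi; lra.
Qed.

End Absorption.

Section HeatSmoothing.
Context {R : realType} {n N : nat} (N0 : (0 < N)%N).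
Local Notation V := 'rV['I_N.-1.+1]_n.
Implicit Types (g : V -> R) (x : V) (es : seq (dir n)).

(** The time derivative of the flow is a sum of [n] paired second differences, and the singularity
    [t ^ (p - 1)] is integrable for [p > 0]. *)
Lemma heat_smoothing es g (M p h : R) x : 0 < p -> 0 <= h -> 0 <= M ->
  (forall t i, 0 < t < h ->
     `|lgrads (es ++ [:: (i, false); (i, true)]) (heat t g) x| <= M * t `^ (p - 1)) ->
  `|lgrads es (heat h g) x - lgrads es g x| <= n%:R * M * (h `^ p / p).
Proof.
move=> p0 h0 M0 hM.
have dl := diff_on_lgrads _ _ _ _ es (fun x => heat_diff h g x) x.
have nM : 0 <= n%:R * M by rewrite mulr_ge0.
have := powR_growth_bound _ _ (n%:R * M) 0 1 h p ltr01 (lexx 0) h0 nM _ _ dl.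
rewrite p0 orbT gt_eqF// heat0 add0r !mul1r powR0 ?gt_eqF// subr0.
move=> /(_ isT isT); apply => s sh.
rewrite lgrads_laplace normrN add0r mul1r; apply: (le_trans (ler_norm_sum _ _ _)).
have -> : n%:R * M * s `^ (p - 1) = \sum_(i < n) M * s `^ (p - 1).
  by rewrite sumr_const card_ord -[RHS]mulr_natl; ring.
by apply: ler_sum => i _; exact: hM.
Qed.

(** One of the two differences in the Laplacian falls on the datum and costs [G]; the other is taken
    by the flow and costs the inverse square root of the time. *)
Lemma heat_time_half g (G h : R) x : 0 <= h ->
  (forall e y, `|lgrad e g y| <= G) ->
  `|heat h g x - g x| <= 2 * n%:R * @heat_cst R n 1 * G * Num.sqrt h.
Proof.
(* A negative [G] is possible only without directions, that is for [n = 0], where the flow is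
   constant in time. *)
move=> h0 hG; have [G0|Gneg] := leP 0 G; last first.
  have [n0|/card_gt0P[i _]] := posnP #|'I_n|.
    have e0 : forall i : 'I_n, False by move=> i; have := fintype0 i n0.
    have := heat_smoothing [::] g 0 1 h x ltr01 h0 (lexx 0).
    rewrite mulr0 mul0r normr_le0 => hh.
    have -> : `|heat h g x - g x| = 0.
      by apply/eqP; rewrite normr_eq0; apply: hh => t i; case: (e0 i).
    by rewrite card_ord in n0; rewrite n0 mulr0 !mul0r.
  by have := le_trans (normr_ge0 _) (hG (i, true) x); rewrite leNgt Gneg.
have := heat_smoothing [::] g (@heat_cst R n 1 * G) 2^-1 h x.
rewrite invr_gt0 ltr0n h0 mulr_ge0 ?heat_cst_ge0// powR12_sqrt// invrK.
move=> /(_ isT isT isT) hh.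
have -> : 2 * n%:R * @heat_cst R n 1 * G * Num.sqrt h =
  n%:R * (@heat_cst R n 1 * G) * (Num.sqrt h * 2) by ring.
apply: hh => t i /andP[t0 _] /=.
have := heat_lgrads_sup N0 (lgrad (i, true) g) G t [:: (i, false)] x isT t0 (hG _).
rewrite /= heat_lgrad ?(ltW t0)// mul1r.
by rewrite (_ : 2^-1 - 1 = - 2^-1 :> R)//; lra.
Qed.

End HeatSmoothing.

Section GradientBound.
Context {R : realType} {n : nat} (cm cp T sigma nf nphi um up : R).
Hypotheses (hc : 0 < cm) (hcp : cm <= cp) (hsigma : nash_exponent n cm cp sigma).
Local Notation adm N K phi dphi ddphi f u :=
  (@admissible R n cm cp T nf nphi um up N K phi dphi ddphi f u).
Local Notation U := (Num.max `|um| `|up|).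

Lemma freeze_cst_ge0 k : 0 <= @freeze_cst R n cm cp nf nphi k.
Proof.
have c1 : 0 <= 1 + cm^-1 by rewrite addr_ge0// invr_ge0 ltW.
have c2 : 0 <= 1 + cp by rewrite addr_ge0// (le_trans (ltW hc)).
apply: addr_ge0; last by rewrite !mulr_ge0 ?heat_cst_ge0.
by apply: mulr_ge0; [rewrite mulr_ge0 ?heat_cst_ge0|rewrite !mulr_ge0].
Qed.

Lemma tscale_gt0 (K t : R) : 0 < K -> 0 < t -> 0 < tscale K t.
Proof. by move=> K0 t0; rewrite lt_min t0 invr_gt0. Qed.

(** It allows bounds at earlier times of the window to be expressed by the scale at its end. *)
Lemma tscale_half (K t s : R) : 0 < K -> 0 < t -> t - tscale K t / 2 <= s ->
  tscale K t / 2 <= tscale K s /\ 0 < s.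
Proof.
move=> K0 t0 ts; have h0 := tscale_gt0 K t K0 t0.
have h1 : tscale K t <= t by rewrite ge_min lexx.
have h2 : tscale K t <= K^-1 by rewrite ge_min lexx orbT.
split; last by lra.
by rewrite {2}/tscale le_min; apply/andP; split; lra.
Qed.

Lemma sqrt_tscale_half (K t s M : R) : 0 < K -> 0 < t -> 0 <= M ->
  t - tscale K t / 2 <= s ->
  M / Num.sqrt (tscale K s) <= Num.sqrt 2 * M / Num.sqrt (tscale K t).
Proof.
move=> K0 t0 M0 /(tscale_half K t s K0 t0)[h1 s0].
have h0 := tscale_gt0 K t K0 t0; have h2 := tscale_gt0 K s K0 s0.
rewrite [Num.sqrt 2 * M]mulrC -mulrA ler_wpM2l//.
rewrite ler_pdivlMr ?sqrtr_gt0// mulrC ler_pdivrMr ?sqrtr_gt0// -sqrtrM//.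
by rewrite ler_wsqrtr//; lra.
Qed.

(* The scaled gradient is bounded by a constant plus [W * (cp * eps) `^ q] times
   itself, and [eps] makes the latter factor at most 1/2. *)
Lemma grad_bound : exists2 C : R, 0 <= C & forall N K phi dphi ddphi f u,
  adm N K phi dphi ddphi f u -> forall t e x, 0 < t <= T ->
  `|lgrad e (u t) x| <= C / Num.sqrt (tscale K t).
Proof.
have [C2 C20 hosc] := nash_osc cm cp T sigma nf nphi um up hc hsigma.
have [/andP[sg0 sg1] _] := hsigma.
set q := sigma / 4 in hosc.
have q0 : 0 < q by rewrite divr_gt0.
have q1 : q < 2^-1 by rewrite /q; lra.
have U0 : 0 <= U by rewrite le_max normr_ge0.
have cp0 : 0 < cp by apply: lt_le_trans hcp.
set F := @freeze_cst R n cm cp nf nphi 1; have F0 : 0 <= F by exact: freeze_cst_ge0.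
pose W := F * C2 * Num.sqrt 2 / (cm * q).
have cmq : 0 < cm * q by rewrite mulr_gt0.
have W0 : 0 <= W by rewrite /W divr_ge0 ?(ltW cmq)// !mulr_ge0 ?sqrtr_ge0.
(* The first entry keeps the time [eps * h0] within the half-window; the second gives
   [(cp * eps) ^ q <= 1 / (2 * W + 1)], so that [W] times it is at most 1/2. *)
pose eps : R := Num.min 2^-1 ((2 * W + 1)^-1 `^ q^-1 / cp).
have W1 : 0 < 2 * W + 1 by lra.
have eps0 : 0 < eps by rewrite lt_min invr_gt0 ltr0n/= divr_gt0// powR_gt0// invr_gt0.
have epsW : W * (cp * eps) `^ q <= 2^-1.
  have h1 : (cp * eps) `^ q <= (2 * W + 1)^-1.
    have -> : (2 * W + 1)^-1 = ((2 * W + 1)^-1 `^ q^-1) `^ q.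
      by rewrite -powRrM mulVf ?gt_eqF// powRr1// invr_ge0 ltW.
    apply: powR_le_pos; [by rewrite mulr_ge0 ?ltW| |exact: ltW].
    by rewrite mulrC -ler_pdivlMr// ge_min lexx orbT.
  apply: (@le_trans _ _ (W * (2 * W + 1)^-1)); first by rewrite ler_wpM2l.
  by rewrite ler_pdivrMr//; lra.
pose C5 := @heat_cst R n 1 * U * (cm * eps) `^ (- 2^-1) + F * ((cp * eps) `^ q / (cm * q)).
have C50 : 0 <= C5.
  apply: addr_ge0; apply: mulr_ge0 => //.
  - by rewrite mulr_ge0// heat_cst_ge0.
  - exact: powR_ge0.
  - by rewrite divr_ge0 ?powR_ge0// ltW.
exists (2 * C5) => [|N K phi dphi ddphi f u ad t e x tT]; first by rewrite mulr_ge0.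
have [N0 K0 _ _ cbd _ _ _ ru] := ad.
have t0 : 0 < t by case/andP: tT.
rewrite ler_pdivlMr ?sqrtr_gt0 ?tscale_gt0// mulrC.
pose g (i : R * dir n * 'rV['I_N.-1.+1]_n) :=
  Num.sqrt (tscale K i.1.1) * `|lgrad i.1.2 (u i.1.1) i.2|.
(* The a priori bound: a difference quotient of a function bounded by [U] is at most [2 * U * N]. *)
apply: (absorb _ (fun i => 0 < i.1.1 <= T) g C5 (Num.sqrt T * (N%:R * (2 * U))) C50
   _ _ (t, e, x)) => //.
  move=> [[s e'] y] /= /andP[s0 sT]; rewrite mulr_ge0 ?sqrtr_ge0//=.
  apply: ler_pM => //.
    by rewrite ler_wsqrtr// ge_min sT.
  rewrite /lgrad normrM ger0_norm// ler_wpM2l//.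
  have rs z : `|u s z| <= U by apply: range_norm; apply: ru; rewrite sT ltW.
  by apply: (le_trans (ler_normB _ _)); rewrite mulr2n mulrDl mul1r lerD.
move=> M M0 hM [[t1 e1] x1] /= /[dup] tT1 /andP[t10 t1T].
set h0 := tscale K t1; have h00 : 0 < h0 by exact: tscale_gt0.
have h0t : h0 <= t1 by rewrite ge_min lexx.
have /andP[acm acp] : cm <= dphi (u t1 x1) <= cp.
  by apply: cbd; apply: ru; rewrite ltW.
set a := dphi (u t1 x1) in acm acp.
have a0 : 0 < a by apply: lt_le_trans acm.
have eps2 : eps <= 2^-1 by rewrite ge_min lexx.
have lipM (s : R) e' y : t1 - h0 / 2 <= s <= t1 ->
    `|lgrad e' (u s) y| <= Num.sqrt 2 * M / Num.sqrt h0.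
  move=> /andP[s1 s2]; have [_ s0] := tscale_half K t1 s K0 t10 s1.
  apply: le_trans (sqrt_tscale_half K t1 s M K0 t10 M0 s1).
  rewrite ler_pdivlMr ?sqrtr_gt0 ?tscale_gt0// mulrC.
  by apply: (hM (s, e', y)); rewrite /= s0 (le_trans s2).
have del0 : 0 <= eps * h0 <= h0 / 2.
  rewrite mulr_ge0 ?(ltW eps0) ?(ltW h00)//=.
  have : eps * h0 <= 2^-1 * h0 by rewrite ler_pM2r.
  lra.
have qn0 : q + 2^-1 - 1 / 2 = q by field.
have hmod (s : R) y : t1 - h0 / 2 <= s <= t1 ->
    `|u s y - u t1 x1| <= C2 * ((t1 - s + weight (y - x1)) / h0) `^ q.
  move=> /andP[s1 s2]; have [_ s0] := tscale_half K t1 s K0 t10 s1.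
  by apply: (hosc _ _ _ _ _ _ _ ad) => //; rewrite s2 ltW.
have q01 : 0 < q < 2^-1 by rewrite q0.
have G0 : 0 <= Num.sqrt 2 * M by rewrite mulr_ge0 ?sqrtr_ge0.
have tau0 : (0 : R) <= 0 <= h0 by apply/andP; split; [|exact: ltW].
have H := freeze cm cp T nf nphi um up N K phi dphi ddphi f u hc ad t1 q C2 (Num.sqrt 2 * M)
  0 (eps * h0) x1 [:: e1] tT1 q01 C20 G0 hmod lipM tau0 del0.
rewrite /= -/h0 -/a qn0 q0 orbT gt_eqF// add0r heat0 powR0 ?gt_eqF// subr0 -/F in H.
have {}H := H isT isT.
have dT : 0 <= t1 - eps * h0 <= T by apply/andP; split; lra.
have ade : 0 < a * (eps * h0) by rewrite !mulr_gt0.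
have H2 := heat_lgrads_sup N0 (u (t1 - eps * h0)) U (a * (eps * h0)) [:: e1] x1 isT ade
  (fun y => range_norm um up _ (ru _ y dT)).
rewrite /= mul1r in H2.
have p2 (y : R) : 0 < y -> y `^ (- 2^-1) = (Num.sqrt y)^-1.
  by move=> y0; rewrite powRN powR12_sqrt// ltW.
have sh : h0 `^ (- (q + 2^-1)) * h0 `^ q = (Num.sqrt h0)^-1.
  rewrite -powRD; last by rewrite (gt_eqF h00) implybT.
  by rewrite (_ : - (q + 2^-1) + q = - 2^-1) ?p2//; ring.
have hq0 : 0 <= (Num.sqrt h0)^-1 by rewrite invr_ge0 sqrtr_ge0.
have CM0 : 0 <= C2 * (Num.sqrt 2 * M) + 1 by rewrite addr_ge0 ?mulr_ge0.
have b1 : h0 `^ (- (q + 2^-1)) * F * (C2 * (Num.sqrt 2 * M) + 1) *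
      ((a * (eps * h0)) `^ q / (a * q)) <=
    (Num.sqrt h0)^-1 * (F * (C2 * (Num.sqrt 2 * M) + 1) * ((cp * eps) `^ q / (cm * q))).
  rewrite [a * (eps * h0)]mulrA [a * eps * h0]mulrC (powRM (x := h0)) ?mulr_ge0 ?(ltW a0) ?(ltW eps0) ?(ltW h00)//.
  have -> : h0 `^ (- (q + 2^-1)) * F * (C2 * (Num.sqrt 2 * M) + 1) *
      (h0 `^ q * (a * eps) `^ q / (a * q)) =
    (h0 `^ (- (q + 2^-1)) * h0 `^ q) * (F * (C2 * (Num.sqrt 2 * M) + 1) *
      ((a * eps) `^ q / (a * q))) by ring.
  rewrite sh ler_wpM2l// ler_wpM2l ?mulr_ge0//; apply: ler_pM.
  - exact: powR_ge0.
  - by rewrite invr_ge0 mulr_ge0// ltW.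
  - apply: powR_le_pos; [by rewrite mulr_ge0 ?ltW| |exact: ltW].
    by rewrite ler_pM2r.
  - by rewrite lef_pV2 ?posrE ?mulr_gt0// ler_pM2r.
have b2 : @heat_cst R n 1 * U * (a * (eps * h0)) `^ (- 2^-1) <=
    (Num.sqrt h0)^-1 * (@heat_cst R n 1 * U * (cm * eps) `^ (- 2^-1)).
  rewrite [a * (eps * h0)]mulrA [a * eps * h0]mulrC (powRM (x := h0)) ?mulr_ge0 ?(ltW a0) ?(ltW eps0) ?(ltW h00)//.
  rewrite (p2 h0)//; set b0 := (Num.sqrt h0)^-1; set b3 := (a * eps) `^ _.
  have -> : @heat_cst R n 1 * U * (b0 * b3) = b0 * (@heat_cst R n 1 * U * b3) by ring.
  rewrite ler_wpM2l// ler_wpM2l ?mulr_ge0 ?heat_cst_ge0//.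
  apply: powR_le_neg; [by rewrite mulr_gt0|by rewrite ler_pM2r|].
  by rewrite oppr_le0 invr_ge0.
rewrite /g /= -/h0 mulrC -ler_pdivlMr ?sqrtr_gt0// mulrC.
have := ler_normB (lgrad e1 (heat (a * (eps * h0)) (u (t1 - eps * h0))) x1)
  (lgrad e1 (heat (a * (eps * h0)) (u (t1 - eps * h0))) x1 - lgrad e1 (u t1) x1).
rewrite opprB addrC subrK => h3; apply: (le_trans h3).
apply: (le_trans (lerD H2 H)); apply: (le_trans (lerD b2 b1)).
rewrite -mulrDr ler_wpM2l// /C5 -addrA lerD2l.
have : M * (W * (cp * eps) `^ q) <= M * 2^-1 by rewrite ler_wpM2l.
have -> : F * (C2 * (Num.sqrt 2 * M) + 1) * ((cp * eps) `^ q / (cm * q)) =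
  M * (W * (cp * eps) `^ q) + F * ((cp * eps) `^ q / (cm * q)).
  by rewrite /W; field; rewrite !gt_eqF.
lra.
Qed.

End GradientBound.

Ltac nneg := repeat first [done | assumption | by apply: ltW | exact: powR_ge0
  | exact: sqrtr_ge0 | exact: heat_cst_ge0 | apply: mulr_ge0 | apply: addr_ge0
  | rewrite invr_ge0].

(** * Time regularity and higher differences after smoothing *)

Section HigherOrderBounds.
Context {R : realType} {n : nat} (cm cp T sigma nf nphi um up : R).
Hypotheses (hc : 0 < cm) (hcp : cm <= cp) (hsigma : nash_exponent n cm cp sigma).
Local Notation adm N K phi dphi ddphi f u :=
  (@admissible R n cm cp T nf nphi um up N K phi dphi ddphi f u).
Local Notation U := (Num.max `|um| `|up|).

Let U0 : 0 <= U. Proof. by rewrite le_max normr_ge0. Qed.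

(** The flow started from [u s] is the intermediate term. [freeze] without differences compares it
    with [u t] at order [q + 1/2], and [heat_time_half] with [u s] at order 1/2, the worse of the
    two. *)
Lemma time_half : exists2 C : R, 0 <= C & forall N K phi dphi ddphi f u,
  adm N K phi dphi ddphi f u -> forall (t s : R) x, 0 < t <= T -> 0 <= s <= t ->
  `|u s x - u t x| <= C * ((t - s) / tscale K t) `^ 2^-1.
Proof.
have [C2 C20 hosc] := nash_osc cm cp T sigma nf nphi um up hc hsigma.
have [C1 C10 hgrad] := grad_bound cm cp T sigma nf nphi um up hc hcp hsigma.
have [/andP[sg0 sg1] _] := hsigma.
set q := sigma / 4 in hosc.
have q0 : 0 < q by rewrite divr_gt0.
have q1 : q < 2^-1 by rewrite /q; lra.
have cp0 : 0 < cp by apply: lt_le_trans hcp.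
set F := @freeze_cst R n cm cp nf nphi 0.
have F0 : 0 <= F by exact: freeze_cst_ge0.
pose p := q + 2^-1.
have p0 : 0 < p by rewrite /p; lra.
pose G := Num.sqrt 2 * C1.
have G0 : 0 <= G by rewrite mulr_ge0 ?sqrtr_ge0.
pose A1 := F * (C2 * G + 1) * (cp `^ p / (cm * p)).
pose A2 := 2 * n%:R * @heat_cst R n 1 * G * cp `^ 2^-1.
have A10 : 0 <= A1.
  by rewrite /A1; nneg.
have A20 : 0 <= A2 by rewrite /A2; nneg.
exists (A1 + A2 + 2 * U * 2) => [|N K phi dphi ddphi f u ad t s x tT /andP[s0 st]].
  by nneg.
have [N0 K0 _ _ cbd _ _ _ ru] := ad.
have /andP[t0 tT'] := tT.
set h0 := tscale K t; have h00 : 0 < h0 by exact: tscale_gt0.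
have h0t : h0 <= t by rewrite ge_min lexx.
set del := t - s; have del0 : 0 <= del by rewrite subr_ge0.
set X := del / h0; have X0 : 0 <= X by rewrite divr_ge0// ltW.
have P0 : 0 <= X `^ 2^-1 by exact: powR_ge0.
have sT : 0 <= s <= T by rewrite s0 (le_trans st).
have tT2 : 0 <= t <= T by rewrite ltW.
have [hbig|hsmall] := ltP (h0 / 2) del.
  have : `|u s x - u t x| <= 2 * U.
    apply: (le_trans (ler_normB _ _)).
    by rewrite mulr2n mulrDl mul1r lerD//; apply: range_norm; exact: ru.
  have i2 : 0 <= 2^-1 :> R by rewrite invr_ge0.
  have hX2 : 1 <= 2 * X `^ 2^-1.
    have hX : 2^-1 <= X by rewrite ler_pdivlMr//; lra.
    have := powR_le_pos _ _ 2^-1 i2 hX i2.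
    have : 2^-1 `^ 1 <= 2^-1 `^ 2^-1 :> R.
      by apply: ger_powR; [rewrite invr_gt0 ltr0n invf_le1// ler1n|rewrite invf_le1// ler1n].
    by rewrite powRr1 ?invr_ge0//; lra.
  have : 2 * U * 1 <= 2 * U * (2 * X `^ 2^-1) by rewrite ler_wpM2l ?mulr_ge0.
  have : 0 <= (A1 + A2) * X `^ 2^-1 by rewrite mulr_ge0 ?addr_ge0.
  lra.
have [acm acp] : cm <= dphi (u t x) /\ dphi (u t x) <= cp.
  by apply/andP; apply: cbd; exact: ru.
set a := dphi (u t x) in acm acp.
have a0 : 0 < a by apply: lt_le_trans acm.
have lipG (r : R) e' y : t - h0 / 2 <= r <= t ->
    `|lgrad e' (u r) y| <= G / Num.sqrt h0.
  move=> /andP[r1 r2]; have [_ r0] := tscale_half K t r K0 t0 r1.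
  apply: le_trans (sqrt_tscale_half K t r C1 K0 t0 C10 r1).
  by apply: (hgrad _ _ _ _ _ _ _ ad); rewrite r0 (le_trans r2).
have hmod (r : R) y : t - h0 / 2 <= r <= t ->
    `|u r y - u t x| <= C2 * ((t - r + weight (y - x)) / h0) `^ q.
  move=> /andP[r1 r2]; have [_ r0] := tscale_half K t r K0 t0 r1.
  by apply: (hosc _ _ _ _ _ _ _ ad) => //; rewrite r2 ltW.
have q01 : 0 < q < 2^-1 by rewrite q0.
have tau0 : (0 : R) <= 0 <= h0 by apply/andP; split; [|exact: ltW].
have delh : 0 <= del <= h0 / 2 by rewrite del0.
have H := freeze cm cp T nf nphi um up N K phi dphi ddphi f u hc ad t q C2 G
  0 del x [::] tT q01 C20 G0 hmod lipG tau0 delh.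
rewrite /= -/h0 -/a mul0r subr0 -/p p0 orbT gt_eqF// add0r heat0 powR0 ?gt_eqF// subr0 -/F in H.
have {}H := H isT isT.
have ts : t - del = s by rewrite /del; ring.
rewrite ts in H.
have ad0 : 0 <= a * del by rewrite mulr_ge0// ltW.
have ade : a * del <= cp * del by rewrite ler_wpM2r.
have st2 : t - h0 / 2 <= s <= t by rewrite st andbT; move: hsmall; rewrite /del; lra.
have H2 := heat_time_half N0 (u s) (G / Num.sqrt h0) (a * del) x ad0 (fun e y => lipG s e y st2).
have hinv : h0 `^ (- p) = h0^-1 `^ p by rewrite -powR_inv1 ?(ltW h00)// -powRrM mulN1r.
have b1 : h0 `^ (- p) * F * (C2 * G + 1) * ((a * del) `^ p / (a * p)) <= A1 * X `^ p.
  have -> : A1 * X `^ p =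
     h0 `^ (- p) * F * (C2 * G + 1) * ((cp * del) `^ p / (cm * p)).
    rewrite /X (powRM _ del0) ?invr_ge0 ?(ltW h00)// (powRM _ (ltW cp0) del0) hinv /A1.
    by ring.
  apply: ler_wpM2l; first by nneg.
  apply: ler_pM.
  - exact: powR_ge0.
  - by rewrite invr_ge0 mulr_ge0// ltW.
  - by apply: powR_le_pos => //; exact: ltW.
  - by rewrite lef_pV2 ?posrE ?mulr_gt0// ler_pM2r.
have b1' : A1 * X `^ p <= A1 * X `^ 2^-1.
  rewrite ler_wpM2l//; have [->|Xn0] := eqVneq X 0.
    by rewrite !powR0// ?invr_neq0// gt_eqF.
  apply: ger_powR; last by rewrite /p lerDr ltW.
  rewrite lt_neqAle eq_sym Xn0 X0/= ler_pdivrMr// mul1r.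
  by move: hsmall; lra.
have b2 : 2 * n%:R * @heat_cst R n 1 * (G / Num.sqrt h0) * Num.sqrt (a * del) <= A2 * X `^ 2^-1.
  have -> : A2 * X `^ 2^-1 =
     2 * n%:R * @heat_cst R n 1 * (G / Num.sqrt h0) * Num.sqrt (cp * del).
    rewrite /A2 !powR12_sqrt ?(ltW cp0)// /X !sqrtrM ?(ltW cp0)// sqrtrV ?(ltW h00)//.
    by ring.
  apply: ler_wpM2l; first by nneg.
  exact: ler_wsqrtr.
have := ler_normB (heat (a * del) (u s) x - u t x) (heat (a * del) (u s) x - u s x).
have -> : heat (a * del) (u s) x - u t x - (heat (a * del) (u s) x - u s x) =
  u s x - u t x by ring.
move=> h3; apply: (le_trans h3); apply: (le_trans (lerD H H2)).
have : 0 <= 2 * U * 2 * X `^ 2^-1 by rewrite !mulr_ge0.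
lra.
Qed.

(** The gradient bound and [time_half] give exponent 1/2. For ratios below 1 it is weakened to
    [sigma / 2], which is admissible in [freeze] and yields the order [(1 + sigma) / 2] wanted at
    the end. *)
Lemma osc_sigma : exists2 C : R, 0 <= C & forall N K phi dphi ddphi f u,
  adm N K phi dphi ddphi f u -> forall (t s : R) x y, 0 < t <= T ->
  t - tscale K t / 2 <= s <= t ->
  `|u s y - u t x| <= C * ((t - s + weight (y - x)) / tscale K t) `^ (sigma / 2).
Proof.
have [C1 C10 hgrad] := grad_bound cm cp T sigma nf nphi um up hc hcp hsigma.
have [C2 C20 htime] := time_half.
have [/andP[sg0 sg1] _] := hsigma.
pose G := Num.sqrt 2 * C1.
have G0 : 0 <= G by rewrite mulr_ge0 ?sqrtr_ge0.
exists (n%:R * G + C2 + 2 * U) => [|N K phi dphi ddphi f u ad t s x y tT /andP[s1 s2]].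
  by nneg.
have [N0 K0 _ _ cbd _ _ _ ru] := ad.
have /andP[t0 tT'] := tT.
set h0 := tscale K t; have h00 : 0 < h0 by exact: tscale_gt0.
have [_ s0] := tscale_half K t s K0 t0 s1.
set w := weight _; have w0 : 0 <= w by exact: weight_ge0.
have ts0 : 0 <= t - s by rewrite subr_ge0.
set X := _ / h0.
have X0 : 0 <= X by rewrite divr_ge0 ?(ltW h00)// addr_ge0.
have P0 : 0 <= X `^ (sigma / 2) by exact: powR_ge0.
have [X1|X1] := leP 1 X.
  have : `|u s y - u t x| <= 2 * U.
    apply: (le_trans (ler_normB _ _)).
    rewrite mulr2n mulrDl mul1r lerD//; apply: range_norm; apply: ru.
      by rewrite ltW// (le_trans s2).
    by rewrite ltW.
  have : 1 <= X `^ (sigma / 2).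
    have := powR_le_pos 1 X (sigma / 2) ler01 X1.
    by rewrite powR1; apply; rewrite divr_ge0// ltW.
  move=> h1; have : 2 * U * 1 <= 2 * U * X `^ (sigma / 2) by rewrite ler_wpM2l ?mulr_ge0.
  have : 0 <= (n%:R * G + C2) * X `^ (sigma / 2) by rewrite mulr_ge0 ?addr_ge0 ?mulr_ge0.
  lra.
have hX : X `^ 2^-1 <= X `^ (sigma / 2).
  have [->|Xn0] := eqVneq X 0.
    by rewrite !powR0// ?invr_neq0// mulf_neq0 ?invr_neq0// gt_eqF.
  by apply: ger_powR; [rewrite lt_neqAle eq_sym Xn0 X0 ltW|lra].
have m1 : `|u s y - u s x| <= n%:R * G * X `^ 2^-1.
  have hl z e : `|lgrad e (u s) z| <= G / Num.sqrt h0.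
    apply: le_trans (sqrt_tscale_half K t s C1 K0 t0 C10 s1).
    by apply: (hgrad _ _ _ _ _ _ _ ad); rewrite s0 (le_trans s2).
  have hw := lipschitz_weight N0 (u s) (G / Num.sqrt h0) y x hl.
  apply: (le_trans hw).
  have tsw : 0 <= t - s + w by rewrite addr_ge0.
  rewrite powR12_sqrt// -!mulrA !ler_wpM2l// /X (sqrtrM _ tsw) sqrtrV ?(ltW h00)//.
  by rewrite mulrC ler_wpM2r ?invr_ge0 ?sqrtr_ge0// ler_wsqrtr// lerDr.
have m2 : `|u s x - u t x| <= C2 * X `^ 2^-1.
  have := htime _ _ _ _ _ _ _ ad t s x tT; rewrite (ltW s0) s2 => /(_ isT) h.
  apply: (le_trans h); rewrite ler_wpM2l//; apply: powR_le_pos => //.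
    by rewrite divr_ge0 ?(ltW h00).
  by rewrite ler_pM2r ?invr_gt0// lerDl.
have := ler_normD (u s y - u s x) (u s x - u t x); rewrite addrA subrK => h3.
have h4 : (n%:R * G + C2) * X `^ 2^-1 <= (n%:R * G + C2) * X `^ (sigma / 2).
  by rewrite ler_wpM2l// addr_ge0 ?mulr_ge0.
have : 0 <= 2 * U * X `^ (sigma / 2) by rewrite !mulr_ge0.
lra.
Qed.

(** With at least two differences [p] is negative, so the Duhamel integral is dominated by its end
    [tau] and gives [tau ^ p]. Running back over the whole half-window makes the other term a flow
    of length at least [cm * h0 / 2]. *)
Lemma higher_bound (k : nat) : (1 < k)%N ->
  exists2 C : R, 0 <= C & forall N K phi dphi ddphi f u,
  adm N K phi dphi ddphi f u -> forall (t tau : R) es x, 0 < t <= T ->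
  0 < tau <= tscale K t -> size es = k ->
  `|lgrads es (heat tau (u t)) x| <=
    C * tscale K t `^ (- (sigma / 2 + 2^-1)) * tau `^ (sigma / 2 + 2^-1 - k%:R / 2).
Proof.
move=> k1.
have [C1 C10 hgrad] := grad_bound cm cp T sigma nf nphi um up hc hcp hsigma.
have [C2 C20 hosc] := osc_sigma.
have [/andP[sg0 sg1] _] := hsigma.
set q := sigma / 2 in hosc *.
have q0 : 0 < q by rewrite divr_gt0.
have q1 : q < 2^-1 by rewrite /q; lra.
set F := @freeze_cst R n cm cp nf nphi k.
have F0 : 0 <= F by exact: freeze_cst_ge0.
set p := q + 2^-1 - k%:R / 2.
have k2 : 2 <= k%:R :> R by rewrite (ler_nat R 2).
have p0 : p < 0 by rewrite /p; lra.
pose G := Num.sqrt 2 * C1.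
have G0 : 0 <= G by rewrite mulr_ge0 ?sqrtr_ge0.
pose A1 := F * (C2 * G + 1) * (cm * - p)^-1.
pose A2 := @heat_cst R n k * U * (cm / 2) `^ (- (k%:R / 2)).
have cmp : 0 < cm * - p by rewrite mulr_gt0// oppr_gt0.
have A10 : 0 <= A1.
  by rewrite /A1 mulr_ge0 ?invr_ge0 ?(ltW cmp)// mulr_ge0// addr_ge0// mulr_ge0.
have A20 : 0 <= A2 by rewrite /A2 mulr_ge0 ?powR_ge0// mulr_ge0// heat_cst_ge0.
exists (A1 + A2) => [|N K phi dphi ddphi f u ad t tau es x tT /andP[tau0 tauh] hk].
  by rewrite addr_ge0.
have [N0 K0 _ _ cbd _ _ _ ru] := ad.
have /andP[t0 tT'] := tT.
set h0 := tscale K t in tauh *; have h00 : 0 < h0 by exact: tscale_gt0.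
have h0t : h0 <= t by rewrite ge_min lexx.
have [acm acp] : cm <= dphi (u t x) /\ dphi (u t x) <= cp.
  by apply/andP; apply: cbd; apply: ru; rewrite ltW.
set a := dphi (u t x) in acm acp.
have a0 : 0 < a by apply: lt_le_trans acm.
have lipG (r : R) e' y : t - h0 / 2 <= r <= t ->
    `|lgrad e' (u r) y| <= G / Num.sqrt h0.
  move=> /andP[r1 r2]; have [_ r0] := tscale_half K t r K0 t0 r1.
  apply: le_trans (sqrt_tscale_half K t r C1 K0 t0 C10 r1).
  by apply: (hgrad _ _ _ _ _ _ _ ad); rewrite r0 (le_trans r2).
have hmod (r : R) y : t - h0 / 2 <= r <= t ->
    `|u r y - u t x| <= C2 * ((t - r + weight (y - x)) / h0) `^ q.
  by move=> hr; apply: (hosc _ _ _ _ _ _ _ ad).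
have q01 : 0 < q < 2^-1 by rewrite q0.
have tau01 : 0 <= tau <= h0 by rewrite ltW.
have h20 : 0 < h0 / 2 by rewrite divr_gt0.
have delh : 0 <= h0 / 2 <= h0 / 2 by rewrite lexx ltW.
have H := freeze cm cp T nf nphi um up N K phi dphi ddphi f u hc ad t q C2 G
  tau (h0 / 2) x es tT q01 C20 G0 hmod lipG tau01 delh.
rewrite /= -/h0 -/a hk -/p tau0 lt_eqF// -/F in H.
have {}H := H isT isT.
set H0 := h0 `^ (- (q + 2^-1)) in H *.
have H00 : 0 <= H0 by exact: powR_ge0.
have tp0 : 0 <= tau `^ p by exact: powR_ge0.
have b1 : H0 * F * (C2 * G + 1) * (((tau + a * (h0 / 2)) `^ p - tau `^ p) / (a * p))
   <= A1 * H0 * tau `^ p.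
  have -> : A1 * H0 * tau `^ p = H0 * F * (C2 * G + 1) * (tau `^ p / (cm * - p)).
    by rewrite /A1; ring.
  apply: ler_wpM2l; first by nneg.
  have -> : ((tau + a * (h0 / 2)) `^ p - tau `^ p) / (a * p) =
     (tau `^ p - (tau + a * (h0 / 2)) `^ p) / (a * - p).
    by field; rewrite (lt_eqF p0) gt_eqF.
  have hle : (tau + a * (h0 / 2)) `^ p <= tau `^ p.
    by apply: powR_le_neg => //; [rewrite lerDl mulr_ge0 ?ltW|exact: ltW].
  apply: ler_pM.
  - by rewrite subr_ge0.
  - by rewrite invr_ge0 mulr_ge0 ?oppr_ge0 ?ltW.
  - by rewrite lerBlDr lerDl powR_ge0.
  - by rewrite lef_pV2 ?posrE ?mulr_gt0 ?oppr_gt0// ler_pM2r ?oppr_gt0.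
have ta : 0 < tau + a * (h0 / 2) by rewrite addr_gt0// mulr_gt0.
have tT2 : 0 <= t - h0 / 2 <= T by apply/andP; split; lra.
have H2 := heat_lgrads_sup0 N0 (u (t - h0 / 2)) U (tau + a * (h0 / 2)) es x ta
  (fun y => range_norm um up _ (ru _ y tT2)).
rewrite hk in H2.
(* The far term is of order [h0 ^ (- k / 2)]; since [p < 0] and [tau <= h0], its factor [h0 ^ p] is
   at most [tau ^ p]. *)
have b2 : @heat_cst R n k * U * (tau + a * (h0 / 2)) `^ (- (k%:R / 2)) <= A2 * H0 * tau `^ p.
  rewrite /A2 -!mulrA ler_wpM2l ?heat_cst_ge0// ler_wpM2l//.
  apply: (@le_trans _ _ ((cm / 2 * h0) `^ (- (k%:R / 2)))).
    apply: powR_le_neg; first by rewrite mulr_gt0 ?divr_gt0.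
      have : cm * (h0 / 2) <= a * (h0 / 2) by rewrite ler_pM2r.
      lra.
    by rewrite oppr_le0 divr_ge0.
  rewrite powRM ?divr_ge0 ?(ltW hc) ?(ltW h00)// ler_wpM2l ?powR_ge0//.
  have -> : - (k%:R / 2) = - (q + 2^-1) + p by rewrite /p; ring.
  rewrite powRD; last by rewrite (gt_eqF h00) implybT.
  rewrite ler_wpM2l//; apply: powR_le_neg => //; exact: ltW.
set A := lgrads es (heat (tau + a * (h0 / 2)) (u (t - h0 / 2))) x in H H2 *.
set B := lgrads es (heat tau (u t)) x in H *.
have := ler_normB A (A - B); rewrite opprB addrC subrK => h3.
apply: (le_trans h3); apply: (le_trans (lerD H2 H)).
apply: (le_trans (lerD b2 b1)); lra.
Qed.

End HigherOrderBounds.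

(** * Parabolic Hölder estimates *)

Section HolderGradient.
Context {R : realType} {n : nat} (cm cp T sigma nf nphi um up : R).
Hypotheses (hc : 0 < cm) (hcp : cm <= cp) (hsigma : nash_exponent n cm cp sigma).
Local Notation adm N K phi dphi ddphi f u :=
  (@admissible R n cm cp T nf nphi um up N K phi dphi ddphi f u).
Local Notation U := (Num.max `|um| `|up|).
Local Notation q := (sigma / 2).
Local Notation hexp K t := (tscale K t `^ (- (q + 2^-1))).

Let U0 : 0 <= U. Proof. by rewrite le_max normr_ge0. Qed.

Let sg01 : 0 < sigma < 1. Proof. by case: hsigma. Qed.

Lemma tscale_le (K s t : R) : s <= t -> tscale K s <= tscale K t.
Proof. by move=> st; rewrite /tscale le_min !ge_min st lexx !orbT. Qed.

Lemma hexp_le (K s t : R) : 0 < K -> 0 < s -> s <= t -> hexp K t <= hexp K s.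
Proof.
move=> K0 s0 st; apply: powR_le_neg; [exact: tscale_gt0|exact: tscale_le|].
by case/andP: sg01; lra.
Qed.

Lemma inv_sqrt_hexp (K t : R) : 0 < K -> 0 < t ->
  (Num.sqrt (tscale K t))^-1 = hexp K t * tscale K t `^ q.
Proof.
move=> K0 t0; have h0 := tscale_gt0 K t K0 t0.
rewrite -powRD; last by rewrite (gt_eqF h0) implybT.
by rewrite (_ : - (q + 2^-1) + q = - 2^-1) ?powRN ?powR12_sqrt ?ltW//; ring.
Qed.

(** Three differences of the flow blow up like [r ^ (q - 1)], which is integrable and leaves
    [d ^ q]. *)
Lemma grad_smoothing : exists2 C : R, 0 <= C & forall N K phi dphi ddphi f u,
  adm N K phi dphi ddphi f u -> forall (t d : R) e x, 0 < t <= T ->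
  0 <= d <= tscale K t ->
  `|lgrad e (heat d (u t)) x - lgrad e (u t) x| <= C * hexp K t * d `^ q.
Proof.
have [C3 C30 h3] := higher_bound cm cp T sigma nf nphi um up hc hcp hsigma 3 isT.
have /andP[sg0 sg1] := sg01; have q0 : 0 < q by rewrite divr_gt0.
exists (n%:R * C3 / q) => [|N K phi dphi ddphi f u ad t d e x tT /andP[d0 dh]].
  by rewrite !mulr_ge0// invr_ge0 ltW.
have [N0 K0 _ _ _ _ _ _ _] := ad.
have H0 : 0 <= hexp K t by exact: powR_ge0.
have := heat_smoothing [:: e] (u t) (C3 * hexp K t) q d x q0 d0 (mulr_ge0 C30 H0).
have -> : n%:R * (C3 * hexp K t) * (d `^ q / q) = n%:R * C3 / q * hexp K t * d `^ q by ring.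
apply=> r i /andP[r0 rd].
have := h3 _ _ _ _ _ _ _ ad t r ([:: e] ++ [:: (i, false); (i, true)]) x tT.
rewrite r0 (le_trans (ltW rd) dh) => /(_ isT erefl).
by rewrite (_ : q + 2^-1 - 3%:R / 2 = q - 1)//; field.
Qed.

(** Both gradients are smoothed for a time equal to the squared distance [d], at cost [d ^ q]. The
    smoothed gradient has slope [d ^ (q - 1/2)], which over a distance [sqrt d] again costs [d ^ q].
    Beyond the scale [tscale] the gradient bound is enough. *)
Lemma grad_holder_space : exists2 C : R, 0 <= C & forall N K phi dphi ddphi f u,
  adm N K phi dphi ddphi f u -> forall (t : R) e x y, 0 < t <= T ->
  `|lgrad e (u t) x - lgrad e (u t) y| <= C * hexp K t * weight (x - y) `^ q.
Proof.
have [C1 C10 h1] := grad_bound cm cp T sigma nf nphi um up hc hcp hsigma.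
have [C2 C20 h2] := higher_bound cm cp T sigma nf nphi um up hc hcp hsigma 2 isT.
have [C3 C30 h3] := grad_smoothing.
have /andP[sg0 sg1] := sg01; have q0 : 0 < q by rewrite divr_gt0.
exists (2 * C1 + (2 * C3 + n%:R * C2)) => [|N K phi dphi ddphi f u ad t e x y tT].
  by rewrite !addr_ge0 ?mulr_ge0.
have [N0 K0 _ _ _ _ _ _ _] := ad; have /andP[t0 _] := tT.
have hK := tscale_gt0 K t K0 t0.
set H := hexp K t; have H0 : 0 <= H by exact: powR_ge0.
set d := weight _; have d0 : 0 <= d by exact: weight_ge0.
have P0 : 0 <= d `^ q by exact: powR_ge0.
have HP : 0 <= H * d `^ q by rewrite mulr_ge0.
have [dh|hd] := leP d (tscale K t); last first.
  have b z := h1 _ _ _ _ _ _ _ ad t e z tT.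
  have : `|lgrad e (u t) x - lgrad e (u t) y| <= 2 * C1 * (H * tscale K t `^ q).
    apply: (le_trans (ler_normB _ _)); apply: (le_trans (lerD (b x) (b y))).
    by rewrite inv_sqrt_hexp// -/H; lra.
  have : 2 * C1 * (H * tscale K t `^ q) <= 2 * C1 * (H * d `^ q).
    rewrite ler_wpM2l ?mulr_ge0// ler_wpM2l//.
    by apply: powR_le_pos; apply: ltW.
  have : 0 <= (2 * C3 + n%:R * C2) * (H * d `^ q) by rewrite mulr_ge0// addr_ge0 ?mulr_ge0.
  lra.
have [dz|dn0] := eqVneq d 0.
  have /eqP : x - y = 0 by exact: (weight_eq0 N _ N0 dz).
  rewrite subr_eq0 => /eqP ->; rewrite subrr normr0.
  by rewrite -mulrA mulr_ge0// !addr_ge0 ?mulr_ge0.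
have {}dn0 : 0 < d by rewrite lt_neqAle eq_sym dn0.
have dh' : 0 <= d <= tscale K t by rewrite d0.
have b3 z := h3 _ _ _ _ _ _ _ ad t d e z tT dh'.
have b2 z e' : `|lgrad e' (lgrad e (heat d (u t))) z| <= C2 * H * d `^ (q - 2^-1).
  have := h2 _ _ _ _ _ _ _ ad t d [:: e'; e] z tT.
  rewrite dn0 dh => /(_ isT erefl).
  by rewrite (_ : q + 2^-1 - 2%:R / 2 = q - 2^-1)//; field.
have b4 := lipschitz_weight N0 (lgrad e (heat d (u t))) _ x y b2.
have E : n%:R * (C2 * H * d `^ (q - 2^-1)) * Num.sqrt (weight (x - y)) =
   n%:R * C2 * (H * d `^ q).
  rewrite -/d -powR12_sqrt// -[in RHS](subrK 2^-1 q).
  rewrite [in RHS]powRD; last by rewrite (gt_eqF dn0) implybT.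
  by ring.
rewrite E in b4.
have bx := b3 x; have by_ := b3 y; rewrite -/H in bx by_.
have : 0 <= 2 * C1 * (H * d `^ q) by rewrite mulr_ge0// mulr_ge0.
move: bx by_ b4; rewrite !ler_norml; lra.
Qed.

(** The scheme of [time_half], with the improved modulus and with second differences from
    [higher_bound] in place of [heat_time_half]; both terms now have order [q + 1/2]. *)
Lemma time_holder : exists2 C : R, 0 <= C & forall N K phi dphi ddphi f u,
  adm N K phi dphi ddphi f u -> forall (t s : R) x, 0 < s -> s <= t -> t <= T ->
  `|u t x - u s x| <= C * hexp K s * (t - s) `^ (q + 2^-1).
Proof.
have [C1 C10 hgrad] := grad_bound cm cp T sigma nf nphi um up hc hcp hsigma.
have [C2 C20 h2] := higher_bound cm cp T sigma nf nphi um up hc hcp hsigma 2 isT.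
have [C3 C30 hosc] := osc_sigma cm cp T sigma nf nphi um up hc hcp hsigma.
have /andP[sg0 sg1] := sg01; have q0 : 0 < q by rewrite divr_gt0.
have q1 : q < 2^-1 by lra.
have cp0 : 0 < cp by apply: lt_le_trans hcp.
pose p := q + 2^-1; have p0 : 0 < p by rewrite /p; lra.
set F := @freeze_cst R n cm cp nf nphi 0; have F0 : 0 <= F by exact: freeze_cst_ge0.
pose G := Num.sqrt 2 * C1.
have G0 : 0 <= G by rewrite mulr_ge0 ?sqrtr_ge0.
(* The first entry keeps [t - s] within the half-window; the second keeps the heat time
   [a * (t - s)] below the scale at the earlier time [s], where [higher_bound] is used. *)
pose kap : R := Num.min 2^-1 (2 * cp)^-1.
have kap0 : 0 < kap by rewrite lt_min !invr_gt0 ltr0n/= mulr_gt0.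
pose A1 := F * (C3 * G + 1) * (cp `^ p / (cm * p)).
pose A2 := n%:R * C2 * (cp `^ p / p).
pose A3 := 2 * U * kap^-1 `^ p.
have A10 : 0 <= A1 by rewrite /A1; nneg.
have A20 : 0 <= A2 by rewrite /A2; nneg.
have A30 : 0 <= A3 by rewrite /A3; nneg.
exists (A1 + A2 + A3) => [|N K phi dphi ddphi f u ad t s x s0 st tT']; first by nneg.
have [N0 K0 _ _ cbd _ _ _ ru] := ad.
have t0 : 0 < t by apply: lt_le_trans st.
have tT : 0 < t <= T by rewrite t0.
have sT : 0 < s <= T by rewrite s0 (le_trans st).
set h0 := tscale K t; have h00 : 0 < h0 by exact: tscale_gt0.
set h1 := tscale K s; have h10 : 0 < h1 by exact: tscale_gt0.
have h0t : h0 <= t by rewrite ge_min lexx.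
have h10' : h1 <= h0 by exact: tscale_le.
set H := h1 `^ _; have H0 : 0 <= H by exact: powR_ge0.
have HH : hexp K t <= H by exact: hexp_le.
set del := t - s; have del0 : 0 <= del by rewrite subr_ge0.
rewrite -/p; set P := del `^ p; have P0 : 0 <= P by exact: powR_ge0.
have HP : 0 <= H * P by rewrite mulr_ge0.
have [hsmall|hbig] := leP del (kap * h0); last first.
  have : `|u t x - u s x| <= 2 * U.
    apply: (le_trans (ler_normB _ _)).
    by rewrite mulr2n mulrDl mul1r lerD//; apply: range_norm; apply: ru; rewrite ltW//;
      case/andP: sT.
  have : 1 <= kap^-1 `^ p * H * P.
    have hinv : H = h1^-1 `^ p by rewrite -powR_inv1 ?(ltW h10)// -powRrM mulN1r.
    have k1 : 0 <= kap^-1 by rewrite invr_ge0 ltW.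
    have h1i : 0 <= h1^-1 by rewrite invr_ge0 ltW.
    rewrite hinv /P -(powRM _ k1 h1i) -powRM ?mulr_ge0//.
    have h4 : 1 <= kap^-1 * h1^-1 * del.
      rewrite -mulrA -ler_pdivrMl ?invr_gt0// invrK mulr1 mulrC ler_pdivlMr//.
      by apply: le_trans (ltW hbig); rewrite ler_pM2l.
    by have := powR_le_pos _ _ p ler01 h4 (ltW p0); rewrite powR1.
  move=> h4 h5.
  have h6 : 2 * U * 1 <= 2 * U * (kap^-1 `^ p * H * P) by rewrite ler_wpM2l ?mulr_ge0.
  have : 0 <= (A1 + A2) * (H * P) by nneg.
  rewrite /A3; lra.
have [acm acp] : cm <= dphi (u t x) /\ dphi (u t x) <= cp.
  by apply/andP; apply: cbd; apply: ru; rewrite ltW.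
set a := dphi (u t x) in acm acp.
have a0 : 0 < a by apply: lt_le_trans acm.
have kap2 : kap * h0 <= h0 / 2.
  by rewrite mulrC ler_pM2l// ge_min lexx.
have kapc : cp * (kap * h0) <= h0 / 2.
  rewrite mulrA [h0 / 2]mulrC ler_pM2r//.
  apply: (@le_trans _ _ (cp * (2 * cp)^-1)); first by rewrite ler_pM2l// ge_min lexx orbT.
  by rewrite invfM mulrCA mulfV ?gt_eqF// mulr1.
have lipG (r : R) e' y : t - h0 / 2 <= r <= t ->
    `|lgrad e' (u r) y| <= G / Num.sqrt h0.
  move=> /andP[r1 r2]; have [_ r0] := tscale_half K t r K0 t0 r1.
  apply: le_trans (sqrt_tscale_half K t r C1 K0 t0 C10 r1).
  by apply: (hgrad _ _ _ _ _ _ _ ad); rewrite r0 (le_trans r2).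
have hmod (r : R) y : t - h0 / 2 <= r <= t ->
    `|u r y - u t x| <= C3 * ((t - r + weight (y - x)) / h0) `^ q.
  by move=> hr; apply: (hosc _ _ _ _ _ _ _ ad).
have q01 : 0 < q < 2^-1 by rewrite q0.
have tau0 : (0 : R) <= 0 <= h0 by apply/andP; split; [|exact: ltW].
have delh : 0 <= del <= h0 / 2 by rewrite del0 (le_trans hsmall).
have B1 := freeze cm cp T nf nphi um up N K phi dphi ddphi f u hc ad t q C3 G
  0 del x [::] tT q01 C30 G0 hmod lipG tau0 delh.
rewrite /= -/h0 -/a mul0r subr0 -/p p0 orbT gt_eqF// add0r heat0 powR0 ?gt_eqF// subr0 -/F in B1.
have {}B1 := B1 isT isT.
have ts : t - del = s by rewrite /del; ring.
rewrite ts in B1.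
have ad0 : 0 <= a * del by rewrite mulr_ge0// ltW.
have ade : a * del <= cp * del by rewrite ler_wpM2r.
have adP : (a * del) `^ p <= cp `^ p * P.
  by rewrite -(powRM _ (ltW cp0) del0); apply: powR_le_pos => //; exact: ltW.
have adh : a * del <= h1.
  apply: (le_trans ade); apply: (@le_trans _ _ (h0 / 2)).
    by apply: le_trans kapc; rewrite ler_pM2l.
  have := tscale_half K t s K0 t0; rewrite -/h0 => hh; apply: (hh _).1.
  by move: delh => /andP[_]; rewrite /del; lra.
have B2 : `|heat (a * del) (u s) x - u s x| <= n%:R * (C2 * H) * ((a * del) `^ p / p).
  apply: (heat_smoothing [::]) => //; first by rewrite mulr_ge0.
  move=> r i /andP[r0 rd].
  have := h2 _ _ _ _ _ _ _ ad s r ([::] ++ [:: (i, false); (i, true)]) x sT.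
  rewrite r0 (le_trans (ltW rd) adh) => /(_ isT erefl).
  by rewrite (_ : q + 2^-1 - 2%:R / 2 = p - 1)// /p; field.
have b2 : n%:R * (C2 * H) * ((a * del) `^ p / p) <= A2 * (H * P).
  have -> : A2 * (H * P) = n%:R * (C2 * H) * (cp `^ p * P / p) by rewrite /A2; ring.
  apply: ler_wpM2l; first by nneg.
  by rewrite ler_wpM2r// invr_ge0 ltW.
have b1 : hexp K t * F * (C3 * G + 1) * ((a * del) `^ p / (a * p)) <= A1 * (H * P).
  have -> : A1 * (H * P) = H * F * (C3 * G + 1) * (cp `^ p * P / (cm * p)).
    by rewrite /A1; ring.
  apply: ler_pM.
  - by nneg.
  - by rewrite divr_ge0 ?powR_ge0// mulr_ge0 ?ltW.
  - by rewrite -!mulrA ler_wpM2r//; nneg.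
  apply: ler_pM => //; first exact: powR_ge0.
    by rewrite invr_ge0 mulr_ge0 ?ltW.
  by rewrite lef_pV2 ?posrE ?mulr_gt0// ler_pM2r.
have : 0 <= A3 * (H * P) by nneg.
have := le_trans B1 b1; have := le_trans B2 b2.
rewrite !ler_norml -/p; lra.
Qed.

(** After smoothing both gradients for the time [d = t - s], what remains is one difference of the
    flow of [u t - u s]: size [d ^ (q + 1/2)] by [time_holder], times [d ^ (- 1/2)] for the
    difference. *)
Lemma grad_holder_time : exists2 C : R, 0 <= C & forall N K phi dphi ddphi f u,
  adm N K phi dphi ddphi f u -> forall (t s : R) e x, 0 < s -> s <= t -> t <= T ->
  `|lgrad e (u t) x - lgrad e (u s) x| <= C * hexp K s * (t - s) `^ q.
Proof.
have [C1 C10 h1] := grad_bound cm cp T sigma nf nphi um up hc hcp hsigma.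
have [C2 C20 h2] := time_holder.
have [C3 C30 h3] := grad_smoothing.
have /andP[sg0 sg1] := sg01; have q0 : 0 < q by rewrite divr_gt0.
exists (2 * C1 + (2 * C3 + @heat_cst R n 1 * C2)) => [|N K phi dphi ddphi f u ad t s e x s0 st tT'].
  by nneg.
have [N0 K0 _ _ _ _ _ _ _] := ad.
have t0 : 0 < t by apply: lt_le_trans st.
have tT : 0 < t <= T by rewrite t0.
have sT : 0 < s <= T by rewrite s0 (le_trans st).
set H := hexp K s; have H0 : 0 <= H by exact: powR_ge0.
have HH : hexp K t <= H by exact: hexp_le.
set d := t - s; have d0 : 0 <= d by rewrite subr_ge0.
have hs := tscale_gt0 K s K0 s0; have ht := tscale_gt0 K t K0 t0.
have hst := tscale_le K s t st.
have P0 : 0 <= d `^ q by exact: powR_ge0.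
have HP : 0 <= H * d `^ q by rewrite mulr_ge0.
have [dh|hd] := leP d (tscale K s); last first.
  have bt := h1 _ _ _ _ _ _ _ ad t e x tT.
  have bs := h1 _ _ _ _ _ _ _ ad s e x sT.
  have bt' : C1 / Num.sqrt (tscale K t) <= C1 / Num.sqrt (tscale K s).
    by rewrite ler_wpM2l// lef_pV2 ?posrE ?sqrtr_gt0// ler_wsqrtr.
  have : `|lgrad e (u t) x - lgrad e (u s) x| <= 2 * C1 * (H * tscale K s `^ q).
    apply: (le_trans (ler_normB _ _)); apply: (le_trans (lerD (le_trans bt bt') bs)).
    by rewrite inv_sqrt_hexp// -/H; lra.
  have : 2 * C1 * (H * tscale K s `^ q) <= 2 * C1 * (H * d `^ q).
    rewrite ler_wpM2l ?mulr_ge0// ler_wpM2l//.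
    by apply: powR_le_pos; apply: ltW.
  have : 0 <= (2 * C3 + @heat_cst R n 1 * C2) * (H * d `^ q) by nneg.
  lra.
have [dz|dn0] := eqVneq d 0.
  have -> : t = s by move: dz; rewrite /d; lra.
  rewrite subrr normr0 -mulrA mulr_ge0//; nneg.
have {}dn0 : 0 < d by rewrite lt_neqAle eq_sym dn0.
have bt := h3 _ _ _ _ _ _ _ ad t d e x tT; rewrite d0 (le_trans dh hst) in bt.
have {}bt := bt isT.
have bs := h3 _ _ _ _ _ _ _ ad s d e x sT; rewrite d0 dh in bs.
have {}bs := bs isT; rewrite -/H in bs.
have bt' : C3 * hexp K t * d `^ q <= C3 * (H * d `^ q).
  by rewrite -mulrA ler_wpM2l// ler_wpM2r.
have bm := heat_lgrads_sup N0 (fun y => u t y - u s y) (C2 * H * d `^ (q + 2^-1)) d [:: e] x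
  isT dn0 (fun y => h2 _ _ _ _ _ _ _ ad t s y s0 st tT').
rewrite heat_sub// lgrads_sub /= in bm.
have E : @heat_cst R n 1 * (C2 * H * d `^ (q + 2^-1)) * d `^ (- (1 / 2)) =
    @heat_cst R n 1 * C2 * (H * d `^ q).
  have -> : d `^ q = d `^ (q + 2^-1) * d `^ (- (1 / 2)).
    rewrite -powRD; last by rewrite (gt_eqF dn0) implybT.
    by congr (_ `^ _); field.
  by ring.
rewrite E in bm.
have : 0 <= 2 * C1 * (H * d `^ q) by rewrite mulr_ge0// mulr_ge0.
have {}bt := le_trans bt bt'.
move: bt bs bm; rewrite !ler_norml; lra.
Qed.

End HolderGradient.

(** * Polylinear interpolation *)

Section Interpolation.
Context {R : realType} {n N : nat} (N0 : (0 < N)%N).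
Local Notation V := 'rV['I_N.-1.+1]_n.
Local Notation ev e := (lclass N (evec e)).
Implicit Types (g : V -> R) (x y : V) (z : 'rV[R]_n) (v : {ffun 'I_n -> bool}).

Let NR : 0 < N%:R :> R. Proof. by rewrite ltr0n. Qed.

Definition pweight z v : R := \prod_(i < n) vartheta N (v i) (z 0 i).

Definition interpolate g z : R := \sum_v pweight z v * g (lclass N (cell N z v)).

Lemma interpE (u : R -> V -> R) t z : interp u t z = interpolate (u t) z.
Proof. by []. Qed.

Lemma fracpart_itv (r : R) : 0 <= fracpart r < 1.
Proof.
by have := floor_itv r; rewrite /fracpart intrD; move=> /andP[]; lra.
Qed.

Lemma vartheta_ge0 b (r : R) : 0 <= vartheta N b r.
Proof. by rewrite /vartheta; have := fracpart_itv (N%:R * r); case: b; lra. Qed.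

Lemma pweight_ge0 z v : 0 <= pweight z v.
Proof. by apply: prodr_ge0 => i _; exact: vartheta_ge0. Qed.

Lemma sum_pweight z : \sum_v pweight z v = 1.
Proof.
rewrite /pweight -(bigA_distr_bigA (fun i b => vartheta N b (z 0 i)))/=.
by rewrite big1// => i _; rewrite big_bool/= /vartheta addrC subrK.
Qed.

Lemma interpolate_near g z (c B : R) :
  (forall v, `|g (lclass N (cell N z v)) - c| <= B) -> `|interpolate g z - c| <= B.
Proof.
move=> h; have -> : interpolate g z - c =
    \sum_v pweight z v * (g (lclass N (cell N z v)) - c).
  rewrite /interpolate -[c in LHS]mul1r -(sum_pweight z) mulr_suml -sumrB.
  by apply: eq_bigr => v _; rewrite mulrBr.
rewrite -[B]mul1r -(sum_pweight z) mulr_suml.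
apply: (le_trans (ler_norm_sum _ _ _)); apply: ler_sum => v _.
by rewrite normrM ger0_norm ?pweight_ge0// ler_wpM2l ?pweight_ge0.
Qed.

Lemma interpolate_sub g (k : V -> R) z :
  interpolate g z - interpolate k z = interpolate (fun x => g x - k x) z.
Proof. by rewrite /interpolate -sumrB; apply: eq_bigr => v _; rewrite mulrBr. Qed.

Lemma interpolate_norm g z (B : R) : (forall x, `|g x| <= B) -> `|interpolate g z| <= B.
Proof.
move=> h; rewrite -[interpolate g z]subr0; apply: interpolate_near => v.
by rewrite subr0.
Qed.

Lemma floor_scaled_evec z i (j : 'I_n) :
  N%:R * (z + N%:R^-1 *: ivec R (evec (i, true))) 0 j = N%:R * z 0 j + (i == j)%:R.
Proof.
have Nn : N%:R != 0 :> R by rewrite gt_eqF.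
rewrite /evec /= !mxE eqxx /= mulrDr [N%:R * (_ * _)]mulrA mulfV// mul1r eq_sym.
by case: eqP.
Qed.

(** A translation by one mesh width moves the cell by one site and preserves the fractional parts,
    so the interpolation weights are unchanged. *)
Lemma cgrad_interp (u : R -> V -> R) i t z :
  cgrad N (i, true) (interp u) (t, z) = interpolate (lgrad (i, true) (u t)) z.
Proof.
rewrite /cgrad /= !interpE /interpolate -sumrB mulr_sumr; apply: eq_bigr => v _.
set z' := z + _.
have fE j : Num.floor (N%:R * z' 0 j) = Num.floor (N%:R * z 0 j) + (i == j)%:Z.
  by rewrite floor_scaled_evec -[(i == j)%:R]/((i == j)%:Z%:~R) floorDrz ?intrKfloor ?intr_int.
have -> : pweight z' v = pweight z v.
  apply: eq_bigr => j _; rewrite /vartheta /fracpart fE floor_scaled_evec intrD.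
  by rewrite opprD addrACA subrr addr0.
have -> : lclass N (cell N z' v) = lclass N (cell N z v) + ev (i, true).
  rewrite -lclassD; congr (lclass N _); apply/rowP => j.
  rewrite [LHS]mxE fE [RHS]mxE [cell _ _ _ _ _]mxE /evec /= mxE eqxx /= eq_sym.
  by rewrite addrAC; case: eqP.
by rewrite /lgrad; ring.
Qed.

Definition plin (h : int -> R) (b : R) : R :=
  (1 - fracpart b) * h (Num.floor b) + fracpart b * h (Num.floor b + 1).

(** The segment from [a] to [b] is cut at the integers into a first piece, [j] whole steps and a
    last piece, each of slope at most [M]. *)
Lemma plin_lipschitz (h : int -> R) (M a b : R) :
  (forall m, `|h (m + 1) - h m| <= M) -> `|plin h a - plin h b| <= M * `|a - b|.
Proof.
move=> hM; have M0 : 0 <= M by apply: le_trans (hM 0).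
wlog ab : a b / a <= b.
  by move=> hw; have [/hw//|/ltW /hw] := leP a b; rewrite distrC (distrC b).
have steps (m : int) (j : nat) : `|h (m + j%:Z) - h m| <= M * j%:R.
  elim: j => [|j IH]; first by rewrite addr0 subrr normr0 mulr0.
  have := ler_normD (h (m + j.+1%:Z) - h (m + j%:Z)) (h (m + j%:Z) - h m).
  rewrite addrA subrK -natr1 mulrDr mulr1 => h1; apply: (le_trans h1).
  rewrite addrC; apply: lerD => //.
  by have := hM (m + j%:Z); rewrite -addrA -PoszD addn1.
have /andP[fa0 fa1] := fracpart_itv a; have /andP[fb0 fb1] := fracpart_itv b.
have fl : Num.floor a <= Num.floor b by apply: le_floor.
have aE : a = (Num.floor a)%:~R + fracpart a by rewrite /fracpart addrC subrK.
have bE : b = (Num.floor b)%:~R + fracpart b by rewrite /fracpart addrC subrK.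
rewrite (ler0_norm (x := a - b)); last by rewrite subr_le0.
have [e|ne] := eqVneq (Num.floor a) (Num.floor b).
  have ba : b - a = fracpart b - fracpart a by rewrite /fracpart e; ring.
  rewrite opprB ba /plin e.
  have -> : (1 - fracpart a) * h (Num.floor b) + fracpart a * h (Num.floor b + 1) -
     ((1 - fracpart b) * h (Num.floor b) + fracpart b * h (Num.floor b + 1)) =
     - ((fracpart b - fracpart a) * (h (Num.floor b + 1) - h (Num.floor b))) by ring.
  rewrite normrN normrM ger0_norm; last by rewrite -ba subr_ge0.
  by rewrite mulrC ler_wpM2r// -ba subr_ge0.
have [j jE] : exists j : nat, Num.floor b = Num.floor a + 1 + j%:Z.
  exists `|(Num.floor b - (Num.floor a + 1))%R|%N.
  by rewrite gez0_abs; [ring|rewrite subr_ge0 -ltzD1 ltrD2r lt_neqAle ne].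
have h1 := steps (Num.floor a + 1) j; rewrite -jE in h1.
have h2 := hM (Num.floor a); have h3 := hM (Num.floor b).
have -> : - (a - b) = (1 - fracpart a) + j%:R + fracpart b.
  by rewrite {1}aE {1}bE jE !intrD; ring.
rewrite /plin.
have -> : (1 - fracpart a) * h (Num.floor a) + fracpart a * h (Num.floor a + 1) -
     ((1 - fracpart b) * h (Num.floor b) + fracpart b * h (Num.floor b + 1)) =
  - ((1 - fracpart a) * (h (Num.floor a + 1) - h (Num.floor a))
    + (h (Num.floor b) - h (Num.floor a + 1))
    + fracpart b * (h (Num.floor b + 1) - h (Num.floor b))) by ring.
rewrite normrN.
have t1 : `|(1 - fracpart a) * (h (Num.floor a + 1) - h (Num.floor a))| <= M * (1 - fracpart a).
  by rewrite normrM ger0_norm ?subr_ge0 ?(ltW fa1)// mulrC ler_wpM2r// subr_ge0 ltW.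
have t3 : `|fracpart b * (h (Num.floor b + 1) - h (Num.floor b))| <= M * fracpart b.
  by rewrite normrM ger0_norm// mulrC ler_wpM2r.
move: t1 h1 t3; set X1 := (1 - _) * (h _ - h _); set X3 := fracpart b * (h _ - h _).
by set X2 := h (Num.floor b) - _; move=> t1 t2 t3; have := ler_normD (X1 + X2) X3; have := ler_normD X1 X2; lra.
Qed.

Definition set_true (i : 'I_n) v : {ffun 'I_n -> bool} :=
  [ffun j => if j == i then true else v j].

(* Pairing the vertices of a cell that differ in the coordinate [i] makes the
   interpolation piecewise linear in that coordinate. *)
Lemma sum_split_coord (F : {ffun 'I_n -> bool} -> R) i :
  \sum_v F v = \sum_(v : {ffun 'I_n -> bool} | ~~ v i) (F v + F (set_true i v)).
Proof.
rewrite (bigID (fun v : {ffun 'I_n -> bool} => v i))/= addrC big_split/=; congr (_ + _).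
pose unset v : {ffun 'I_n -> bool} := [ffun j => if j == i then false else v j].
rewrite (reindex_onto (set_true i) unset) /=.
  apply: eq_bigl => v; rewrite !ffunE eqxx /=; apply/eqP/idP => [<-|vi].
    by rewrite !ffunE eqxx.
  by apply/ffunP => j; rewrite !ffunE; case: eqP => // ->; rewrite (negPf vi).
by move=> v vi; apply/ffunP => j; rewrite !ffunE; case: eqP => // ->.
Qed.

Definition pweight' i z v : R := \prod_(j < n | j != i) vartheta N (v j) (z 0 j).

Lemma interpolate_split g z i : interpolate g z = \sum_(v : {ffun 'I_n -> bool} | ~~ v i)
  pweight' i z v * plin (fun m => g (lclass N (\row_j
    if j == i then m else Num.floor (N%:R * z 0 j) + (v j : nat)%:Z))) (N%:R * z 0 i).
Proof.
rewrite /interpolate (sum_split_coord _ i); apply: eq_bigr => v vi.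
have vF : v i = false by apply/negbTE.
have -> : pweight z v = pweight' i z v * (1 - fracpart (N%:R * z 0 i)).
  by rewrite /pweight (bigD1 i)//= vF mulrC.
have -> : pweight z (set_true i v) = pweight' i z v * fracpart (N%:R * z 0 i).
  rewrite /pweight (bigD1 i)//= ffunE eqxx mulrC; congr (_ * _).
  by apply: eq_bigr => j ji; rewrite ffunE (negPf ji).
rewrite -!mulrA -mulrDr /plin; congr (_ * (_ * g _ + _ * g _)); congr (lclass N _);
  apply/rowP => j; rewrite !mxE ?ffunE; case: eqP => [->|]//=.
by rewrite vF addr0.
Qed.

Lemma sum_pweight' i z : \sum_(v : {ffun 'I_n -> bool} | ~~ v i) pweight' i z v = 1.
Proof.
rewrite -(sum_pweight z) (sum_split_coord _ i); apply: eq_bigr => v vi.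
have vF : v i = false by apply/negbTE.
rewrite /pweight !(bigD1 (P := xpredT) i)//= vF ffunE eqxx.
rewrite [X in _ = _ + _ * X](_ : _ = pweight' i z v); last first.
  by apply: eq_bigr => j ji; rewrite ffunE (negPf ji).
by rewrite -/(pweight' i z v) -mulrDl subrK mul1r.
Qed.

Lemma interpolate_coord g z z' i (M : R) :
  (forall x e, `|g (x + ev e) - g x| <= M) ->
  (forall j, j != i -> z' 0 j = z 0 j) ->
  `|interpolate g z' - interpolate g z| <= M * (N%:R * `|z' 0 i - z 0 i|).
Proof.
move=> hM zz'; rewrite !(interpolate_split _ _ i).
rewrite (eq_bigr (fun v : {ffun 'I_n -> bool} => pweight' i z v *
  plin (fun m => g (lclass N (\row_j
    if j == i then m else Num.floor (N%:R * z 0 j) + (v j : nat)%:Z))) (N%:R * z' 0 i)));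
  last first.
  move=> v _; congr (_ * plin _ _).
    by apply: eq_bigr => j ji; rewrite zz'.
  apply/funext => m; congr (g (lclass N _)); apply/rowP => j; rewrite !mxE.
  by case: eqVneq => // ji; rewrite zz'.
rewrite -sumrB; set X := (X in _ <= X).
have -> : X = \sum_(v : {ffun 'I_n -> bool} | ~~ v i) pweight' i z v * X.
  by rewrite -mulr_suml sum_pweight' mul1r.
rewrite /X {X}.
apply: (le_trans (ler_norm_sum _ _ _)); apply: ler_sum => v _.
have p0 : 0 <= pweight' i z v by apply: prodr_ge0 => j _; exact: vartheta_ge0.
rewrite -mulrBr normrM ger0_norm// ler_wpM2l//.
have -> : N%:R * `|z' 0 i - z 0 i| = `|N%:R * z' 0 i - N%:R * z 0 i|.
  by rewrite -mulrBr normrM ger0_norm.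
apply: plin_lipschitz => m.
have := hM (lclass N (\row_j
    if j == i then m else Num.floor (N%:R * z 0 j) + (v j : nat)%:Z)) (i, true).
rewrite -lclassD; congr (`|g (lclass N _) - _| <= M).
apply/rowP => j; rewrite !mxE /=; case: eqP => _ //=; by rewrite addr0.
Qed.

(** The coordinates are changed one at a time through the hybrid points [mix k]; each change may
    cross several cells. *)
Lemma interpolate_lipschitz g z z' (M : R) :
  (forall x e, `|g (x + ev e) - g x| <= M) ->
  `|interpolate g z' - interpolate g z| <= M * (N%:R * \sum_i `|z' 0 i - z 0 i|).
Proof.
move=> hM.
pose mix k : 'rV[R]_n := \row_j (if (j < k)%N then z' 0 j else z 0 j).
have main k : (k <= n)%N -> `|interpolate g (mix k) - interpolate g z| <=
    M * (N%:R * \sum_(i < n | (i < k)%N) `|z' 0 i - z 0 i|).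
  elim: k => [_|k IH kn].
    rewrite big_pred0// !mulr0 (_ : mix 0%N = z) ?subrr ?normr0//.
    by apply/rowP => j; rewrite mxE.
  pose i := Ordinal kn.
  have h1 : `|interpolate g (mix k.+1) - interpolate g (mix k)| <=
      M * (N%:R * `|z' 0 i - z 0 i|).
    have := interpolate_coord g (mix k) (mix k.+1) i M hM.
    rewrite !mxE /= ltnn ltnSn; apply=> j ji; rewrite !mxE ltnS leq_eqVlt.
    by rewrite (_ : (j == k :> nat) = false)//; apply/negP => /eqP e;
      move/negP: ji; apply; apply/eqP/val_inj.
  have h2 := IH (ltnW kn).
  have -> : \sum_(j < n | (j < k.+1)%N) `|z' 0 j - z 0 j| =
      `|z' 0 i - z 0 i| + \sum_(j < n | (j < k)%N) `|z' 0 j - z 0 j|.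
    rewrite (bigD1 i) ?ltnSn//=; congr (_ + _); apply: eq_bigl => j.
    by rewrite ltnS ltn_neqAle andbC.
  have := ler_normD (interpolate g (mix k.+1) - interpolate g (mix k))
     (interpolate g (mix k) - interpolate g z).
  by rewrite addrA subrK !mulrDr; lra.
have := main n (leqnn n); rewrite (_ : mix n = z'); last first.
  by apply/rowP => j; rewrite mxE ltn_ord.
by rewrite (eq_bigl xpredT) => // j; rewrite ltn_ord.
Qed.

Lemma coord_le_euclid z i : `|z 0 i| <= euclid z.
Proof.
rewrite -sqrtr_sqr ler_wsqrtr// (bigD1 i)//= lerDl; apply: sumr_ge0 => j _.
by rewrite sqr_ge0.
Qed.

(** At distances at least one mesh width, all vertices of the two cells are compared. Below it the
    interpolation is Lipschitz, and [q < 1/2] gives [N * E <= (N * E) ^ (2 * q)], which turns the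
    slope into the Hölder bound. *)
Lemma interpolate_holder g z z' (B q : R) : 0 < q -> q < 2^-1 -> 0 <= B ->
  (forall x y, `|g x - g y| <= B * weight (x - y) `^ q) ->
  `|interpolate g z' - interpolate g z| <= (9 * n%:R) * B * (euclid (z' - z) ^+ 2) `^ q.
Proof.
move=> q0 q1 B0 hB; set E := euclid _; have E0 : 0 <= E by exact: sqrtr_ge0.
have nn : (0 < n)%N \/ n = 0%N by case: (n) => [|m]; [right|left].
case: nn => [n0|n0]; last first.
  have -> : z' = z by apply/rowP => i; exfalso; move: (i); rewrite n0 => -[].
  by rewrite subrr normr0 mulr_ge0 ?powR_ge0// !mulr_ge0.
have n1 : 1 <= n%:R :> R by rewrite ler1n.
have P0 : 0 <= (E ^+ 2) `^ q by exact: powR_ge0.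
have coordE i : `|z' 0 i - z 0 i| <= E.
  by have := coord_le_euclid (z' - z) i; rewrite !mxE.
have [NE|NE] := leP 1 (N%:R * E).
  have Ninv : N%:R^-1 <= E by rewrite -[_^-1]mul1r ler_pdivrMr// mulrC.
  have hv v v' : `|g (lclass N (cell N z' v')) - g (lclass N (cell N z v))| <=
      (9 * n%:R) * B * (E ^+ 2) `^ q.
    apply: (le_trans (hB _ _)).
    rewrite -lclassN -lclassD [9 * _ * B]mulrC -mulrA ler_wpM2l//.
    apply: (@le_trans _ _ ((9 * n%:R * E ^+ 2) `^ q)); last first.
      rewrite powRM ?mulr_ge0 ?exprn_ge0// ler_wpM2r//.
      rewrite -[leRHS]powRr1 ?mulr_ge0//; apply: ler_powR; last by lra.
      by lra.
    apply: powR_le_pos; [exact: weight_ge0| |exact: ltW].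
    apply: (le_trans (weight_lclass_le N0 _)); rewrite euclid_sqr.
    (* In each coordinate, rounding and the choice of vertices add at most two mesh widths to the
       displacement [E], and a mesh width is at most [E] here. *)
    have -> : 9 * n%:R * E ^+ 2 = \sum_(i < n) (3 * E) ^+ 2.
      by rewrite sumr_const card_ord -[RHS]mulr_natl; ring.
    apply: ler_sum => i _; rewrite -real_normK ?num_real// ler_pXn2r ?nnegrE ?mulr_ge0//.
    rewrite !mxE.
    have := fracpart_itv (N%:R * z 0 i); have := fracpart_itv (N%:R * z' 0 i).
    rewrite /fracpart => /andP[a1 a2] /andP[b1 b2].
    rewrite !intrD intrN intrD.
    set d1 : R := (v' i : nat)%:Z%:~R; set d2 : R := (v i : nat)%:Z%:~R.
    have hd1 : 0 <= d1 <= 1 by rewrite /d1; case: (v' i); rewrite /= ?ler01 ?lexx.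
    have hd2 : 0 <= d2 <= 1 by rewrite /d2; case: (v i); rewrite /= ?ler01 ?lexx.
    rewrite normrM ger0_norm ?invr_ge0// mulrC ler_pdivrMr//.
    have := coordE i; rewrite -(ler_pM2l NR) -{1}(ger0_norm (ltW NR)) -normrM mulrBr.
    rewrite !ler_norml; move: hd1 hd2 => /andP[c1 c2] /andP[c3 c4] /andP[c5 c6].
    by apply/andP; split; lra.
  apply: interpolate_near => v'; rewrite distrC.
  by apply: interpolate_near => v; rewrite distrC.
have step x e : `|g (x + ev e) - g x| <= B * (N%:R ^- 2) `^ q.
  apply: (le_trans (hB _ _)); rewrite ler_wpM2l//.
  apply: powR_le_pos; [exact: weight_ge0| |exact: ltW].
  rewrite [x + _]addrC addrK.
  have c0 : cyc_size ((0 : V) 0 e.1) = 0%N by rewrite mxE cyc_size0.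
  have := @weight_ev R n N 0 e; rewrite weight0 subr0 add0r c0 expr0n subr0 => ->.
  have /andP[h1 _] := cyc_size_ev N0 0 e; rewrite add0r c0 in h1.
  rewrite -[leRHS]mul1r ler_pM2r ?invr_gt0 ?exprn_gt0//.
  by rewrite -[leRHS](expr1n _ 2) ler_pXn2r ?nnegrE// (ler_nat R _ 1).
apply: (le_trans (interpolate_lipschitz g z z' _ step)).
have sumE : \sum_i `|z' 0 i - z 0 i| <= n%:R * E.
  have -> : n%:R * E = \sum_(i < n) E by rewrite sumr_const card_ord -[RHS]mulr_natl.
  by apply: ler_sum.
apply: (@le_trans _ _ (B * (N%:R ^- 2) `^ q * (N%:R * (n%:R * E)))).
  by rewrite ler_wpM2l ?mulr_ge0 ?powR_ge0// ler_wpM2l.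
have h1 : N%:R * E <= ((N%:R * E) ^+ 2) `^ q.
  have [->|E1] := eqVneq E 0; first by rewrite mulr0 powR_ge0.
  have NE0 : 0 < N%:R * E by rewrite mulr_gt0// lt_neqAle eq_sym E1.
  rewrite -(powR_mulrn 2) ?(ltW NE0)// -powRrM -[leLHS]powRr1 ?(ltW NE0)//.
  by apply: ger_powR; [rewrite NE0 ltW|lra].
have h2 : (N%:R ^- 2) `^ q * ((N%:R * E) ^+ 2) `^ q = (E ^+ 2) `^ q.
  rewrite -powRM ?invr_ge0 ?exprn_ge0 ?mulr_ge0//; congr (_ `^ _).
  by field; rewrite gt_eqF.
have h3 : (N%:R ^- 2) `^ q * (N%:R * E) <= (E ^+ 2) `^ q.
  by rewrite -h2 ler_wpM2l// powR_ge0.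
have -> : B * (N%:R ^- 2) `^ q * (N%:R * (n%:R * E)) =
  n%:R * B * ((N%:R ^- 2) `^ q * (N%:R * E)) by ring.
apply: (@le_trans _ _ (n%:R * B * (E ^+ 2) `^ q)).
  by rewrite ler_wpM2l// mulr_ge0.
by rewrite ler_wpM2r// ler_wpM2r// ler_peMl//; lra.
Qed.

End Interpolation.

(** * Powers of [K] and the interpolated gradient *)

Section ParabolicHolder.
Context {R : realType} {n : nat} (cm cp T sigma nf nphi um up : R).
Hypotheses (hc : 0 < cm) (hcp : cm <= cp) (hsigma : nash_exponent n cm cp sigma).
Local Notation adm N K phi dphi ddphi f u :=
  (@admissible R n cm cp T nf nphi um up N K phi dphi ddphi f u).
Local Notation q := (sigma / 2).
Local Notation hexp K t := (tscale K t `^ (- (q + 2^-1))).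

Let sg01 : 0 < sigma < 1. Proof. by case: hsigma. Qed.

(** The ratio [m / tscale K m] is the maximum of 1 and [K * m]. For [K > 1] its power [p] is raised
    to [r]; for [K <= 1] it is bounded in terms of [T], which the summand 1 accounts for. *)
Lemma tscale_ratio (K m p r : R) : 0 < K -> 0 < m -> m <= T -> 0 <= p -> p <= 1 ->
  p <= r -> m `^ p * tscale K m `^ (- p) <= (1 + T) * (K `^ r + 1).
Proof.
move=> K0 m0 mT p0 p1 pr; have h0 := tscale_gt0 K m K0 m0.
have T0 : 0 < T by apply: lt_le_trans mT.
have -> : m `^ p * tscale K m `^ (- p) = (m / tscale K m) `^ p.
  rewrite powRM ?invr_ge0 ?(ltW m0) ?(ltW h0)//; congr (_ * _).
  by rewrite -[in RHS]powR_inv1 ?(ltW h0)// -powRrM mulN1r.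
have Kr0 : 0 <= K `^ r by exact: powR_ge0.
have x0 : 0 <= m / tscale K m by rewrite divr_ge0 ?ltW.
have T1 : 1 <= 1 + T by lra.
have T10 : 0 <= 1 + T by lra.
have [K1|K1] := leP K 1.
  have h : m / tscale K m <= 1 + T.
    rewrite ler_pdivrMr// /tscale; have [h|h] := leP m K^-1.
      by rewrite ler_peMl ?ltW//; lra.
    rewrite ler_pdivlMr//; apply: (@le_trans _ _ m); last by lra.
    by rewrite ler_piMr ?(ltW m0).
  apply: (le_trans (powR_le_pos _ _ p x0 h p0)).
  apply: (@le_trans _ _ (1 + T)).
    by rewrite -[leRHS]powRr1//; apply: ler_powR.
  by rewrite -[leLHS]mulr1 ler_wpM2l//; lra.
have h : m / tscale K m <= (1 + T) * K.
  rewrite ler_pdivrMr// /tscale; have [h|h] := leP m K^-1.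
    rewrite ler_peMl ?(ltW m0)//; have : 1 * 1 <= (1 + T) * K by apply: ler_pM => //; exact: ltW.
    by rewrite mulr1.
  by rewrite mulfK ?gt_eqF//; lra.
apply: (le_trans (powR_le_pos _ _ p x0 h p0)).
rewrite powRM ?(ltW K0)//; apply: ler_pM; try exact: powR_ge0.
  by rewrite -[leRHS]powRr1//; apply: ler_powR.
apply: (@le_trans _ _ (K `^ r)); last by lra.
by apply: ler_powR => //; exact: ltW.
Qed.

Lemma interpolate_grad_holder : exists2 C : R, 0 <= C &
  forall N K phi dphi ddphi f u, adm N K phi dphi ddphi f u ->
  forall (t s : R) i z z', 0 < t <= T -> 0 < s <= T ->
  `|interpolate (lgrad (i, true) (u t)) z - interpolate (lgrad (i, true) (u s)) z'| <=
  C * hexp K (Num.min t s) * (`|t - s| `^ q + (euclid (z - z') ^+ 2) `^ q).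
Proof.
have [CS CS0 hS] := grad_holder_space cm cp T sigma nf nphi um up hc hcp hsigma.
have [CT CT0 hT] := grad_holder_time cm cp T sigma nf nphi um up hc hcp hsigma.
have /andP[sg0 sg1] := sg01; have q0 : 0 < q by rewrite divr_gt0.
have q1 : q < 2^-1 by lra.
have main N K phi dphi ddphi f u : adm N K phi dphi ddphi f u ->
  forall (t s : R) i z z', 0 < s -> s <= t -> t <= T ->
  `|interpolate (lgrad (i, true) (u t)) z - interpolate (lgrad (i, true) (u s)) z'| <=
  (9 * n%:R * CS + CT) * hexp K s * ((t - s) `^ q + (euclid (z - z') ^+ 2) `^ q).
  move=> ad t s i z z' s0 st tT.
  have [N0 K0 _ _ _ _ _ _ _] := ad.
  set H := hexp K s; have H0 : 0 <= H by exact: powR_ge0.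
  set P1 := _ `^ q; set P2 := _ `^ q.
  have P10 : 0 <= P1 by exact: powR_ge0.
  have P20 : 0 <= P2 by exact: powR_ge0.
  have sT : 0 < s <= T by rewrite s0 (le_trans st).
  have h1 : `|interpolate (lgrad (i, true) (u s)) z - interpolate (lgrad (i, true) (u s)) z'|
     <= 9 * n%:R * (CS * H) * P2.
    apply: interpolate_holder => //; first by rewrite mulr_ge0.
    by move=> x y; apply: (hS _ _ _ _ _ _ _ ad).
  have h2 : `|interpolate (lgrad (i, true) (u t)) z - interpolate (lgrad (i, true) (u s)) z|
     <= CT * H * P1.
    rewrite interpolate_sub; apply: interpolate_norm => x.
    exact: (hT _ _ _ _ _ _ _ ad).
  set a := interpolate _ z in h2 *; set b := interpolate _ z in h1 h2 *.
  set c := interpolate _ z' in h1 *.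
  have := ler_normD (a - b) (b - c); rewrite addrA subrK => h3.
  have h4 : 0 <= 9 * n%:R * CS * H * P1 by nneg.
  have h5 : 0 <= CT * H * P2 by nneg.
  lra.
exists (9 * n%:R * CS + CT) => [|N K phi dphi ddphi f u ad t s i z z' /andP[t0 tT] /andP[s0 sT]].
  by nneg.
have [st|/ltW ts] := leP s t.
  by rewrite (ger0_norm (x := t - s)) ?subr_ge0//; apply: (main _ _ _ _ _ _ _ ad).
rewrite distrC (distrC t) (ger0_norm (x := s - t)) ?subr_ge0//.
have -> : euclid (z - z') = euclid (z' - z).
  by congr Num.sqrt; apply: eq_bigr => j _; rewrite !mxE -sqrrN opprB.
exact: (main _ _ _ _ _ _ _ ad).
Qed.

End ParabolicHolder.

Section TorusDistance.
Context {R : realType} {n : nat}.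

(** The power is inverted first, so that the claim becomes a lower bound for every representative,
    and hence for their infimum. *)
Lemma euclid_le_torus_dist (z y : 'rV[R]_n) (A B sigma : R) : 0 < sigma -> 0 <= A ->
  (forall k, B <= A * euclid (z - y + ivec R k) `^ sigma) ->
  B <= A * torus_dist z y `^ sigma.
Proof.
move=> sg0 A0 hk.
have sn : sigma != 0 by rewrite gt_eqF.
have [B0|B0] := leP B 0.
  by apply: (le_trans B0); rewrite mulr_ge0// powR_ge0.
have Apos : 0 < A.
  rewrite lt_neqAle A0 andbT; apply/eqP => e.
  by have := hk 0; rewrite -e mul0r leNgt B0.
have BA : 0 <= B / A by rewrite divr_ge0// ltW.
rewrite -ler_pdivrMl// mulrC.
have -> : B / A = ((B / A) `^ sigma^-1) `^ sigma by rewrite -powRrM mulVf// powRr1.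
apply: powR_le_pos; [exact: powR_ge0| |exact: ltW].
apply: lb_le_inf; first by exists (euclid (z - y + ivec R 0)), 0.
move=> _ [k _ <-].
have E0 : 0 <= euclid (z - y + ivec R k) by exact: sqrtr_ge0.
have -> : euclid (z - y + ivec R k) = (euclid (z - y + ivec R k) `^ sigma) `^ sigma^-1.
  by rewrite -powRrM mulfV// powRr1.
apply: powR_le_pos => //; last by rewrite invr_ge0 ltW.
by rewrite ler_pdivrMr// mulrC.
Qed.

Lemma interpolate_periodic {N} (g : 'rV['I_N.-1.+1]_n -> R) z k : (0 < N)%N ->
  interpolate g (z + ivec R k) = interpolate g z.
Proof. exact: (interp_periodic (fun _ : R => g) 0). Qed.

End TorusDistance.

(** * The weighted norms *)

Section Norms.
Context {R : realType} {n : nat} (cm cp T sigma nf nphi um up : R).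
Hypotheses (hc : 0 < cm) (hcp : cm <= cp) (hsigma : nash_exponent n cm cp sigma).
Local Notation adm N K phi dphi ddphi f u :=
  (@admissible R n cm cp T nf nphi um up N K phi dphi ddphi f u).
Local Notation q := (sigma / 2).
Local Notation hexp K t := (tscale K t `^ (- (q + 2^-1))).

Let sg01 : 0 < sigma < 1. Proof. by case: hsigma. Qed.

Lemma min_sqrt (t s : R) : Num.min (Num.sqrt t) (Num.sqrt s) = Num.sqrt (Num.min t s).
Proof.
have [ts|/ltW st] := leP t s.
  by rewrite (min_idPl _)// ler_wsqrtr.
by rewrite (min_idPr _)// ler_wsqrtr.
Qed.

Lemma sqrt_powR (m : R) : 0 <= m -> Num.sqrt m `^ (1 + sigma) = m `^ (q + 2^-1).
Proof.
by move=> m0; rewrite -powR12_sqrt// -powRrM; congr (_ `^ _); field.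
Qed.

Lemma exponent_le : q + 2^-1 <= 1 + sigma^-1.
Proof.
have /andP[s0 s1] := sg01.
have h : 0 < sigma^-1 by rewrite invr_gt0.
lra.
Qed.

Lemma holder_grad_bound : 0 < T -> exists2 C : R, 0 <= C &
  forall N K phi dphi ddphi f u, adm N K phi dphi ddphi f u ->
  (holder_grad N T sigma (interp u) <= (C * (K `^ (1 + sigma^-1) + 1))%:E)%E.
Proof.
move=> T0.
have [C C0 hC] := interpolate_grad_holder cm cp T sigma nf nphi um up hc hcp hsigma.
have /andP[sg0 sg1] := sg01.
exists (2 * C * (1 + T)) => [|N K phi dphi ddphi f u ad].
  by apply: mulr_ge0; [apply: mulr_ge0|lra].
have [N0 K0 _ _ _ _ _ _ _] := ad.
have KR : 0 <= K `^ (1 + sigma^-1) + 1 by rewrite addr_ge0// powR_ge0.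
apply: ge_ereal_sup => _ [[t z] [[s y] [/= /andP[t0 tT] /andP[s0 sT] _ ->]]].
rewrite lee_fin min_sqrt /=.
set m := Num.min t s.
have m0 : 0 <= m by rewrite le_min t0.
have RHS0 : 0 <= 2 * C * (1 + T) * (K `^ (1 + sigma^-1) + 1).
  by apply: mulr_ge0 => //; apply: mulr_ge0; [apply: mulr_ge0|lra].
(* If one of the times is 0 the weight in front of the quotient vanishes. *)
move: m0; rewrite le_eqVlt => /predU1P[<-|m0].
  by rewrite sqrtr0 powR0 ?mul0r//; lra.
have tpos : 0 < t by move: m0; rewrite lt_min => /andP[].
have spos : 0 < s by move: m0; rewrite lt_min => /andP[].
have mT : m <= T by rewrite ge_min tT.
rewrite sqrt_powR ?(ltW m0)//.
set G := grad_diff _ _ _ _; set D := pdist _ _.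
have D0 : 0 <= D by rewrite /D /pdist le_max sqrtr_ge0.
have H0 : 0 <= hexp K m by exact: powR_ge0.
have hG : G <= 2 * C * hexp K m * D `^ sigma.
  rewrite /G /grad_diff; apply: bigmax_le => [|i _].
    by rewrite mulr_ge0 ?powR_ge0// mulr_ge0// mulr_ge0.
  rewrite !cgrad_interp//.
  have p1 : `|t - s| `^ q <= D `^ sigma.
    have -> : `|t - s| `^ q = Num.sqrt `|t - s| `^ sigma.
      by rewrite -powR12_sqrt// -powRrM mulrC.
    apply: powR_le_pos; [exact: sqrtr_ge0| |exact: ltW].
    by rewrite /D /pdist le_max lexx.
  have p2 : torus_dist z y `^ sigma <= D `^ sigma.
    apply: powR_le_pos; [| |exact: ltW].
      apply: lb_le_inf; first by exists (euclid (z - y + ivec R 0)), 0.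
      by move=> _ [k _ <-]; exact: sqrtr_ge0.
    by rewrite /D /pdist le_max lexx orbT.
  set L := `|_|.
  have CH0 : 0 <= C * hexp K m by rewrite mulr_ge0.
  (* Only the spatial term depends on the representative; by periodicity [z] may be translated by
     any integer vector on the left. *)
  have : L - C * hexp K m * `|t - s| `^ q <= C * hexp K m * torus_dist z y `^ sigma.
    apply: euclid_le_torus_dist => // k.
    have := hC _ _ _ _ _ _ _ ad t s i (z + ivec R k) y.
    rewrite interpolate_periodic// tpos spos tT sT => /(_ isT isT).
    have -> : (euclid (z + ivec R k - y) ^+ 2) `^ q = euclid (z - y + ivec R k) `^ sigma.
      rewrite [z + _ - y]addrAC -(powR_mulrn 2) ?sqrtr_ge0// -powRrM.
      by congr (_ `^ _); field.
    by rewrite -/m -/L; lra.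
  have : C * hexp K m * `|t - s| `^ q <= C * hexp K m * D `^ sigma by rewrite ler_wpM2l.
  have : C * hexp K m * torus_dist z y `^ sigma <= C * hexp K m * D `^ sigma.
    by rewrite ler_wpM2l.
  lra.
have quot : G / D `^ sigma <= 2 * C * hexp K m.
  (* Division by zero returns 0, for which the bound is trivial. *)
  have [e|Dn] := eqVneq (D `^ sigma) 0.
    by rewrite e invr0 mulr0 mulr_ge0// mulr_ge0.
  by rewrite ler_pdivrMr// lt_neqAle eq_sym Dn powR_ge0.
apply: (@le_trans _ _ (m `^ (q + 2^-1) * (2 * C * hexp K m))).
  by rewrite ler_wpM2l// powR_ge0.
have -> : m `^ (q + 2^-1) * (2 * C * hexp K m) = 2 * C * (m `^ (q + 2^-1) * hexp K m).
  by ring.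
rewrite -[leRHS]mulrA ler_wpM2l ?mulr_ge0//; apply: tscale_ratio => //; try lra.
exact: exponent_le.
Qed.

Lemma holder_time_bound : 0 < T -> exists2 C : R, 0 <= C &
  forall N K phi dphi ddphi f u, adm N K phi dphi ddphi f u ->
  (holder_time T sigma u <= (C * (K `^ (1 + sigma^-1) + 1))%:E)%E.
Proof.
move=> T0.
have [C C0 hC] := time_holder cm cp T sigma nf nphi um up hc hcp hsigma.
have /andP[sg0 sg1] := sg01.
exists (C * (1 + T)) => [|N K phi dphi ddphi f u ad].
  by apply: mulr_ge0 => //; lra.
have [N0 K0 _ _ _ _ _ _ _] := ad.
have KR : 0 <= K `^ (1 + sigma^-1) + 1 by rewrite addr_ge0// powR_ge0.
apply: ge_ereal_sup => _ [t [s [x [/andP[t0 tT] /andP[s0 sT] ts ->]]]].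
rewrite lee_fin min_sqrt.
set m := Num.min t s.
have m0 : 0 <= m by rewrite le_min t0.
move: m0; rewrite le_eqVlt => /predU1P[<-|m0].
  rewrite sqrtr0 powR0 ?mul0r; last by lra.
  by apply: mulr_ge0 => //; apply: mulr_ge0 => //; lra.
have tpos : 0 < t by move: m0; rewrite lt_min => /andP[].
have spos : 0 < s by move: m0; rewrite lt_min => /andP[].
have mT : m <= T by rewrite ge_min tT.
rewrite sqrt_powR ?(ltW m0)//.
have -> : (1 + sigma) / 2 = q + 2^-1 by field.
have hb : `|u t x - u s x| <= C * hexp K m * `|t - s| `^ (q + 2^-1).
  rewrite /m; have [hts|/ltW hst] := leP t s.
    rewrite distrC (distrC t) (ger0_norm (x := s - t)) ?subr_ge0//.
    exact: (hC _ _ _ _ _ _ _ ad).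
  by rewrite (ger0_norm (x := t - s)) ?subr_ge0//; apply: (hC _ _ _ _ _ _ _ ad).
have tspos : 0 < `|t - s| `^ (q + 2^-1) by rewrite powR_gt0// normr_gt0 subr_eq0.
apply: (@le_trans _ _ (m `^ (q + 2^-1) * (C * hexp K m))).
  by rewrite ler_wpM2l ?powR_ge0// ler_pdivrMr.
have -> : m `^ (q + 2^-1) * (C * hexp K m) = C * (m `^ (q + 2^-1) * hexp K m) by ring.
rewrite -[leRHS]mulrA ler_wpM2l//; apply: tscale_ratio => //; try lra.
exact: exponent_le.
Qed.

(** Multiplied by [sqrt t], the bound of [grad_bound] is the power 1/2 of the ratio in
    [tscale_ratio]. The two conclusions are the choices [r = 1 / sigma] and [r = 1 + 1 / sigma]. *)
Lemma lgrad_bound : 0 < T -> exists2 C : R, 0 <= C &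
  forall N K phi dphi ddphi f u, adm N K phi dphi ddphi f u ->
  forall e (t : R) x, 0 < t <= T ->
  `|lgrad e (u t) x| <= C * t `^ (- 2^-1) * (K `^ sigma^-1 + 1) /\
  Num.sqrt t * `|lgrad e (u t) x| <= C * (K `^ (1 + sigma^-1) + 1).
Proof.
move=> T0.
have [C C0 hC] := grad_bound cm cp T sigma nf nphi um up hc hcp hsigma.
have /andP[sg0 sg1] := sg01.
exists (C * (1 + T)) => [|N K phi dphi ddphi f u ad e t x tT].
  by apply: mulr_ge0 => //; lra.
have [N0 K0 _ _ _ _ _ _ _] := ad.
have /andP[t0 tT'] := tT.
have hb := hC _ _ _ _ _ _ _ ad t e x tT.
have p2 (y : R) : 0 < y -> y `^ (- 2^-1) = (Num.sqrt y)^-1.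
  by move=> y0; rewrite powRN powR12_sqrt// ltW.
have ht := tscale_gt0 K t K0 t0.
have si : 1 <= sigma^-1 by rewrite -[leLHS]invr1 lef_pV2 ?posrE// ltW.
have i2 : 2^-1 <= 1 :> R by lra.
have key r : 2^-1 <= r -> Num.sqrt t * (C / Num.sqrt (tscale K t)) <=
    C * (1 + T) * (K `^ r + 1).
  move=> hr; have := tscale_ratio T K t 2^-1 r K0 t0 tT' ltac:(by rewrite invr_ge0) i2 hr.
  rewrite powR12_sqrt ?(ltW t0)// p2// => h.
  by rewrite mulrCA -[leRHS]mulrA ler_wpM2l.
have st0 : 0 < Num.sqrt t by rewrite sqrtr_gt0.
split; last first.
  apply: (@le_trans _ _ (Num.sqrt t * (C / Num.sqrt (tscale K t)))).
    by rewrite ler_pM2l.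
  by apply: key; lra.
rewrite p2// mulrAC ler_pdivlMr// mulrC.
apply: (@le_trans _ _ (Num.sqrt t * (C / Num.sqrt (tscale K t)))).
  by rewrite ler_pM2l.
by apply: key; lra.
Qed.

End Norms.

(** * From the smoothness classes to [admissible] *)

Section Reduction.
Context {R : realType}.

Lemma supnorm_ge (a b : R) (h : R -> R) r : continuous h -> a <= r <= b ->
  `|h r| <= supnorm a b h.
Proof.
move=> ch rab; have ab : a <= b by case/andP: rab => [/le_trans]; exact.
have cn : {within `[a, b], continuous (fun r => `|h r|)}.
  apply: continuous_subspaceT => x.
  by apply: (@continuous_comp _ _ _ h (fun y : R => `|y|)); [exact: ch|exact: norm_continuous].
have [c _ hc] := EVT_max ab cn.
apply: ub_le_sup; last by exists r => //=; rewrite in_itv.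
by exists `|h c| => _ [s sab <-]; apply: hc; rewrite /= in sab.
Qed.

Lemma Ck_is_derive k (h : R -> R) j (r : R) : Ck k h -> (j < k)%N ->
  is_derive r 1 (derive1n j h) (derive1n j.+1 h r).
Proof.
move=> [hd _] jk; have := derivableP (hd j jk r).
by rewrite -derive1E derive1nS.
Qed.

Lemma Ck_continuous k (h : R -> R) j : Ck k h -> (j < k)%N -> continuous (derive1n j h).
Proof.
move=> [hd _] jk r; apply: differentiable_continuous; apply/derivable1_diffP.
exact: hd.
Qed.

End Reduction.

Theorem corollary4p3 (R : realType) (n : nat) (cm cp T sigma nf nphi um up : R)
    (hn : (0 < n)%N) (hT : 0 < T) (hu : um < up) (hc : 0 < cm)
    (hsigma : nash_exponent n cm cp sigma) :
  exists C : R,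
    forall (N : nat) (K : R) (phi f : R -> R) (u : R -> lattice_torus N n -> R),
    (0 < N)%N -> 0 < K ->
    Ck 5 phi -> {homo phi : x y / x < y} ->
    is_min_on um up (derive1n 1 phi) cm ->
    is_max_on um up (derive1n 1 phi) cp ->
    supnorm um up (derive1n 2 phi) = nphi ->
    Ck 1 f -> (exists M : R, forall r : R, M < `|r| -> r * f r < 0) ->
    supnorm um up f = nf ->
    is_solution T K phi f u ->
    (forall (t : R) x, 0 <= t <= T -> um <= u t x <= up) ->
    [/\ (star_norm T sigma u <= (C * (K `^ (1 + sigma^-1) + 1))%:E)%E,
        forall (e : dir n) (t : R) (x : lattice_torus N n), 0 < t <= T ->
          `|lgrad e (u t) x| <= C * t `^ (- 2^-1) * (K `^ sigma^-1 + 1) &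
        (holder_grad N T sigma (interp u) <= (C * (K `^ (1 + sigma^-1) + 1))%:E)%E].
Proof.
(* If [cp < cm], no [phi] has minimum [cm] and maximum [cp], and any constant will do. *)
have [hcp|hcp] := leP cm cp; last first.
  exists 0 => N K phi f u _ _ _ _ [[r rab rE] _] [_ hmax].
  by have := hmax r rab; rewrite rE leNgt hcp.
have [C1 C10 h1] := holder_grad_bound cm cp T sigma nf nphi um up hc hcp hsigma hT.
have [C2 C20 h2] := holder_time_bound cm cp T sigma nf nphi um up hc hcp hsigma hT.
have [C3 C30 h3] := lgrad_bound cm cp T sigma nf nphi um up hc hcp hsigma hT.
exists (C1 + C2 + C3) => N K phi f u N0 K0 Cphi _ [_ hmin] [_ hmax] nphiE Cf _ nfE [cu du] ru.
have cf : continuous f by exact: (Ck_continuous 1 f 0 Cf).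
have ad : @admissible R n cm cp T nf nphi um up N K phi (derive1n 1 phi) (derive1n 2 phi) f u.
  split.
  - exact: N0.
  - exact: K0.
  - by move=> r; apply: (Ck_is_derive 5 phi 0).
  - by move=> r; apply: (Ck_is_derive 5 phi 1).
  - by move=> r rab; rewrite hmin// hmax.
  - by move=> r rab; rewrite -nphiE; apply: supnorm_ge => //; apply: (Ck_continuous 5).
  - by move=> r rab; rewrite -nfE; apply: supnorm_ge.
  - by move=> x; split=> [|t tT]; [exact: cu|exact: du].
  - exact: ru.
have X1 := h1 _ _ _ _ _ _ _ ad; have X2 := h2 _ _ _ _ _ _ _ ad.
have X3 := h3 _ _ _ _ _ _ _ ad.
set KP := K `^ (1 + sigma^-1) + 1 in X1 X2 X3 *.
have KP0 : 0 <= KP by rewrite addr_ge0// powR_ge0.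
have X4 : (grad_sup N T (interp u) <= (C3 * KP)%:E)%E.
  apply: bigmax_le => [|i _]; first by rewrite lee_fin mulr_ge0.
  apply: ge_ereal_sup => _ [[t z] /= /andP[t0 tT] <-]; rewrite lee_fin cgrad_interp//=.
  (* At time 0 the weight [sqrt t] vanishes. At positive times interpolation is an average over
     vertices, so the lattice bound carries over. *)
  rewrite /= in t0 tT; move: t0; rewrite le_eqVlt => /predU1P[<-|t0]; first by rewrite sqrtr0 mul0r mulr_ge0.
  have st0 : 0 < Num.sqrt t by rewrite sqrtr_gt0.
  rewrite mulrC -ler_pdivlMr//; apply: interpolate_norm => x.
  by rewrite ler_pdivlMr// mulrC; apply: (X3 (i, true) t x _).2; rewrite t0.
split.
- by rewrite !mulrDl !EFinD; apply: leeD => //; apply: leeD.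
- move=> e t x tT; apply: (le_trans (X3 e t x tT).1).
  rewrite ler_wpM2r ?addr_ge0 ?powR_ge0// ler_wpM2r ?powR_ge0// lerDr addr_ge0//.
- apply: (le_trans X1); rewrite lee_fin ler_wpM2r// -addrA lerDl addr_ge0//.
Qed.
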